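(* Assume $L_z>H$. Discretize the $t$-integrals in the definition of $U^{\text c}_{\text{Fourier}}$ by the trapezoidal rule with mesh size $\pi/(\alpha L_z)$. Then $$U^{\text c}_{\text{Fourier}}=\frac{2\pi}{L_xL_yL_z}\sum_{\boldsymbol k\neq\boldsymbol 0}\frac{e^{-k^2/(4\alpha^2)}}{k^2}\,\rho_{\boldsymbol k}\,\bar\rho^{M}_{\boldsymbol k}-\frac{\alpha}{\sqrt\pi}\sum_{i=1}^Nq_i^2+U^M_{\text{IBC}}+U^M_{\text{ELC}}+U^M_{\text{err}},$$ where $\boldsymbol k=2\pi(n_x/L_x,n_y/L_y,n_z/L_z)$ with $(n_x,n_y,n_z)\in\mathbb Z^3\setminus\{\boldsymbol 0\}$, $k=|\boldsymbol k|$, $$\rho_{\boldsymbol k}:=\sum_{i=1}^Nq_ie^{\mathrm i\boldsymbol k\cdot\boldsymbol r_i},\qquad \bar\rho^{M}_{\boldsymbol k}:=\sum_{j=1}^Nq_j\left[e^{-\mathrm i\boldsymbol k\cdot\boldsymbol r_j}+\sum_{l=1}^M\left(\gamma_+^{(l)}e^{-\mathrm i\boldsymbol k\cdot\boldsymbol r_{j+}^{(l)}}+\gamma_-^{(l)}e^{-\mathrm i\boldsymbol k\cdot\boldsymbol r_{j-}^{(l)}}\right)\right],$$ $$U^M_{\text{IBC}}:=\frac{2\pi}{L_xL_yL_z}\left(\sum_{i=1}^Nq_iz_i\right)\sum_{j=1}^Nq_j\left[z_j+\sum_{l=1}^M\left(\gamma_+^{(l)}z_{j+}^{(l)}+\gamma_-^{(l)}z_{j-}^{(l)}\right)\right],$$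 $$U^M_{\text{ELC}}:=\frac{2\pi}{L_xL_y}\sum_{i,j=1}^Nq_iq_j\sum_{\boldsymbol h\ne\boldsymbol 0}\frac{e^{\mathrm i\boldsymbol h\cdot\boldsymbol r_{ij}}}{h}\,\frac{\cosh(hz_{ij})+\mathcal G_{ij}(h)}{1-e^{hL_z}},$$ $$\mathcal G_{ij}(h):=\sum_{l=1}^M\left[\gamma_+^{(l)}\cosh\!\big(h(z_i-z_{j+}^{(l)})\big)+\gamma_-^{(l)}\cosh\!\big(h(z_i-z_{j-}^{(l)})\big)\right],$$ and $U^M_{\text{err}}$ is the remainder error term. The last two terms satisfy $$\left|U^M_{\text{ELC}}\right|=\mathcal O\!\left(e^{-\frac{2\pi(L_z-H)}{\max\{L_x,L_y\}}}+\sum_{l=1}^M\left(|\gamma_+^{(l)}|+|\gamma_-^{(l)}|\right)e^{-\frac{2\pi(L_z-(l+1)H)}{\max\{L_x,L_y\}}}\right)$$ and $$\left|U^M_{\text{err}}\right|=\mathcal O\!\left(e^{-\alpha^2(L_z-H)^2}+\sum_{l=1}^M\left(|\gamma_+^{(l)}|+|\gamma_-^{(l)}|\right)e^{-\alpha^2(L_z-(l+1)H)^2}\right).$$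
   Context: Setting (three-layer sandwich model with image charges truncated at reflection level $M\ge1$): $L_x,L_y,H,\alpha>0$. $N$ point charges $q_1,\dots,q_N\in\mathbb R$ with charge neutrality $\sum_iq_i=0$ lie at $\boldsymbol r_i=(x_i,y_i,z_i)$ inside the central layer ($0<z_i<H$); the system is periodic in $x,y$ with periods $L_x,L_y$. Dielectric interfaces lie at $z=0$ and $z=H$, with permittivities $\varepsilon_{\text{top}},\varepsilon_{\text c},\varepsilon_{\text{bot}}$ in the top, central and bottom layers, and $\gamma_{\text{top}}=\frac{\varepsilon_{\text c}-\varepsilon_{\text{top}}}{\varepsilon_{\text c}+\varepsilon_{\text{top}}}$, $\gamma_{\text{bot}}=\frac{\varepsilon_{\text c}-\varepsilon_{\text{bot}}}{\varepsilon_{\text c}+\varepsilon_{\text{bot}}}$, with $|\gamma_{\text{top}}|,|\gamma_{\text{bot}}|\le1$. For $l\ge1$ the $l$-th order images of $q_j$ have positions $\boldsymbol r_{j\pm}^{(l)}=(x_j,y_j,z_{j\pm}^{(l)})$ with $$z_{j+}^{(l)}=(-1)^lz_j+2\lceil l/2\rceil H,\qquad z_{j-}^{(l)}=(-1)^lz_j-2\lfloor l/2\rfloor H,$$ and factors $\gamma_+^{(l)}=\gamma_{\text{top}}^{\lceil l/2\rceil}\gamma_{\text{bot}}^{\lfloor l/2\rfloor}$, $\gamma_-^{(l)}=\gamma_{\text{top}}^{\lfloor l/2\rfloor}\gamma_{\text{bot}}^{\lceil l/2\rceil}$. Write $\boldsymbol r_{ij}=\boldsymbol r_i-\boldsymbol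 r_j$, $z_{ij}=z_i-z_j$; $\boldsymbol h=2\pi(n_x/L_x,n_y/L_y,0)$ with $(n_x,n_y)\in\mathbb Z^2$, $h=|\boldsymbol h|$. The reciprocal-space part of the truncated energy (Ewald splitting parameter $\alpha$) is $$U^{\text c}_{\text{Fourier}}=\frac1{2\alpha L_xL_y}\sum_{i,j=1}^Nq_iq_j\sum_{\boldsymbol h\neq\boldsymbol 0}e^{\mathrm i\boldsymbol h\cdot\boldsymbol r_{ij}}\int_{-\infty}^\infty\frac{e^{-\frac{h^2}{4\alpha^2}-t^2}}{\frac{h^2}{4\alpha^2}+t^2}\,\Gamma_{ij}(t)\,dt-\frac{\alpha}{\sqrt\pi}\sum_{i=1}^Nq_i^2+\mathcal J_0,$$ $$\Gamma_{ij}(t)=e^{2\mathrm i\alpha z_{ij}t}+\sum_{l=1}^M\left[\gamma_+^{(l)}e^{2\mathrm i\alpha t(z_i-z_{j+}^{(l)})}+\gamma_-^{(l)}e^{2\mathrm i\alpha t(z_i-z_{j-}^{(l)})}\right],$$ $$\mathcal J_0=\frac1{2\alpha L_xL_y}\sum_{i,j=1}^Nq_iq_j\int_{-\infty}^\infty\frac{e^{-t^2}\Gamma_{ij}(t)-\Gamma_{ij}(0)}{t^2}\,dt,$$ where the integral in $\mathcal J_0$ is understood as a principal value at $t=0$ (equivalently, after summing over $i,j$, when neutrality removes the singularity). The remainder $U^M_{\text{err}}$ is what is left when the displayed explicit terms are subtracted from $U^{\text c}_{\text{Fourier}}$. The series defining $U^M_{\text{ELC}}$ is understood for those $L_z$ for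 which it converges (in particular for $L_z>(M+1)H$). The $\mathcal O(\cdot)$ estimates describe decay as $L_z$ grows, with the configuration and all other parameters (including $M$ and $\alpha$) fixed. *)

(* Defs.v *)
From mathcomp Require Import all_boot all_order all_algebra.
From mathcomp Require Import complex.
From mathcomp Require Import all_classical all_reals all_analysis.
Import Order.TTheory GRing.Theory Num.Theory.
Import numFieldNormedType.Exports.

Set Implicit Arguments.
Unset Strict Implicit.
Unset Printing Implicit Defensive.

Local Open Scope classical_set_scope.
Local Open Scope ring_scope.
Local Open Scope complex_scope.

(* Makes the Landau notations available at +oo. *)
Canonical pinfty_filter_on (R : numFieldType) : filter_on R :=
  FilterType (pinfty_nbhs R) _.

Section complex_analysis.
Context {R : realType}.

Definition expi (theta : R) : R[i] := cos theta +i* sin theta.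

Definition cosh (u : R) : R := (expR u + expR (- u)) / 2.

(* Extends a real-valued linear functional (sum, integral, limit) to
   complex-valued functions through real and imaginary parts. *)
Definition complexify {T : Type} (F : (T -> R) -> R) (f : T -> R[i]) : R[i] :=
  F (fun t => complex.Re (f t)) +i* F (fun t => complex.Im (f t)).

(* Unordered sum over D: sum of the positive parts minus sum of the negative
   parts. It is meaningful for absolutely summable families (csummable). *)
Definition rsum {T : choiceType} (D : set T) (f : T -> R) : R :=
  fine (\esum_(t in D) (Num.max (f t) 0)%:E) -
  fine (\esum_(t in D) (Num.max (- f t) 0)%:E).

Definition csum {T : choiceType} (D : set T) (f : T -> R[i]) : R[i] :=
  complexify (rsum D) f.

Definition csummable {T : choiceType} (D : set T) (f : T -> R[i]) : Prop :=
  summable D (fun t => (Normc.normc (f t))%:E).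

Definition cintegral (D : set R) (f : R -> R[i]) : R[i] :=
  complexify (fun g => \int[lebesgue_measure]_(t in D) g t) f.

Definition cintegrable (D : set R) (f : R -> R[i]) : Prop :=
  lebesgue_measure.-integrable D (fun t => (complex.Re (f t))%:E) /\
  lebesgue_measure.-integrable D (fun t => (complex.Im (f t))%:E).

Definition clim {T : Type} (F : set_system T) (f : T -> R[i]) : R[i] :=
  complexify (fun g => lim (g t @[t --> F])) f.

Definition ccvg {T : Type} (F : set_system T) (f : T -> R[i]) : Prop :=
  cvg ((complex.Re (f t) : R) @[t --> F]) /\
  cvg ((complex.Im (f t) : R) @[t --> F]).

(* Cauchy principal value at t = 0 of an integral over the whole line *)
Definition pv_integral (f : R -> R[i]) : R[i] :=
  clim (0 : R)^'+ (fun e : R => cintegral [set t | e < `|t|] f).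

Definition pv_integrable (f : R -> R[i]) : Prop :=
  (forall e : R, 0 < e -> cintegrable [set t | e < `|t|] f) /\
  ccvg (0 : R)^'+ (fun e : R => cintegral [set t | e < `|t|] f).

(* Trapezoidal rule on the whole line with mesh d; t = 0 is a node. *)
Definition trapezoid (d : R) (f : R -> R[i]) : R[i] :=
  d%:C * csum [set: int] (fun n : int => f (n%:~R * d)).

Definition trapezoid_summable (d : R) (f : R -> R[i]) : Prop :=
  csummable [set: int] (fun n : int => f (n%:~R * d)).

(* f with its value at 0 replaced by its limit there *)
Definition extend0 (f : R -> R[i]) (t : R) : R[i] :=
  if t == 0 then clim (0 : R)^' f else f t.

Definition vec3 (a b c : R) : 'rV[R]_3 := \row_i tnth [tuple a; b; c] i.

Definition dot (u v : 'rV[R]_3) : R := \sum_i u 0 i * v 0 i.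

(* Euclidean norm; the norm `|u| of a matrix is the sup norm. *)
Definition enorm (u : 'rV[R]_3) : R := Num.sqrt (dot u u).

End complex_analysis.

(* N charges in the central layer 0 < z < height *)
Record sandwich (R : realType) (N : nat) := Sandwich {
  Lx : R; Ly : R; height : R;
  eps_top : R; eps_c : R; eps_bot : R;
  charges : 'I_N -> R;
  xpos : 'I_N -> R; ypos : 'I_N -> R; zpos : 'I_N -> R }.

Section energies.
Context {R : realType} {N : nat}.
Variable S : sandwich R N.
Variable M : nat. (* reflection level *)

Local Notation Lx := (Lx S).
Local Notation Ly := (Ly S).
Local Notation H := (height S).
Local Notation q := (charges S).
Local Notation x := (xpos S).
Local Notation y := (ypos S).
Local Notation z := (zpos S).

Definition gamma_top : R := (eps_c S - eps_top S) / (eps_c S + eps_top S).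
Definition gamma_bot : R := (eps_c S - eps_bot S) / (eps_c S + eps_bot S).

(* uphalf l is the ceiling and l./2 the floor of l / 2. *)
Definition gamma_p (l : nat) : R := gamma_top ^+ uphalf l * gamma_bot ^+ l./2.
Definition gamma_m (l : nat) : R := gamma_top ^+ l./2 * gamma_bot ^+ uphalf l.

Definition z_p (l : nat) (j : 'I_N) : R :=
  (-1) ^+ l * z j + 2 * (uphalf l)%:R * H.
Definition z_m (l : nat) (j : 'I_N) : R :=
  (-1) ^+ l * z j - 2 * (l./2)%:R * H.

Definition rvec (i : 'I_N) : 'rV[R]_3 := vec3 (x i) (y i) (z i).
Definition rvec_p (l : nat) (j : 'I_N) : 'rV[R]_3 := vec3 (x j) (y j) (z_p l j).
Definition rvec_m (l : nat) (j : 'I_N) : 'rV[R]_3 := vec3 (x j) (y j) (z_m l j).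

Definition hvec (n : int * int) : 'rV[R]_3 :=
  (2 * pi) *: vec3 (n.1%:~R / Lx) (n.2%:~R / Ly) 0.
Definition hnorm (n : int * int) : R := enorm (hvec n).

Definition nonzero2 : set (int * int) := [set n | n != (0, 0)].

Section fourier.
Variable alpha : R.

Definition GammaM (i j : 'I_N) (t : R) : R[i] :=
  expi (2 * alpha * (z i - z j) * t) +
  \sum_(1 <= l < M.+1)
    ((gamma_p l)%:C * expi (2 * alpha * t * (z i - z_p l j)) +
     (gamma_m l)%:C * expi (2 * alpha * t * (z i - z_m l j))).

Definition fourier_integrand (i j : 'I_N) (n : int * int) (t : R) : R[i] :=
  (expR (- (hnorm n ^+ 2 / (4 * alpha ^+ 2)) - t ^+ 2) /
     (hnorm n ^+ 2 / (4 * alpha ^+ 2) + t ^+ 2))%:C * GammaM i j t.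

Definition fourier_term (i j : 'I_N) (n : int * int) : R[i] :=
  expi (dot (hvec n) (rvec i - rvec j)) *
  cintegral [set: R] (fourier_integrand i j n).

Definition J0_integrand (i j : 'I_N) (t : R) : R[i] :=
  ((expR (- t ^+ 2))%:C * GammaM i j t - GammaM i j 0) / (t ^+ 2)%:C.

Definition J0 : R[i] :=
  (1 / (2 * alpha * Lx * Ly))%:C *
  \sum_i \sum_j (q i * q j)%:C * pv_integral (J0_integrand i j).

Definition U_self : R[i] := (alpha / Num.sqrt pi * \sum_i q i ^+ 2)%:C.

Definition U_Fourier : R[i] :=
  (1 / (2 * alpha * Lx * Ly))%:C *
    (\sum_i \sum_j (q i * q j)%:C * csum nonzero2 (fourier_term i j))
  - U_self + J0.

Definition U_Fourier_converges : Prop :=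
  forall i j : 'I_N,
    [/\ forall n, nonzero2 n ->
          cintegrable [set: R] (fourier_integrand i j n),
        csummable nonzero2 (fourier_term i j) &
        pv_integrable (J0_integrand i j)].

Definition mesh (Lz : R) : R := pi / (alpha * Lz).

Definition fourier_term_trapezoid (Lz : R) (i j : 'I_N) (n : int * int) :
    R[i] :=
  expi (dot (hvec n) (rvec i - rvec j)) *
  trapezoid (mesh Lz) (fourier_integrand i j n).

(* Only after the summation over i and j does neutrality remove the
   singularity at t = 0, which is a node. *)
Definition J0_total_integrand (t : R) : R[i] :=
  \sum_i \sum_j (q i * q j)%:C * J0_integrand i j t.

Definition J0_trapezoid (Lz : R) : R[i] :=
  (1 / (2 * alpha * Lx * Ly))%:C *
  trapezoid (mesh Lz) (extend0 J0_total_integrand).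

(* U_Fourier with every t-integral replaced by the trapezoidal rule *)
Definition U_trapezoid (Lz : R) : R[i] :=
  (1 / (2 * alpha * Lx * Ly))%:C *
    (\sum_i \sum_j
       (q i * q j)%:C * csum nonzero2 (fourier_term_trapezoid Lz i j))
  - U_self + J0_trapezoid Lz.

Definition U_trapezoid_converges (Lz : R) : Prop :=
  [/\ forall (i j : 'I_N) n, nonzero2 n ->
        trapezoid_summable (mesh Lz) (fourier_integrand i j n),
      forall i j : 'I_N, csummable nonzero2 (fourier_term_trapezoid Lz i j),
      ccvg (0 : R)^' J0_total_integrand &
      trapezoid_summable (mesh Lz) (extend0 J0_total_integrand)].

End fourier.

Definition kvec (Lz : R) (n : int * int * int) : 'rV[R]_3 :=
  (2 * pi) *: vec3 (n.1.1%:~R / Lx) (n.1.2%:~R / Ly) (n.2%:~R / Lz).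

Definition nonzero3 : set (int * int * int) := [set n | n != (0, 0, 0)].

Definition rho (k : 'rV[R]_3) : R[i] :=
  \sum_i (q i)%:C * expi (dot k (rvec i)).

Definition rhobar (k : 'rV[R]_3) : R[i] :=
  \sum_j (q j)%:C *
    (expi (- dot k (rvec j)) +
     \sum_(1 <= l < M.+1)
       ((gamma_p l)%:C * expi (- dot k (rvec_p l j)) +
        (gamma_m l)%:C * expi (- dot k (rvec_m l j)))).

Definition kterm (alpha Lz : R) (n : int * int * int) : R[i] :=
  let k := kvec Lz n in
  (expR (- (enorm k ^+ 2 / (4 * alpha ^+ 2))) / enorm k ^+ 2)%:C *
  rho k * rhobar k.

Definition U_reciprocal (alpha Lz : R) : R[i] :=
  (2 * pi / (Lx * Ly * Lz))%:C * csum nonzero3 (kterm alpha Lz).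

Definition U_IBC (Lz : R) : R[i] :=
  (2 * pi / (Lx * Ly * Lz) * (\sum_i q i * z i) *
   \sum_j q j * (z j + \sum_(1 <= l < M.+1)
                         (gamma_p l * z_p l j + gamma_m l * z_m l j)))%:C.

Definition calG (i j : 'I_N) (h : R) : R :=
  \sum_(1 <= l < M.+1) (gamma_p l * cosh (h * (z i - z_p l j)) +
                        gamma_m l * cosh (h * (z i - z_m l j))).

Definition ELC_term (Lz : R) (i j : 'I_N) (n : int * int) : R[i] :=
  let h := hnorm n in
  expi (dot (hvec n) (rvec i - rvec j)) / h%:C *
  ((cosh (h * (z i - z j)) + calG i j h) / (1 - expR (h * Lz)))%:C.

Definition U_ELC (Lz : R) : R[i] :=
  (2 * pi / (Lx * Ly))%:C *
  \sum_i \sum_j (q i * q j)%:C * csum nonzero2 (ELC_term Lz i j).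

Definition U_ELC_converges (Lz : R) : Prop :=
  forall i j : 'I_N, csummable nonzero2 (ELC_term Lz i j).

Definition U_err (alpha Lz : R) : R[i] :=
  U_Fourier alpha -
  (U_reciprocal alpha Lz - U_self alpha + U_IBC Lz + U_ELC Lz).

End energies.

(* Main.v *)
(* Both the Fourier terms and [J0] are sums, over images at vertical distance [zeta], of integrals of an even
   kernel against a cosine of frequency [b = 2 alpha zeta]: the kernel [exp (- a^2 - t^2) / (a^2 + t^2)] with
   [a = h / (2 alpha)] for [h <> 0] and, since neutrality allows one to subtract its value at [b = 0], the
   function [exp (- t^2) (cos (b t) - 1) / t^2] for [h = 0]; the sine parts are odd and vanish. By Poisson
   summation the trapezoidal rule of mesh [d] replaces the integral [I(b)] by the sum of all
   [I(b + 2 pi m / d)], where [2 pi / d = 2 alpha Lz].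

   Solving a second-order differential equation in [b] gives [I(b) = (pi / a) exp (- a |b|)] in the first
   case and [I(b) = - pi |b| + 2 sqrt pi] in the second, both up to [exp (- b^2 / 4)]. Summed over [m <> 0],
   the exponentials form the geometric series [U_ELC]; in the second case the subtracted [1] leaves second
   differences of [I], in which the affine part cancels. What remains is [U_err], of size
   [exp (- (alpha (Lz - |zeta|))^2)] with [|zeta| <= (l + 1) H] for an image of order [l]. The trapezoidal sum
   itself is the reciprocal sum over [k <> 0]; its missing node [h = 0], [t = 0] carries, by neutrality, the
   limit [4 alpha^2 (sum_i q_i z_i) (sum_j q_j z_j')], which is [U_IBC]. *)

Require Import Defs.
From mathcomp Require Import all_boot all_order all_algebra.
From mathcomp Require Import finmap.
From mathcomp Require Import complex.
From mathcomp Require Import all_classical all_reals all_analysis.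
From mathcomp Require Import measurable_realfun.
From mathcomp Require Import ring lra.
Import Order.TTheory GRing.Theory Num.Theory.
Import numFieldNormedType.Exports.

Local Open Scope classical_set_scope.
Local Open Scope ring_scope.
Local Open Scope complex_scope.

Set Implicit Arguments.
Unset Strict Implicit.
Unset Printing Implicit Defensive.

(** * Unordered sums *)

(** The trapezoidal sum is reached through the Dirichlet kernel: integrating a kernel against it
    gives, by the product formulas for cosines, the finite sum of shifted transforms up to order
    [K], and as [K] grows the integral tends to the sum over the nodes. On each cell of the mesh
    this is the Riemann-Lebesgue lemma; the obstacle is to exchange the limit with the sum over
    infinitely many cells, which requires the Lipschitz constants of the kernel on the cells to be
    summable. For [h = 0] the kernel is a quotient continued at [t = 0], so the central cell is
    treated by a Taylor estimate instead of a derivative.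

    The error estimates must remain summable over [h], hence uniform in [a]. The closed form of the
    screened transform contains two Gaussian tails, one of which stops decaying once [a > b / 2];
    there [exp (- a b)] supplies both the Gaussian in [b] and the factor [exp (- a)] that is summed
    over [h]. This works as soon as [b >= 2], and [Lz >= (M + 1) H + 1 / alpha] keeps every shifted
    frequency above that threshold. *)

Definition abs_summable (R : realType) (T : choiceType) (D : set T) (f : T -> R) :=
  summable D (fun t => (f t)%:E).

Section rsum_theory.
Context {R : realType} {T : choiceType}.
Implicit Types (D : set T) (f g : T -> R).

Lemma abs_summable_le D f g : abs_summable D g ->
  (forall t, D t -> `|f t| <= g t) -> abs_summable D f.
Proof.
move=> Dg fg; apply: le_lt_trans Dg; apply: le_esum => t Dt.
by rewrite lee_fin (le_trans (fg _ Dt))// ler_norm.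
Qed.

Lemma eq_abs_summable D f g : (forall t, D t -> f t = g t) ->
  abs_summable D f -> abs_summable D g.
Proof. by move=> fg; rewrite /abs_summable /summable (eq_esum (b := fun t => `|(g t)%:E|%E))// => t /fg ->. Qed.

Lemma abs_summableS (D E : set T) f : E `<=` D -> abs_summable D f -> abs_summable E f.
Proof.
move=> ED; apply: le_lt_trans; rewrite [leRHS](esumID E)// setIidr//.
by rewrite leeDl// esum_ge0.
Qed.

Lemma abs_summableD D f g : abs_summable D f -> abs_summable D g ->
  abs_summable D (fun t => f t + g t).
Proof. exact: summableD. Qed.

Lemma abs_summableN D f : abs_summable D f -> abs_summable D (fun t => - f t).
Proof. by rewrite /abs_summable summableN. Qed.

Lemma abs_summableB D f g : abs_summable D f -> abs_summable D g ->
  abs_summable D (fun t => f t - g t).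
Proof. by move=> Df Dg; apply: abs_summableD => //; exact: abs_summableN. Qed.

Lemma esum_fin_num D f : abs_summable D f -> (forall t, D t -> 0 <= f t) ->
  \esum_(t in D) (f t)%:E \is a fin_num.
Proof.
move=> Df f0; rewrite (eq_esum (b := fun t => `|(f t)%:E|%E)) -?summableE//.
by move=> t /f0 ft; rewrite gee0_abs.
Qed.

(** One inequality suffices: applied to [c * f] with the factor [c^-1], it gives the reverse one in
    [esumZl]. *)
Lemma le_esumZl D f (c : R) : 0 <= c -> (forall t, D t -> 0 <= f t) ->
  (\esum_(t in D) (c * f t)%:E <= c%:E * \esum_(t in D) (f t)%:E)%E.
Proof.
move=> c0 f0; apply: ge_ereal_sup => _ [X [finX XD] <-].
have -> : (\sum_(x \in X) (c * f x)%:E = c%:E * \sum_(x \in X) (f x)%:E)%E.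
  rewrite !fsbig_finite//= !sumEFin -EFinM mulr_sumr//.
by rewrite lee_wpmul2l ?lee_fin// esum_ge//; exists X.
Qed.

Lemma esumZl D f (c : R) : 0 <= c -> (forall t, D t -> 0 <= f t) ->
  (\esum_(t in D) (c * f t)%:E = c%:E * \esum_(t in D) (f t)%:E)%E.
Proof.
rewrite le_eqVlt => /predU1P[<- _|c0 f0].
  by rewrite mul0e esum1// => t _; rewrite mul0r.
apply/eqP; rewrite eq_le le_esumZl//= ?(ltW c0)//.
have := @le_esumZl D (fun t => c * f t) c^-1.
have -> : (\esum_(t in D) (c^-1 * (c * f t))%:E = \esum_(t in D) (f t)%:E)%E.
  by apply: eq_esum => t _; rewrite mulKf// gt_eqF.
move=> /(_ _ _)/wrap[|t Dt|]; rewrite ?invr_ge0 ?(ltW c0)//.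
  by rewrite mulr_ge0 ?(ltW c0) ?f0.
by move=> h; rewrite -lee_pdivlMl.
Qed.

Lemma abs_summableZ D f (c : R) : abs_summable D f -> abs_summable D (fun t => c * f t).
Proof.
rewrite /abs_summable /summable => Df.
rewrite (eq_esum (b := fun t => (`|c| * `|f t|)%:E)); last first.
  by move=> t _; rewrite abse_EFin normrM.
rewrite esumZl// lte_mul_pinfty//.
Qed.

Lemma abs_summable_norm D f : abs_summable D f ->
  abs_summable D (fun t => `|f t|).
Proof. by apply: le_lt_trans; apply: le_esum => t _; rewrite /= normr_id. Qed.

Lemma abs_summable_pos D f : abs_summable D f ->
  abs_summable D (fun t => Num.max (f t) 0).
Proof.
move=> Df; apply: (abs_summable_le (abs_summable_norm Df)) => t _.
by rewrite ger0_norm ?le_max ?lexx ?orbT// ge_max ler_norm normr_ge0.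
Qed.

Lemma abs_summable_neg D f : abs_summable D f ->
  abs_summable D (fun t => Num.max (- f t) 0).
Proof. by move=> /abs_summableN/abs_summable_pos. Qed.

(** [rsum] may be computed from any difference of non-negative summable families, not only from the
    positive and negative parts. Additivity and homogeneity follow from this freedom. *)
Lemma rsumE D f g : abs_summable D f -> abs_summable D g ->
  (forall t, D t -> 0 <= f t) -> (forall t, D t -> 0 <= g t) ->
  rsum D (fun t => f t - g t) =
  fine (\esum_(t in D) (f t)%:E) - fine (\esum_(t in D) (g t)%:E).
Proof.
move=> Df Dg f0 g0.
have := esumB Df Dg f0 g0.
rewrite /rsum.
have -> : (\esum_(i in D) ((EFin \o f) \- (EFin \o g))^\+ i =
           \esum_(t in D) (Num.max (f t - g t) 0)%:E)%E.
  by apply: eq_esum => t _; rewrite funeposE/= EFin_max.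
have -> : (\esum_(i in D) ((EFin \o f) \- (EFin \o g))^\- i =
           \esum_(t in D) (Num.max (- (f t - g t)) 0)%:E)%E.
  by apply: eq_esum => t _; rewrite funenegE/= EFin_max.
move=> H; rewrite -!fineB ?esum_fin_num// ?H//.
- by apply/abs_summable_pos/abs_summableB.
- by move=> t _; rewrite le_max lexx orbT.
- by apply/abs_summable_neg/abs_summableB.
- by move=> t _; rewrite le_max lexx orbT.
Qed.

Lemma rsum_ge0E D f : abs_summable D f -> (forall t, D t -> 0 <= f t) ->
  rsum D f = fine (\esum_(t in D) (f t)%:E).
Proof.
move=> Df f0; have s0 : abs_summable D (fun=> 0 : R).
  by apply: (abs_summable_le Df) => t /f0; rewrite normr0.
rewrite -[RHS](subr0) -[X in _ - X](_ : fine (\esum_(t in D) (0 : R)%:E) = 0).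
  by rewrite -rsumE//; congr rsum; apply/funext => t; rewrite subr0.
by rewrite esum1.
Qed.

Lemma maxB0 (x : R) : Num.max x 0 - Num.max (- x) 0 = x.
Proof.
have [x0|x0] := leP 0 x; first by rewrite max_r ?oppr_le0// subr0.
by rewrite max_l ?oppr_ge0 1?ltW// sub0r opprK.
Qed.

Lemma max0_ge0 (x : R) : 0 <= Num.max x 0.
Proof. by rewrite le_max lexx orbT. Qed.

Lemma eq_rsum D f g : (forall t, D t -> f t = g t) -> rsum D f = rsum D g.
Proof.
move=> fg; rewrite /rsum; congr (fine _ - fine _); apply: eq_esum => t /fg -> //.
Qed.

Lemma rsumN D f : rsum D (fun t => - f t) = - rsum D f.
Proof.
rewrite /rsum opprB; congr (_ - fine _).
by apply: eq_esum => t _; rewrite opprK.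
Qed.

Lemma rsumD D f g : abs_summable D f -> abs_summable D g ->
  rsum D (fun t => f t + g t) = rsum D f + rsum D g.
Proof.
move=> Df Dg.
pose p (h : T -> R) t := Num.max (h t) 0.
pose n (h : T -> R) t := Num.max (- h t) 0.
have -> : rsum D (fun t => f t + g t) =
    rsum D (fun t => (p f t + p g t) - (n f t + n g t)).
  apply: eq_rsum => t _; rewrite opprD addrACA /p /n !maxB0 //.
have [p0 n0] : (forall h t, 0 <= p h t) /\ (forall h t, 0 <= n h t).
  by split=> h t; exact: max0_ge0.
have [pf pg] := (abs_summable_pos Df, abs_summable_pos Dg).
have [nf ng] := (abs_summable_neg Df, abs_summable_neg Dg).
rewrite rsumE//; last 4 first.
- exact: abs_summableD.
- exact: abs_summableD.
- by move=> t _; rewrite addr_ge0.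
- by move=> t _; rewrite addr_ge0.
under eq_esum do rewrite EFinD.
under [X in _ - fine X]eq_esum do rewrite EFinD.
rewrite !esumD//; do ?by move=> t _; rewrite lee_fin ?p0 ?n0.
rewrite !fineD ?esum_fin_num// /rsum -/(p f) -/(p g) -/(n f) -/(n g).
by rewrite opprD addrACA.
Qed.

Lemma rsumB D f g : abs_summable D f -> abs_summable D g ->
  rsum D (fun t => f t - g t) = rsum D f - rsum D g.
Proof. by move=> Df Dg; rewrite rsumD ?rsumN//; exact: abs_summableN. Qed.

Lemma rsumZ D f (c : R) : abs_summable D f ->
  rsum D (fun t => c * f t) = c * rsum D f.
Proof.
wlog c0 : c / 0 <= c => [hw Df|Df].
  have [/hw->//|/ltW c0] := leP 0 c.
  rewrite -[LHS]opprK -rsumN -[c in RHS]opprK mulNr -hw ?oppr_ge0//.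
  by congr (- _); apply: eq_rsum => t _; rewrite mulNr.
have [pf nf] := (abs_summable_pos Df, abs_summable_neg Df).
have -> : rsum D (fun t => c * f t) =
    rsum D (fun t => c * Num.max (f t) 0 - c * Num.max (- f t) 0).
  by apply: eq_rsum => t _; rewrite -mulrBr maxB0.
rewrite rsumE//; do ?exact: abs_summableZ.
- rewrite !esumZl//; do ?by move=> t _; exact: max0_ge0.
  by rewrite !fineM ?esum_fin_num// -?mulrBr// => t _; exact: max0_ge0.
- by move=> t _; rewrite mulr_ge0// max0_ge0.
- by move=> t _; rewrite mulr_ge0// max0_ge0.
Qed.

Lemma rsum_ge0 D f : (forall t, D t -> 0 <= f t) -> 0 <= rsum D f.
Proof.
move=> f0; rewrite /rsum [X in _ - fine X]esum1 ?subr0 ?fine_ge0//.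
  by apply: esum_ge0 => t _; rewrite lee_fin max0_ge0.
by move=> t /f0 ft; rewrite max_r// oppr_le0.
Qed.

Lemma le_rsum D f g : abs_summable D f -> abs_summable D g ->
  (forall t, D t -> f t <= g t) -> rsum D f <= rsum D g.
Proof.
move=> Df Dg fg; rewrite -subr_ge0 -rsumB//.
by apply: rsum_ge0 => t /fg; rewrite subr_ge0.
Qed.

Lemma ler_norm_rsum D f g : abs_summable D g ->
  (forall t, D t -> `|f t| <= g t) -> `|rsum D f| <= rsum D g.
Proof.
move=> Dg fg; have Df := abs_summable_le Dg fg.
rewrite ler_norml -rsumN !le_rsum//; do ?exact: abs_summableN.
- by move=> t /fg; rewrite ler_norml => /andP[].
- by move=> t /fg; rewrite ler_norml => /andP[].
Qed.

Lemma rsumID (E D : set T) f : abs_summable D f ->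
  rsum D f = rsum (D `&` E) f + rsum (D `&` ~` E) f.
Proof.
move=> Df; have [pf nf] := (abs_summable_pos Df, abs_summable_neg Df).
rewrite /rsum (esumID E); last by move=> t _; rewrite lee_fin max0_ge0.
rewrite [X in _ - fine X](esumID E); last by move=> t _; rewrite lee_fin max0_ge0.
rewrite !fineD ?esum_fin_num//; do ?[by move=> t _; rewrite max0_ge0];
  do ?[by apply: abs_summableS (pf) => t []]; do ?by apply: abs_summableS (nf) => t [].
by rewrite opprD addrACA.
Qed.

Lemma rsum_set1 (t : T) f : rsum [set t] f = f t.
Proof. by rewrite /rsum !esum_set1 ?lee_fin ?max0_ge0//= maxB0. Qed.

End rsum_theory.

Lemma reindex_rsum (R : realType) (T T' : choiceType) (P : set T) (Q : set T')
    (e : T -> T') (f : T' -> R) : set_bij P Q e ->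
  rsum Q f = rsum P (f \o e).
Proof. by move=> Pe; rewrite /rsum !(reindex_esum _ _ _ _ Pe). Qed.

Section rsum_fubini.
Context {R : realType} {T1 T2 : choiceType}.
Variables (I : set T1) (J : set T2) (f : T1 * T2 -> R).
Hypothesis fs : abs_summable (I `*` J) f.

Lemma abs_summable_section i : I i -> abs_summable J (fun j => f (i, j)).
Proof.
move=> Ii; apply: le_lt_trans fs.
rewrite -(esum_image J (fun j => (i, j)) (fun p => `|(f p)%:E|%E)); last first.
  by move=> x y _ _ [].
have sub : [set (i, x) | x in J] `<=` I `*` J by move=> _ [j Jj <-].
by rewrite [leRHS](esumID [set (i, x) | x in J])// (setIidr sub) leeDl// esum_ge0.
Qed.

Lemma rsum_fubini_ge0 : (forall p, 0 <= f p) ->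
  abs_summable I (fun i => rsum J (fun j => f (i, j))) /\
  rsum (I `*` J) f = rsum I (fun i => rsum J (fun j => f (i, j))).
Proof.
move=> f0.
have e : (\esum_(i in I) (rsum J (fun j => f (i, j)))%:E =
          \esum_(p in I `*` J) (f p)%:E)%E.
  have -> : (\esum_(p in I `*` J) (f p)%:E = \esum_(p in I `*` J) (f (p.1, p.2))%:E)%E.
    by apply: eq_esum => -[].
  rewrite -(esum_esum (J := fun=> J) (a := fun i j => (f (i, j))%:E)); last first.
    by move=> i j _ _; rewrite lee_fin.
  apply: eq_esum => i Ii; rewrite rsum_ge0E ?fineK ?esum_fin_num//;
    exact: abs_summable_section.
have sI : abs_summable I (fun i => rsum J (fun j => f (i, j))).
  rewrite /abs_summable /summable (eq_esum (b := fun i => (rsum J (fun j => f (i, j)))%:E)).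
    by rewrite e ltey_eq esum_fin_num.
  by move=> i _; rewrite gee0_abs// lee_fin rsum_ge0.
by split => //; rewrite !rsum_ge0E// ?e// => i _; apply: rsum_ge0.
Qed.
End rsum_fubini.

Lemma rsum_fubini (R : realType) (T1 T2 : choiceType) (I : set T1) (J : set T2)
    (f : T1 * T2 -> R) : abs_summable (I `*` J) f ->
  abs_summable I (fun i => rsum J (fun j => f (i, j))) /\
  rsum (I `*` J) f = rsum I (fun i => rsum J (fun j => f (i, j))).
Proof.
move=> fs; have [ps ns] := (abs_summable_pos fs, abs_summable_neg fs).
have [pI pE] := rsum_fubini_ge0 ps (fun p => max0_ge0 _).
have [nI nE] := rsum_fubini_ge0 ns (fun p => max0_ge0 _).
have fi i : I i -> rsum J (fun j => f (i, j)) =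
    rsum J (fun j => Num.max (f (i, j)) 0) - rsum J (fun j => Num.max (- f (i, j)) 0).
  move=> Ii; rewrite -rsumB.
  - by apply: eq_rsum => j _; rewrite maxB0.
  - exact: (abs_summable_section ps Ii).
  - exact: (abs_summable_section ns Ii).
split.
  apply: eq_abs_summable (abs_summableB pI nI) => i Ii; rewrite fi//.
transitivity (rsum (I `*` J) (fun p => Num.max (f p) 0 - Num.max (- f p) 0)).
  by apply: eq_rsum => p _; rewrite maxB0.
by rewrite rsumB// pE nE -rsumB//; apply: eq_rsum => i /fi ->.
Qed.

(** * Complex numbers through real and imaginary parts *)

Section complex_parts.
Context {R : realType}.
Implicit Types x y : R[i].

Lemma Re_add x y : complex.Re (x + y) = complex.Re x + complex.Re y.
Proof. by case: x y => [? ?] [? ?]. Qed.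

Lemma Im_add x y : complex.Im (x + y) = complex.Im x + complex.Im y.
Proof. by case: x y => [? ?] [? ?]. Qed.

Lemma Re_mul x y : complex.Re (x * y) =
  complex.Re x * complex.Re y - complex.Im x * complex.Im y.
Proof. by case: x y => [? ?] [? ?]. Qed.

Lemma Im_mul x y : complex.Im (x * y) =
  complex.Re x * complex.Im y + complex.Im x * complex.Re y.
Proof. by case: x y => [? ?] [? ?]. Qed.

Lemma Re_opp x : complex.Re (- x) = - complex.Re x.
Proof. by case: x. Qed.

Lemma Im_opp x : complex.Im (- x) = - complex.Im x.
Proof. by case: x. Qed.

Lemma eq_complexP x y : complex.Re x = complex.Re y -> complex.Im x = complex.Im y -> x = y.
Proof. by case: x y => [? ?] [? ?] /= -> ->. Qed.

Lemma Re_sum (I : Type) (r : seq I) (P : pred I) (F : I -> R[i]) :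
  complex.Re (\sum_(i <- r | P i) F i) = \sum_(i <- r | P i) complex.Re (F i).
Proof. exact: (big_morph _ Re_add). Qed.

Lemma Im_sum (I : Type) (r : seq I) (P : pred I) (F : I -> R[i]) :
  complex.Im (\sum_(i <- r | P i) F i) = \sum_(i <- r | P i) complex.Im (F i).
Proof. exact: (big_morph _ Im_add). Qed.

Lemma normcE x : Normc.normc x = Num.sqrt (complex.Re x ^+ 2 + complex.Im x ^+ 2).
Proof. by case: x. Qed.

Lemma normRe x : `|complex.Re x| <= Normc.normc x.
Proof. by rewrite normcE -sqrtr_sqr ler_wsqrtr// lerDl sqr_ge0. Qed.

Lemma normIm x : `|complex.Im x| <= Normc.normc x.
Proof. by rewrite normcE -sqrtr_sqr ler_wsqrtr// lerDr sqr_ge0. Qed.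

Lemma normc_le x : Normc.normc x <= `|complex.Re x| + `|complex.Im x|.
Proof.
rewrite normcE -[leRHS]ger0_norm ?addr_ge0// -sqrtr_sqr ler_wsqrtr//.
rewrite sqrrD !real_normK ?num_real// lerD2r lerDl.
by rewrite mulrn_wge0// mulr_ge0.
Qed.

Lemma normc_ge0 x : 0 <= Normc.normc x.
Proof. by rewrite normcE sqrtr_ge0. Qed.

Lemma normcM x y : Normc.normc (x * y) = Normc.normc x * Normc.normc y.
Proof.
rewrite !normcE -sqrtrM ?addr_ge0 ?sqr_ge0// Re_mul Im_mul; congr Num.sqrt; ring.
Qed.

Lemma normcD x y : Normc.normc (x + y) <= Normc.normc x + Normc.normc y.
Proof. exact: le_normcD. Qed.

Lemma normcR (r : R) : Normc.normc r%:C = `|r|.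
Proof. by rewrite normcE/= expr0n addr0 sqrtr_sqr. Qed.

Lemma normc0 : Normc.normc (0 : R[i]) = 0.
Proof. by rewrite normcE/= expr0n addr0 sqrtr0. Qed.

Lemma normc_sum (I : Type) (r : seq I) (P : pred I) (F : I -> R[i]) :
  Normc.normc (\sum_(i <- r | P i) F i) <= \sum_(i <- r | P i) Normc.normc (F i).
Proof.
elim/big_rec2 : _ => [|i y1 y2 _ h]; first by rewrite normc0.
by rewrite (le_trans (normcD _ _))// lerD2l.
Qed.

Lemma normc_expi (u : R) : Normc.normc (expi u) = 1.
Proof. by rewrite normcE/= cos2Dsin2 sqrtr1. Qed.

Lemma expiD (u v : R) : expi (u + v) = expi u * expi v.
Proof. by apply: eq_complexP; rewrite ?Re_mul ?Im_mul/= ?cosD ?sinD//; ring. Qed.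

Lemma expi0 : expi (0 : R) = 1.
Proof. by rewrite /expi cos0 sin0. Qed.

Lemma realCM (a b : R) : (a * b)%:C = a%:C * b%:C.
Proof. by apply: eq_complexP; rewrite ?Re_mul ?Im_mul/=; ring. Qed.

Lemma realCD (a b : R) : (a + b)%:C = a%:C + b%:C.
Proof. by apply: eq_complexP; rewrite ?Re_add ?Im_add/=; ring. Qed.

Lemma realCN (a : R) : (- a)%:C = - a%:C.
Proof. by apply: eq_complexP; rewrite ?Re_opp ?Im_opp/= ?oppr0. Qed.

Lemma realC_sum (I : Type) (r : seq I) (P : pred I) (F : I -> R) :
  (\sum_(i <- r | P i) F i)%:C = \sum_(i <- r | P i) (F i)%:C.
Proof. exact: (big_morph (fun x : R => x%:C) realCD). Qed.

Lemma realC_inv (a : R) : (a^-1)%:C = (a%:C)^-1.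
Proof. by rewrite fmorphV. Qed.

End complex_parts.

(** * Unordered sums of complex families *)

Section csum_theory.
Context {R : realType} {T : choiceType}.
Implicit Types (D : set T) (f g : T -> R[i]).

Lemma csummableP D f : csummable D f <->
  abs_summable D (fun t => complex.Re (f t)) /\ abs_summable D (fun t => complex.Im (f t)).
Proof.
split=> [h|[hr hi]].
  by split; apply: abs_summable_le h _ => t _; rewrite (normRe, normIm).
apply: (abs_summable_le (abs_summableD (abs_summable_norm hr) (abs_summable_norm hi))).
by move=> t _; rewrite ger0_norm ?normc_ge0// normc_le.
Qed.

Lemma csummable_le D f (g : T -> R) : abs_summable D g ->
  (forall t, D t -> Normc.normc (f t) <= g t) -> csummable D f.
Proof.
by move=> h fg; apply: (abs_summable_le h) => t /fg; rewrite ger0_norm ?normc_ge0.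
Qed.

Lemma eq_csummable D f g : (forall t, D t -> f t = g t) -> csummable D f -> csummable D g.
Proof. by move=> fg; apply: eq_abs_summable => t /fg ->. Qed.

Lemma csummableD D f g : csummable D f -> csummable D g -> csummable D (fun t => f t + g t).
Proof.
move=> Df Dg; apply: (csummable_le (abs_summableD Df Dg)) => t _; exact: normcD.
Qed.

Lemma csummableZ D f (c : R[i]) : csummable D f -> csummable D (fun t => c * f t).
Proof.
by move=> Df; apply: (csummable_le (abs_summableZ (Normc.normc c) Df)) => t _; rewrite normcM.
Qed.

Lemma csummable_sum (I : Type) (r : seq I) D (F : I -> T -> R[i]) :
  (forall i, csummable D (F i)) -> csummable D (fun t => \sum_(i <- r) F i t).
Proof.
move=> h; elim: r => [|i r IH].
  apply: (@csummable_le _ _ (fun=> 0)); last by move=> t _; rewrite big_nil normc0.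
  by rewrite /abs_summable /summable esum1 ?ltry// => t _; rewrite abse0.
by apply: eq_csummable (csummableD (h i) IH) => t _; rewrite big_cons.
Qed.

Lemma csummableS D E f : E `<=` D -> csummable D f -> csummable E f.
Proof. exact: abs_summableS. Qed.

Lemma eq_csum D f g : (forall t, D t -> f t = g t) -> csum D f = csum D g.
Proof. by move=> fg; apply: eq_complexP => /=; apply: eq_rsum => t /fg ->. Qed.

Lemma csumD D f g : csummable D f -> csummable D g ->
  csum D (fun t => f t + g t) = csum D f + csum D g.
Proof.
move=> /csummableP[fr fi] /csummableP[gr gi]; apply: eq_complexP; rewrite ?Re_add ?Im_add /=.
  by rewrite -rsumD//; apply: eq_rsum => t _; rewrite Re_add.
by rewrite -rsumD//; apply: eq_rsum => t _; rewrite Im_add.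
Qed.

Lemma csumZ D f (c : R[i]) : csummable D f -> csum D (fun t => c * f t) = c * csum D f.
Proof.
move=> /csummableP[fr fi]; apply: eq_complexP; rewrite ?Re_mul ?Im_mul /= -!rsumZ//.
  by rewrite -rsumB; do ?exact: abs_summableZ; apply: eq_rsum => t _; rewrite Re_mul.
by rewrite -rsumD; do ?exact: abs_summableZ; apply: eq_rsum => t _; rewrite Im_mul.
Qed.

Lemma csumB D f g : csummable D f -> csummable D g ->
  csum D (fun t => f t - g t) = csum D f - csum D g.
Proof.
move=> Df Dg; rewrite -mulN1r -csumZ// -csumD//; last exact: csummableZ.
by apply: eq_csum => t _; rewrite mulN1r.
Qed.

Lemma csum_sum (I : Type) (r : seq I) D (F : I -> T -> R[i]) :
  (forall i, csummable D (F i)) ->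
  csum D (fun t => \sum_(i <- r) F i t) = \sum_(i <- r) csum D (F i).
Proof.
move=> h; elim: r => [|i r IH].
  rewrite big_nil (eq_csum (g := fun=> 0 * 0)); last by move=> t _; rewrite big_nil mul0r.
  rewrite csumZ ?mul0r//.
  by rewrite /csummable /summable esum1 ?ltry// => t _; rewrite normc0 abse0.
rewrite big_cons -IH -csumD//; last exact: csummable_sum.
by apply: eq_csum => t _; rewrite big_cons.
Qed.

(** The factor 2 comes from bounding the real and the imaginary part separately. *)
Lemma normc_csum D f (g : T -> R) : abs_summable D g ->
  (forall t, D t -> Normc.normc (f t) <= g t) -> Normc.normc (csum D f) <= 2 * rsum D g.
Proof.
move=> Dg fg; rewrite (le_trans (normc_le _))// mulr2n mulrDl mul1r lerD//=.
  by apply: ler_norm_rsum => // t /fg; apply: le_trans; exact: normRe.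
by apply: ler_norm_rsum => // t /fg; apply: le_trans; exact: normIm.
Qed.

Lemma csumID (E D : set T) f : csummable D f ->
  csum D f = csum (D `&` E) f + csum (D `&` ~` E) f.
Proof.
by move=> /csummableP[fr fi]; apply: eq_complexP; rewrite ?Re_add ?Im_add/= -rsumID.
Qed.

Lemma csum_set1 (t : T) f : csum [set t] f = f t.
Proof. by rewrite /csum /complexify !rsum_set1; case: (f t). Qed.

End csum_theory.

Lemma csum_fubini (R : realType) (T1 T2 : choiceType) (I : set T1) (J : set T2)
    (f : T1 * T2 -> R[i]) : csummable (I `*` J) f ->
  csummable I (fun i => csum J (fun j => f (i, j))) /\
  csum (I `*` J) f = csum I (fun i => csum J (fun j => f (i, j))).
Proof.
move=> /csummableP[/rsum_fubini[sr er] /rsum_fubini[si ei]]; split.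
  by apply/csummableP; split.
by apply: eq_complexP.
Qed.

Lemma csummable_section (R : realType) (T1 T2 : choiceType) (I : set T1) (J : set T2)
    (f : T1 * T2 -> R[i]) i : csummable (I `*` J) f -> I i -> csummable J (fun j => f (i, j)).
Proof. by move=> fs Ii; exact: (abs_summable_section fs Ii). Qed.

(** * Summable families over the integers and their symmetric partial sums *)

Section summable_families.
Context {R : realType}.

Lemma abs_summable_prod (T1 T2 : choiceType) (I : set T1) (J : set T2) (f : T1 -> R) (g : T2 -> R) :
  abs_summable I f -> abs_summable J g -> abs_summable (I `*` J) (fun p => f p.1 * g p.2).
Proof.
move=> fs gs; rewrite /abs_summable /summable.
have -> : (\esum_(p in I `*` J) `|(f p.1 * g p.2)%:E| =
   \esum_(p in I `*` J) (`|f p.1| * `|g p.2|)%:E)%E.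
  by apply: eq_esum => p _; rewrite abse_EFin normrM.
rewrite -(esum_esum (J := fun=> J) (a := fun i j => (`|f i| * `|g j|)%:E)); last first.
  by move=> i j _ _; rewrite lee_fin mulr_ge0.
under eq_esum do rewrite esumZl//.
have gf := esum_fin_num (abs_summable_norm gs) (fun _ _ => normr_ge0 _).
rewrite -(fineK gf).
under eq_esum do rewrite -EFinM mulrC.
rewrite esumZl//; last by rewrite fine_ge0// esum_ge0.
by rewrite lte_mul_pinfty// lee_fin fine_ge0 ?esum_ge0// => t _; rewrite lee_fin.
Qed.

Lemma abs_summable_expR (d : R) : 0 < d ->
  abs_summable [set: int] (fun n => expR (- (d * `|n%:~R|))).
Proof.
move=> d0; rewrite /abs_summable /summable.
have q1 : expR (- d) < 1 by rewrite -expR0 ltr_expR oppr_lt0.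
(* Treats both halves of the integers by the geometric series: [Posz n] has absolute value [n], and
   [Negz n] has [n + 1]. *)
have key (e : nat -> int) : (forall n, `|(e n)%:~R| >= n%:R :> R) -> injective e ->
    (\esum_(n in range e) `|(expR (- (d * `|n%:~R|)))%:E| < +oo)%E.
  move=> ge_e inj_e; rewrite esum_image; last by move=> x y _ _ /inj_e.
  apply: (@le_lt_trans _ _ (\esum_(n in [set: nat]) (expR (- d) ^+ n)%:E)%E).
    apply: le_esum => n _; rewrite gee0_abs ?lee_fin ?expR_ge0// -expRM_natr ler_expR.
    by rewrite mulNr lerN2 ler_wpM2l// ltW.
  rewrite -nneseries_esumT; last by move=> n; rewrite lee_fin exprn_ge0// expR_ge0.
  apply: (@le_lt_trans _ _ ((1 - expR (- d))^-1)%:E); last by rewrite ltry.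
  apply: lime_le.
    by apply: is_cvg_nneseries => n _ _; rewrite lee_fin exprn_ge0// expR_ge0.
  apply: nearW => n; rewrite sumEFin lee_fin big_mkord.
  have := subrX1 (expR (- d)) n; rewrite -opprB -[X in _ = X * _]opprB mulNr => /oppr_inj h.
  rewrite -[leRHS]mulr1 ler_pdivlMl ?subr_gt0// -h.
  by rewrite gerDl oppr_le0 exprn_ge0// expR_ge0.
rewrite (esumID (range Posz))// lte_add_pinfty//.
  rewrite setTI; apply: key; last by move=> x y [].
  by move=> n; rewrite ger0_norm// ler0n.
rewrite setTI (_ : ~` range Posz = range Negz).
  apply: key; last by move=> x y [].
  by move=> n; rewrite NegzE mulrNz normrN ger0_norm ?ler0n// ler_nat.
apply/seteqP; split=> [[n|n]|_ [n _ <-]] /=.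
- by move=> h; exfalso; apply: h; exists n.
- by move=> _; exists n.
- by move=> [].
Qed.

(** Finite subsums converge to [rsum] along the finite subsets of [D]; the positive and the negative
    part are each approximated to within [e / 2]. *)
Lemma rsum_approx (T : choiceType) (D : set T) (f : T -> R) (e : R) : abs_summable D f -> 0 < e ->
  exists2 X : set T, fsets D X & forall Y, fsets D Y -> X `<=` Y ->
    `|\sum_(t \in Y) f t - rsum D f| <= e.
Proof.
have ge0case (g : T -> R) (h : R) : abs_summable D g -> (forall t, 0 <= g t) -> 0 < h ->
   exists2 X : set T, fsets D X & forall Y, fsets D Y -> X `<=` Y ->
    `|\sum_(t \in Y) g t - rsum D g| <= h.
  move=> Dg g0 h0; have fn := esum_fin_num Dg (fun t _ => g0 t).
  have : (\esum_(t in D) (g t)%:E - h%:E < \esum_(t in D) (g t)%:E)%E.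
    by rewrite -(fineK fn) -EFinB lte_fin ltrBlDr ltrDl.
  move=> /ereal_sup_gt[_ [X DX <-] hX]; exists X => // Y [finY YD] XY.
  have [finX XD] := DX.
  rewrite rsum_ge0E// ler_distl; apply/andP; split.
    have le1 : (\sum_(t \in X) (g t)%:E <= \sum_(t \in Y) (g t)%:E)%E.
      apply: lee_fsum_nneg_subset => //; first exact/subsetP.
      by move=> t _; rewrite lee_fin.
    have := lt_le_trans hX le1.
    rewrite -(fineK fn) -EFinB fsbig_finite//= sumEFin lte_fin -fsbig_finite//= => /ltW h1; exact: h1.
  apply: (@le_trans _ _ (fine (\esum_(t in D) (g t)%:E))); last by rewrite lerDl ltW.
  rewrite -lee_fin fineK// fsbig_finite//= -sumEFin -fsbig_finite//.
  by apply: esum_ge; exists Y.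
move=> Df e0; have e20 : 0 < e / 2 by rewrite divr_gt0.
have [X1 [f1 D1] h1] := ge0case _ _ (abs_summable_pos Df) (fun t => max0_ge0 _) e20.
have [X2 [f2 D2] h2] := ge0case _ _ (abs_summable_neg Df) (fun t => max0_ge0 _) e20.
exists (X1 `|` X2).
  by split; [rewrite finite_setU|rewrite subUset].
move=> Y DY; rewrite subUset => -[X1Y X2Y].
have -> : rsum D f = rsum D (fun t => Num.max (f t) 0) - rsum D (fun t => Num.max (- f t) 0).
  rewrite -rsumB; [|exact: abs_summable_pos|exact: abs_summable_neg].
  by apply: eq_rsum => t _; rewrite maxB0.
have -> : \sum_(t \in Y) f t = \sum_(t \in Y) Num.max (f t) 0 - \sum_(t \in Y) Num.max (- f t) 0.
  have [fY _] := DY.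
  by rewrite !fsbig_finite//= -sumrB; apply: eq_bigr => t _; rewrite maxB0.
rewrite opprD addrACA -opprD [e]splitr (le_trans (ler_normB _ _))//.
by rewrite lerD ?h1 ?h2.
Qed.

(** The order of summation that matches the exhaustion of the line by the cells from [- N] to [N] in
    Poisson summation. *)
Definition sym_partial_sum (f : int -> R) (N : nat) : R :=
  f 0 + \sum_(n < N) (f n.+1%:Z + f (- n.+1%:Z)).

Lemma cvg_sym_partial_sum (f : int -> R) : abs_summable [set: int] f ->
  sym_partial_sum f N @[N --> \oo] --> rsum [set: int] f.
Proof.
move=> fs; apply/cvgrPdist_le => /= e e0.
have [X [finX _] hX] := rsum_approx fs e0.
pose box (N : nat) := [set n : int | (`|n| <= N)%N].
have boxS N : box N.+1 = box N `|` ([set N.+1%:Z] `|` [set - N.+1%:Z]).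
  apply/seteqP; split => [n|n] /=.
    rewrite /box/= leq_eqVlt => /orP[/eqP nN|]; last by left.
    right; move: nN; case: n => n /= nN; first by left; rewrite -nN.
    by right; rewrite -nN.
  by rewrite /box/= => -[/leqW//|[->|->]]; rewrite ?abszN.
have finbox N : finite_set (box N).
  elim: N => [|N IH]; last by rewrite boxS; do ?rewrite finite_setU; split.
  rewrite (_ : box 0%N = [set 0])//; apply/seteqP; split => n /=; last by move=> ->.
  by rewrite /box/= leqn0 absz_eq0 => /eqP.
have sumbox N : sym_partial_sum f N = \sum_(n \in box N) f n.
  elim: N => [|N IH].
    rewrite /sym_partial_sum big_ord0 addr0 (_ : box 0%N = [set 0]) ?fsbig_set1//.
    apply/seteqP; split => n /=; last by move=> ->.
    by rewrite /box/= leqn0 absz_eq0 => /eqP.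
  rewrite /sym_partial_sum big_ord_recr/= addrA -/(sym_partial_sum f N) IH boxS.
  rewrite fsbigU0//=; first congr (_ + _).
  - rewrite fsbigU0 ?fsbig_set1//= => n [-> //].
  - by move=> n [] nN [] nE; move: nN; rewrite /box/= nE ?abszN/= ltnn.
have : exists N, X `<=` box N.
  exists (\max_(n <- fset_set X) `|n|%N) => n Xn; rewrite /box/=.
  by apply: leq_bigmax_seq => //; rewrite in_fset_set// inE.
move=> [N XN]; near=> M.
rewrite distrC sumbox; apply: hX; first by split.
apply: (subset_trans XN) => n /= nN; rewrite /box/= (leq_trans nN)//.
by near: M; exists N.
Unshelve. all: by end_near. Qed.

End summable_families.

(** * Derivatives and integrals on the line *)

Section derivative_rules.
Context {R : realType}.
Implicit Types (f g : R -> R) (x a b c : R).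

Lemma isder_cst x c : is_derive x 1 (fun _ : R => c) 0.
Proof. exact: is_derive_cst. Qed.

Lemma isder_id x : is_derive x 1 (fun t : R => t) 1.
Proof. exact: is_derive_id. Qed.

Lemma isder_add f g x a b : is_derive x 1 f a -> is_derive x 1 g b ->
  is_derive x 1 (fun t => f t + g t) (a + b).
Proof. by move=> fa gb; exact: is_deriveD. Qed.

Lemma isder_opp f x a : is_derive x 1 f a -> is_derive x 1 (fun t => - f t) (- a).
Proof. by move=> fa; exact: is_deriveN. Qed.

Lemma isder_mul f g x a b : is_derive x 1 f a -> is_derive x 1 g b ->
  is_derive x 1 (fun t => f t * g t) (a * g x + f x * b).
Proof.
move=> fa gb; apply: is_derive_eq (is_deriveM fa gb) _.
by rewrite /GRing.scale/= addrC mulrC; ring.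
Qed.

Lemma isder_exp f n x a : is_derive x 1 f a ->
  is_derive x 1 (fun t => f t ^+ n.+1) (n.+1%:R * f x ^+ n * a).
Proof.
move=> fa; elim: n => [|n IH].
  by apply: is_derive_eq fa _; rewrite expr0 !mul1r.
have := isder_mul fa IH.
have -> : (fun t => f t * f t ^+ n.+1) = (fun t => f t ^+ n.+2).
  by apply/funext => t; rewrite [RHS]exprS.
move/is_derive_eq; apply; rewrite [in LHS]exprS -[n.+2%:R]natr1 exprS; ring.
Qed.

Lemma isder_expR f x a : is_derive x 1 f a ->
  is_derive x 1 (fun t => expR (f t)) (expR (f x) * a).
Proof. by move=> fa; exact: (is_derive1_comp (is_derive_expR (f x)) fa). Qed.

Lemma isder_cos f x a : is_derive x 1 f a ->
  is_derive x 1 (fun t => cos (f t)) (- sin (f x) * a).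
Proof. by move=> fa; exact: (is_derive1_comp (is_derive_cos (f x)) fa). Qed.

Lemma isder_sin f x a : is_derive x 1 f a ->
  is_derive x 1 (fun t => sin (f t)) (cos (f x) * a).
Proof. by move=> fa; exact: (is_derive1_comp (is_derive_sin (f x)) fa). Qed.

Lemma isder_inv f x a : f x != 0 -> is_derive x 1 f a ->
  is_derive x 1 (fun t => (f t)^-1) (- (f x) ^- 2 * a).
Proof. by move=> f0 fa; exact: is_deriveV. Qed.

Lemma isder_comp f g x a b : is_derive (g x) 1 f a -> is_derive x 1 g b ->
  is_derive x 1 (fun t => f (g t)) (a * b).
Proof. by move=> fa gb; exact: (is_derive1_comp fa gb). Qed.

Lemma der_continuous f f' : (forall x, is_derive x 1 f (f' x)) -> continuous f.
Proof.
move=> ff x; apply: differentiable_continuous; apply/derivable1_diffP.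
exact: ex_derive.
Qed.

Lemma der_within f f' (A : set R) : (forall x, is_derive x 1 f (f' x)) ->
  {within A, continuous f}.
Proof. by move=> /der_continuous; exact: continuous_subspaceT. Qed.

(** [Num.min] and [Num.max] let the endpoints come in either order, so that a base point such as [0]
    or a node can be approached from both sides. *)
Lemma mean_value_le f f' (K a b : R) :
  (forall t, Num.min a b <= t <= Num.max a b -> is_derive t 1 f (f' t)) ->
  (forall t, Num.min a b <= t <= Num.max a b -> `|f' t| <= K) ->
  `|f b - f a| <= K * `|b - a|.
Proof.
wlog ab : a b / a <= b => [hw df fK|df fK].
  have [ab|/ltW ba] := leP a b; first exact: hw.
  rewrite distrC [X in _ * X]distrC; apply: hw => // t.
  - by rewrite minC maxC; exact: df.
  - by rewrite minC maxC; exact: fK.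
move: df fK; rewrite min_l// max_r// => df fK.
have cf : {within `[a, b], continuous f}.
  apply: derivable_within_continuous => x; rewrite in_itv/= => xab.
  by have := df _ xab => dfx; exact: ex_derive.
have df' x : x \in `]a, b[ -> is_derive x 1 f (f' x).
  by rewrite in_itv/= => /andP[ax xb]; apply: df; rewrite !ltW.
have [c cab ->] := MVT_segment ab df' cf.
by rewrite normrM ler_wpM2r// fK//; move: cab; rewrite in_itv.
Qed.

Lemma nonincr_of_der f f' a : (forall x, a < x -> is_derive x 1 f (f' x)) ->
  (forall x, a < x -> f' x <= 0) ->
  forall x y, a < x -> x <= y -> f y <= f x.
Proof.
move=> df f0 x y ax xy.
apply: (@ler0_derive1_nincr _ f x y) => //.
- move=> t; rewrite in_itv/= => /andP[xt _]; have := df t (lt_trans ax xt).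
  by move=> dft; exact: ex_derive.
- move=> t; rewrite in_itv/= => /andP[xt _]; have dft := df t (lt_trans ax xt).
  by rewrite derive1E derive_val f0// (lt_trans ax).
- apply: derivable_within_continuous => t; rewrite in_itv/= => /andP[xt _].
  by have dft := df t (lt_le_trans ax xt); exact: ex_derive.
Qed.

End derivative_rules.

(** [notypeclasses refine] leaves the derivatives of the subterms as goals for the next step, and
    [eassumption] comes first so that a derivative already in the context is used for an opaque
    function. [der_eq] leaves only the equality between the computed and the expected derivative. *)
Ltac der_step := first
  [ eassumption | notypeclasses refine (isder_cst _ _) | notypeclasses refine (isder_id _)
  | notypeclasses refine (isder_add _ _) | notypeclasses refine (isder_opp _)
  | notypeclasses refine (isder_exp _ _) | notypeclasses refine (isder_mul _ _)
  | notypeclasses refine (isder_expR _) | notypeclasses refine (isder_cos _)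
  | notypeclasses refine (isder_sin _) ].
Ltac der_eq := notypeclasses refine (is_derive_eq _ _); [repeat der_step|cbv beta].

(** * Taylor bounds and Gaussian domination *)

Section elementary_bounds.
Context {R : realType}.
Implicit Types x t : R.

Lemma normr_sin_le x : `|sin x| <= `|x|.
Proof.
have := @mean_value_le R sin cos 1 0 x.
rewrite sin0 !subr0 mul1r; apply.
by move=> t _; rewrite ler_norml cos_geN1 cos_le1.
Qed.

Lemma norm_between x t : Num.min 0 x <= t <= Num.max 0 x -> `|t| <= `|x|.
Proof.
have [x0|x0] := leP 0 x => /andP[h1 h2].
  by rewrite !ger0_norm.
by rewrite !ler0_norm ?lerN2// ltW.
Qed.

(** This bound and the next two each follow from the preceding one by [mean_value_le]. The constants
    are not sharp; only the orders of vanishing at [0] matter. *)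
Lemma normr_cosB1_le x : `|cos x - 1| <= x ^+ 2.
Proof.
have := @mean_value_le R cos (fun t => - sin t) `|x| 0 x.
rewrite cos0 !subr0 -expr2 real_normK ?num_real//; apply.
by move=> t /norm_between h; rewrite normrN (le_trans (normr_sin_le _)).
Qed.

Lemma normr_sinBx_le x : `|sin x - x| <= `|x| ^+ 3.
Proof.
have := @mean_value_le R (fun t => sin t - t) (fun t => cos t - 1) (x ^+ 2) 0 x.
rewrite sin0 !subr0 -[x ^+ 2]ger0_norm ?sqr_ge0// normrX -exprSr; apply.
move=> t /norm_between h; rewrite (le_trans (normr_cosB1_le _))//.
  by rewrite -[t ^+ 2]ger0_norm ?sqr_ge0// normrX lerXn2r// nnegrE.
Qed.

Lemma normr_cosB1D_le x : `|cos x - 1 + x ^+ 2 / 2| <= `|x| ^+ 4.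
Proof.
have := @mean_value_le R (fun t => cos t - 1 + t ^+ 2 / 2) (fun t => t - sin t) (`|x| ^+ 3) 0 x.
rewrite cos0 !subr0 subrr expr0n/= mul0r add0r subr0 -exprSr; apply.
- move=> t _; der_eq.
  by rewrite expr1; field.
- move=> t /norm_between h; rewrite distrC (le_trans (normr_sinBx_le _))//.
  by rewrite lerXn2r// nnegrE.
Qed.

Lemma oneDsqr_gt0 t : 0 < 1 + t ^+ 2.
Proof. by rewrite ltr_wpDr// sqr_ge0. Qed.

(** A Gaussian absorbs a factor [1 + t ^+ 2] and still leaves [(1 + t ^+ 2)^-1], which thereby
    serves as the common dominating function of all the integrals. The constant is the square of the
    2 in [1 + t ^+ 2 <= 2 * expR (t ^+ 2 / 2)]. *)
Lemma sqr_oneDsqr_gauss_le t : (1 + t ^+ 2) ^+ 2 * expR (- t ^+ 2) <= 4.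
Proof.
rewrite expRN ler_pdivrMr ?expR_gt0//.
have -> : expR (t ^+ 2) = expR (t ^+ 2 / 2) ^+ 2 by rewrite -expRM_natr; congr expR; field.
have h : 1 + t ^+ 2 <= 2 * expR (t ^+ 2 / 2).
  have := expR_ge1Dx (t ^+ 2 / 2); have := sqr_ge0 t; lra.
rewrite (_ : 4 * _ = (2 * expR (t ^+ 2 / 2)) ^+ 2); last by ring.
by rewrite lerXn2r// nnegrE ?(ltW (oneDsqr_gt0 _))// mulr_ge0// expR_ge0.
Qed.

Lemma gauss_dominated (p : R) t : 0 <= p -> p <= 1 + t ^+ 2 ->
  p * expR (- t ^+ 2) <= 4 * (1 + t ^+ 2)^-1.
Proof.
move=> p0 pt; rewrite ler_pdivlMr ?oneDsqr_gt0// mulrAC.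
rewrite (le_trans _ (sqr_oneDsqr_gauss_le t))// ler_wpM2r ?expR_ge0//.
by rewrite expr2 ler_wpM2r// ltW// oneDsqr_gt0.
Qed.

Lemma gauss_le1 t : expR (- t ^+ 2) <= 1.
Proof. by rewrite -expR0 ler_expR oppr_le0 sqr_ge0. Qed.

Lemma normr_le_oneDsqr t : `|t| <= 1 + t ^+ 2.
Proof. by rewrite -(real_normK (num_real t)); have := sqr_ge0 (`|t| - 1); have := normr_ge0 t; nra. Qed.

End elementary_bounds.

Local Notation mu := lebesgue_measure.
Local Notation integrableR f := (lebesgue_measure.-integrable [set: _] (EFin \o f)).
Local Notation "'intR' f" := (\int[lebesgue_measure]_(t in [set: _]) f t) (at level 10, f at level 9).

Section integrals_on_the_line.
Context {R : realType}.
Implicit Types f g : R -> R.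

Lemma measurable_of_continuous f : continuous f -> measurable_fun [set: R] f.
Proof. exact: measurable_realfun.continuous_measurable_fun. Qed.

(** Meant for the quotients by [t] or [t ^+ 2], whose value at [0] is fixed by a case distinction or
    by the convention for the inverse of zero. *)
Lemma measurable_except0 f : (forall t, t != 0 -> {for t, continuous f}) ->
  measurable_fun [set: R] f.
Proof.
move=> cf; rewrite -(setvU [set (0 : R)]).
apply/measurable_funU => //; first exact: measurableC.
split; last exact: measurable_fun_set1.
apply: measurable_realfun.open_continuous_measurable_fun.
  by rewrite openC; exact: closed_eq.
by move=> t; rewrite inE/= => /eqP/cf.
Qed.

Lemma integrable_oneDsqrV : integrableR (fun t : R => (1 + t ^+ 2)^-1).
Proof.
have c : continuous (fun t : R => (1 + t ^+ 2)^-1) by exact: continuous_oneDsqrV.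
have p (t : R) : 0 <= (1 + t ^+ 2)^-1 by rewrite invr_ge0 ltW// oneDsqr_gt0.
apply/integrableP; split; first by apply/measurable_EFinP; exact: (measurable_of_continuous c).
under eq_integral => t _ do rewrite /= ger0_norm//.
rewrite ge0_symfun_integralT//; last by move=> t /=; rewrite sqrrN.
rewrite (_ : [set x : R | 0 <= x] = `[0, +oo[%classic).
  by rewrite integral0y_oneDsqr -EFinM ltry.
by apply/seteqP; split => x /=; rewrite in_itv/= andbT.
Qed.

Lemma integrable_dominated f (C : R) : measurable_fun [set: R] f ->
  (forall t, `|f t| <= C * (1 + t ^+ 2)^-1) -> integrableR f.
Proof.
move=> mf fC.
apply: (@le_integrable _ _ R (@lebesgue_measure R) setT measurableT (EFin \o f) (fun t => (C * (1 + t ^+ 2)^-1)%:E)) => //.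
- exact/measurable_EFinP.
- by move=> t _; rewrite !abse_EFin lee_fin (le_trans (fC t))// ler_norm.
- exact: (integrableZl measurableT C integrable_oneDsqrV).
Qed.

(** Domination is asked only for [|x| < B]: in the unscreened case the derivative is bounded by a
    multiple of the frequency, hence only locally uniformly. *)
Lemma is_derive_integral (f f' : R -> R -> R) (C B b : R) :
  (forall x, integrableR (f x)) ->
  (forall (x t : R), is_derive x 1 (f ^~ t) (f' x t)) ->
  (forall x t, `|x| < B -> `|f' x t| <= C * (1 + t ^+ 2)^-1) ->
  `|b| < B ->
  is_derive b 1 (fun x => intR (f x)) (intR (f' b)).
Proof.
move=> itg df f'C bB.
have pE x t : partial1of2 f x t = f' x t.
  by rewrite partial1of2E; have dft := df x t; rewrite derive_val.
have C0 : 0 <= C.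
  have := le_trans (normr_ge0 _) (f'C b 0 bB).
  by rewrite expr0n addr0 invr1 mulr1.
have G0 : forall t : R, 0 <= C * (1 + t ^+ 2)^-1.
  by move=> t; rewrite mulr_ge0// invr_ge0 ltW// oneDsqr_gt0.
have intG : integrableR (fun t => C * (1 + t ^+ 2)^-1).
  exact: (integrableZl measurableT C integrable_oneDsqrV).
have Ib : `]- B, B[%classic b by rewrite /= in_itv/= -ltr_norml.
have dd x t : `]- B, B[%classic x -> [set: R] t -> derivable (f ^~ t) x 1.
  by move=> _ _; have dft := df x t; exact: ex_derive.
have ub x t : `]- B, B[%classic x -> [set: R] t -> `|partial1of2 f x t| <= C * (1 + t ^+ 2)^-1.
  by rewrite /= in_itv/= -ltr_norml pE => xB _; exact: f'C.
have itg' x : `]- B, B[%classic x -> integrableR (f x) by [].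
apply: DeriveDef.
  exact: (derivable_under_integral measurableT Ib itg' dd G0 intG ub).
rewrite -derive1E (differentiation_under_integral measurableT Ib itg' dd G0 intG ub).
by apply: eq_Rintegral => t _; rewrite pE.
Qed.

(** Dominated convergence for indicator functions that are eventually constant at each point. It
    covers sets that exhaust the line as well as sets that shrink to nothing. *)
Lemma cvg_integral_sets f (A : nat -> set R) (B : set R) : integrableR f ->
  (forall n, measurable (A n)) -> measurable B ->
  (forall t, \forall n \near \oo, (t \in A n) = (t \in B)) ->
  \int[mu]_(t in A n) f t @[n --> \oo] --> \int[mu]_(t in B) f t.
Proof.
move=> itg mA mB At.
have itgB : mu.-integrable B (EFin \o f) by exact: integrableS itg.
apply: fine_cvg; rewrite fineK; last exact: integrable_fin_num.
rewrite (_ : (fun n => _) = fun n => (\int[mu]_t ((EFin \o f) \_ (A n)) t)%E); last first.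
  by apply/funext => n; rewrite integral_mkcond.
rewrite integral_mkcond.
apply: (@dominated_cvg _ _ R (@lebesgue_measure R) setT measurableT _ _ (fun t => `|(f t)%:E|%E)) => //.
- move=> n; have mf : measurable_fun (A n) (EFin \o f).
    by apply: measurable_funTS; exact: (measurable_int _ itg).
  exact: (iffLR (measurable_restrictT (EFin \o f) (mA n)) mf).
- move=> t _; apply: cvg_near_cst; near=> n.
  rewrite !patchE (_ : (t \in A n) = (t \in B))//.
  by near: n; exact: At.
- exact: integrable_abse.
- by move=> n t _; rewrite patchE; case: ifP => // _; rewrite abse0.
Unshelve. all: by end_near. Qed.

Lemma cvg_integral_exhaust f (A : nat -> set R) : integrableR f ->
  (forall n, measurable (A n)) -> (forall t, \forall n \near \oo, A n t) ->
  \int[mu]_(t in A n) f t @[n --> \oo] --> intR f.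
Proof.
move=> itg mA At; apply: cvg_integral_sets => // t; near=> n.
by rewrite in_setT mem_set//; near: n; exact: At.
Unshelve. all: by end_near. Qed.

Lemma integral_derivative f (F : R -> R) (l l' : R) : integrableR f -> continuous f ->
  (forall t : R, is_derive t 1 F (f t)) ->
  F n%:R @[n --> \oo] --> l -> F (- n%:R) @[n --> \oo] --> l' ->
  intR f = l - l'.
Proof.
move=> itg cf dF Fl Fl'.
have h1 : F n%:R - F (- n%:R) @[n --> \oo] --> l - l' by exact: cvgB.
have h2 : \int[mu]_(t in `[- n%:R, n%:R]) f t @[n --> \oo] --> intR f.
  apply: cvg_integral_exhaust => // t; near=> n.
  by rewrite /= in_itv/= -ler_norml; near: n; exact: nbhs_infty_ger.
apply: (cvg_unique _ h2); first exact: Rhausdorff.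
apply: cvg_trans h1; apply: near_eq_cvg; near=> n.
have n0 : - n%:R < n%:R :> R by rewrite gtrN// ltr0n; near: n; exists 1%N.
rewrite /Rintegral (continuous_FTC2 n0 (F := F)) ?fineK//.
- exact: continuous_subspaceT.
- split.
  + by move=> x _; have dFx := dF x; exact: ex_derive.
  + exact/cvg_at_right_filter/(der_continuous dF).
  + exact/cvg_at_left_filter/(der_continuous dF).
- by move=> x _; have dFx := dF x; rewrite derive1E derive_val.
Unshelve. all: by end_near. Qed.

Lemma normr_integral_dominated f (C : R) : measurable_fun [set: R] f ->
  (forall t, `|f t| <= C * (1 + t ^+ 2)^-1) ->
  `|intR f| <= C * intR (fun t : R => (1 + t ^+ 2)^-1).
Proof.
move=> mf fC; have itg := integrable_dominated mf fC.
rewrite (le_trans (le_normr_Rintegral measurableT itg))//.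
rewrite -(RintegralZl C measurableT integrable_oneDsqrV) le_Rintegral//.
  exact: (integrable_abse itg).
exact: (integrableZl measurableT C integrable_oneDsqrV).
Qed.

End integrals_on_the_line.

(** * The Fourier transform of the Gaussian *)

Section gaussian_fourier.
Context {R : realType}.
Implicit Types (a b t x : R).

Lemma gauss_dominatedM (f : R -> R) (K : R) t : 0 <= K -> `|f t| <= K * (1 + t ^+ 2) ->
  `|expR (- t ^+ 2) * f t| <= 4 * K * (1 + t ^+ 2)^-1.
Proof.
move=> K0 fK; rewrite normrM [X in X * _]ger0_norm ?expR_ge0// mulrC.
rewrite (le_trans (ler_wpM2r (expR_ge0 _) fK))// -mulrA [leRHS](_ : _ = K * (4 * (1 + t ^+ 2)^-1)); last by ring.
by rewrite -[leLHS]mulrA ler_wpM2l// gauss_dominated// ltW// oneDsqr_gt0.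
Qed.

Lemma integrable_gaussM (f : R -> R) (K : R) : 0 <= K -> measurable_fun [set: R] f ->
  (forall t, `|f t| <= K * (1 + t ^+ 2)) -> integrableR (fun t : R => expR (- t ^+ 2) * f t).
Proof.
move=> K0 mf fK; apply: (@integrable_dominated _ _ (4 * K)).
  apply: measurable_funM => //; apply: measurable_of_continuous.
  by apply: (@der_continuous _ _ (fun t => expR (- t ^+ 2) * (- (2%:R * t ^+ 1 * 1)))) => t; der_eq.
by move=> t; exact: gauss_dominatedM.
Qed.

Lemma oneDsqr_ge1 t : 1 <= 1 + t ^+ 2.
Proof. by rewrite lerDl sqr_ge0. Qed.

Lemma continuous_cosM b : continuous (fun t : R => cos (b * t)).
Proof.
by apply: (@der_continuous _ _ (fun t => - sin (b * t) * (0 * t + b * 1))) => t; der_eq.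
Qed.

Lemma continuous_sinM b : continuous (fun t : R => sin (b * t)).
Proof.
by apply: (@der_continuous _ _ (fun t => cos (b * t) * (0 * t + b * 1))) => t; der_eq.
Qed.

Lemma integrable_gauss_cos b : integrableR (fun t : R => expR (- t ^+ 2) * cos (b * t)).
Proof.
apply: (@integrable_gaussM _ 1) => //; first exact: (measurable_of_continuous (@continuous_cosM b)).
by move=> t; rewrite mul1r (le_trans _ (oneDsqr_ge1 t))// ler_norml cos_geN1 cos_le1.
Qed.

Lemma integrable_gauss_tsin b :
  integrableR (fun t : R => expR (- t ^+ 2) * (t * sin (b * t))).
Proof.
apply: (@integrable_gaussM _ 1) => //.
  apply: measurable_funM => //; exact: (measurable_of_continuous (@continuous_sinM b)).
move=> t; rewrite mul1r (le_trans _ (normr_le_oneDsqr t))// normrM.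
by rewrite ler_piMr// ler_norml sin_geN1 sin_le1.
Qed.

Lemma gauss_fun_cvg0 : expR (- (n%:R ^+ 2)) @[n --> \oo] --> (0 : R).
Proof.
apply: (@squeeze_cvgr _ _ _ _ (fun=> 0) (fun n => n.+1%:R^-1)) => //.
- near=> n; rewrite expR_ge0/= expRN lef_pV2 ?posrE ?expR_gt0//.
  rewrite (le_trans _ (expR_ge1Dx _))// -natr1 addrC lerD2l.
  by rewrite -natrX ler_nat; case: (n) => // m; rewrite leq_pmulr.
- exact: cvg_cst.
- exact: cvg_harmonic.
Unshelve. all: by end_near. Qed.

(** Integration by parts: the difference of the two integrands is the derivative of
    [2^-1 * (expR (- t ^+ 2) * sin (b * t))], which vanishes at both ends of the line. *)
Lemma gauss_tsin_cos b : intR (fun t : R => expR (- t ^+ 2) * (t * sin (b * t))) =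
  b / 2 * intR (fun t : R => expR (- t ^+ 2) * cos (b * t)).
Proof.
have := @integral_derivative R
  (fun t => b / 2 * (expR (- t ^+ 2) * cos (b * t)) - expR (- t ^+ 2) * (t * sin (b * t)))
  (fun t => 2^-1 * (expR (- t ^+ 2) * sin (b * t))) 0 0.
have i1 := integrable_gauss_cos b; have i2 := integrable_gauss_tsin b.
have i3 : integrableR (fun t : R => b / 2 * (expR (- t ^+ 2) * cos (b * t))).
  exact: (integrableZl measurableT (b / 2) i1).
have half_cvg (e : nat -> R) : (forall n, `|e n| <= 1) ->
    2^-1 * (expR (- n%:R ^+ 2) * e n) @[n --> \oo] --> (0 : R).
  move=> e1; apply: norm_cvg0.
  apply: (@squeeze_cvgr _ _ _ _ (fun=> 0) (fun n => expR (- n%:R ^+ 2))).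
  - near=> n; rewrite normr_ge0/= normrM normrM ger0_norm ?invr_ge0//.
    rewrite [X in _ * (X * _)]ger0_norm ?expR_ge0//.
    have := e1 n; have := normr_ge0 (e n); have := expR_ge0 (- n%:R ^+ 2 : R); nra.
  - exact: cvg_cst.
  - exact: gauss_fun_cvg0.
rewrite subrr RintegralB// RintegralZl// => h; apply/eqP; rewrite eq_sym -subr_eq0; apply/eqP.
apply: h.
- exact: (integrableB measurableT i3 i2).
- apply: (@der_continuous _ _ (fun t => _)) => t; der_eq; reflexivity.
- move=> t; der_eq; by field.
- by apply: half_cvg => n; rewrite ler_norml sin_geN1 sin_le1.
- under eq_fun do rewrite sqrrN.
  by apply: half_cvg => n; rewrite ler_norml sin_geN1 sin_le1.
Unshelve. all: by end_near. Qed.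

Lemma is_derive_gauss_cos b :
  is_derive b 1 (fun b => intR (fun t : R => expR (- t ^+ 2) * cos (b * t)))
    (- (b / 2) * intR (fun t : R => expR (- t ^+ 2) * cos (b * t))).
Proof.
have := @is_derive_integral R (fun b t => expR (- t ^+ 2) * cos (b * t))
  (fun b t => -1 * (expR (- t ^+ 2) * (t * sin (b * t)))) 4 (`|b| + 1) b.
rewrite RintegralZl ?gauss_tsin_cos ?mulN1r ?mulNr//; last exact: integrable_gauss_tsin.
apply.
- exact: integrable_gauss_cos.
- move=> x t; der_eq; ring.
- move=> x t _; rewrite mulN1r normrN -[4]mulr1.
  apply: (gauss_dominatedM (f := fun t => t * sin (x * t))) => //.
  rewrite mul1r (le_trans _ (normr_le_oneDsqr t))// normrM.
  by rewrite ler_piMr// ler_norml sin_geN1 sin_le1.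
- by rewrite ltrDl.
Qed.

(** The integral solves [y' = - (b / 2) * y], so its product with [expR (b ^+ 2 / 4)] is constant;
    its value at [b = 0] is the Gaussian integral. *)
Lemma integral_gauss_cos b : intR (fun t : R => expR (- t ^+ 2) * cos (b * t)) =
  Num.sqrt pi * expR (- (b ^+ 2 / 4)).
Proof.
pose y b := intR (fun t : R => expR (- t ^+ 2) * cos (b * t)).
have d x : is_derive x 1 (fun b => y b * expR (b ^+ 2 / 4)) 0.
  have dy := is_derive_gauss_cos x; rewrite -/(y x) in dy.
  rewrite -/y in dy.
  der_eq; by field.
have := is_derive_0_is_cst b 0 d.
rewrite {2}/y expr0n/= mul0r expR0 mulr1.
under eq_Rintegral do rewrite mul0r cos0 mulr1.
rewrite /Rintegral integralT_gauss/= => <-.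
by rewrite -mulrA -expRD addrN expR0 mulr1.
Qed.

End gaussian_fourier.

(** * Fourier transforms of the screened and unscreened kernels *)

Section gauss_tail.
Context {R : realType}.
Implicit Types (x : R).

Let g (t : R) : R := expR (- t ^+ 2).

(** This is [sqrt pi / 2] times the complementary error function at [x]. The reflected half-line is
    used because the fundamental theorem differentiates in the upper endpoint. *)
Definition gauss_tail x : R := \int[mu]_(t in `]-oo, - x]) expR (- t ^+ 2).

Let ig : integrableR g.
Proof. exact: integrableT_gauss. Qed.

Let sp : R := Num.sqrt pi.

Let intg : intR g = sp.
Proof. by rewrite /Rintegral integralT_gauss. Qed.

Lemma gauss_tail_ge0 x : 0 <= gauss_tail x.
Proof. by apply: Rintegral_ge0 => t _; exact: expR_ge0. Qed.

Lemma is_derive_gauss_tail x : is_derive x 1 gauss_tail (- expR (- x ^+ 2)).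
Proof.
have h (y : R) : is_derive y 1 (fun x : R => \int[mu]_(t in `]-oo, x]) g t) (g y).
  have y1 : y < y + 1 by rewrite ltrDl.
  have igy : mu.-integrable `]-oo, y + 1] (EFin \o g) by exact: integrableS ig.
  have [d e] := continuous_FTC1 y1 igy (ltNyr y) (@continuous_gauss_fun R y).
  by apply: DeriveDef; [exact: d|rewrite -derive1E; exact: e].
have := isder_comp (h (- x)) (isder_opp (isder_id x)).
by move/is_derive_eq; apply; rewrite /g sqrrN mulrN1.
Qed.

Lemma cvg_gauss_tail : gauss_tail n%:R @[n --> \oo] --> (0 : R).
Proof.
rewrite -[X in _ --> X](Rintegral_set0 mu g).
apply: cvg_integral_sets => // t; near=> n.
rewrite in_set0; apply/negbTE; rewrite notin_setE/= in_itv/=; apply/negP.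
by rewrite -ltNge ltrNl; near: n; exact: nbhs_infty_gtr.
Unshelve. all: by end_near. Qed.

Lemma gauss_tailD x : gauss_tail x + gauss_tail (- x) = Num.sqrt pi.
Proof.
have d (y : R) : is_derive y 1 (fun y => gauss_tail y + gauss_tail (- y)) 0.
  have d1 := is_derive_gauss_tail y.
  have d2 := isder_comp (is_derive_gauss_tail (- y)) (isder_opp (isder_id y)).
  by der_eq; rewrite sqrrN mulrN1 opprK addNr.
have c n : gauss_tail n%:R + gauss_tail (- n%:R) = gauss_tail x + gauss_tail (- x).
  exact: is_derive_0_is_cst _ _ d.
have h2 : gauss_tail (- n%:R) @[n --> \oo] --> sp.
  rewrite -intg; apply: cvg_integral_exhaust => // t; near=> n.
  by rewrite /= in_itv/= opprK; near: n; exact: nbhs_infty_ger.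
have h3 : gauss_tail n%:R + gauss_tail (- n%:R) @[n --> \oo] --> 0 + sp.
  exact: cvgD cvg_gauss_tail h2.
have : (fun n => gauss_tail n%:R + gauss_tail (- n%:R)) @ \oo --> gauss_tail x + gauss_tail (- x).
  rewrite (_ : (fun n => _) = fun=> gauss_tail x + gauss_tail (- x)); first exact: cvg_cst.
  by apply/funext => n; exact: c.
move=> h4; rewrite (cvg_unique _ h4 h3) ?add0r//; exact: Rhausdorff.
Unshelve. all: by end_near. Qed.

Lemma gauss_tail_le x : gauss_tail x <= Num.sqrt pi.
Proof. by rewrite -(gauss_tailD x) lerDl gauss_tail_ge0. Qed.

Lemma gauss_tail0 : gauss_tail (0 : R) = Num.sqrt pi / 2.
Proof. by have := gauss_tailD 0; rewrite oppr0 => <-; field. Qed.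

(** Mills' inequality. The difference [k] between [expR (- y ^+ 2) / (2 * y)] and the tail is
    non-increasing and tends to [0] at infinity, hence is non-negative. *)
Lemma mul_gauss_tail_le x : 0 < x -> 2 * x * gauss_tail x <= expR (- x ^+ 2).
Proof.
pose k (y : R) := expR (- y ^+ 2) * (2 * y)^-1 - gauss_tail y.
pose k' (y : R) := - (expR (- y ^+ 2) * (2 * y ^+ 2)^-1).
have dk (y : R) : 0 < y -> is_derive y 1 k (k' y).
  move=> y0; have d1 := is_derive_gauss_tail y.
  have d2 : is_derive y 1 (fun y : R => (2 * y)^-1) (- (2 * y) ^- 2 * (0 * y + 2 * 1)).
    apply: isder_inv; first by rewrite mulf_neq0 ?gt_eqF.
    exact: isder_mul (isder_cst _ _) (isder_id _).
  by rewrite /k /k'; der_eq; field; rewrite gt_eqF.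
have k'0 (y : R) : 0 < y -> k' y <= 0.
  by move=> y0; rewrite /k' oppr_le0 mulr_ge0 ?expR_ge0// invr_ge0 mulr_ge0// sqr_ge0.
move=> x0; have kx : 0 <= k x.
  have kn : k n.+1%:R @[n --> \oo] --> (0 : R).
    rewrite -[X in _ --> X]subr0; apply: cvgB; last first.
      by rewrite (_ : (fun n => _) = (fun n => gauss_tail n%:R) \o succn)// cvg_shiftS; exact: cvg_gauss_tail.
    apply: (@squeeze_cvgr _ _ _ _ (fun=> 0) (fun n => n.+1%:R^-1)).
    - near=> n; rewrite mulr_ge0 ?expR_ge0 ?invr_ge0 ?mulr_ge0//=.
      rewrite -[leRHS]mul1r ler_pM ?expR_ge0 ?invr_ge0 ?mulr_ge0// ?gauss_le1//.
      by rewrite lef_pV2 ?posrE ?mulr_gt0// ler_peMl// ler1n.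
    - exact: cvg_cst.
    - exact: cvg_harmonic.
  rewrite -(cvg_lim (@Rhausdorff R) kn).
  apply: limr_le; first by apply/cvg_ex; exists 0.
  near=> n; apply: (nonincr_of_der dk k'0) => //.
  near: n; exists (Num.truncn x) => // n /= xn.
  by rewrite (le_trans (ltW (truncnS_gt x)))// ler_nat.
move: kx; rewrite /k subr_ge0 => /(ler_wpM2l (_ : 0 <= 2 * x)) h.
by rewrite (le_trans (h _)) ?mulr_ge0 ?(ltW x0)// mulrCA mulfV ?mulr1// mulf_neq0// gt_eqF.
Unshelve. all: by end_near. Qed.

Lemma sqrt_pi_ge1 : 1 <= Num.sqrt pi :> R.
Proof. by rewrite -sqrtr1 ler_wsqrtr// (le_trans _ (pi_ge2 R))// ler1n. Qed.

(** Mills' inequality degenerates at [0]. For [x <= 1] the trivial bound [sqrt pi] is used instead,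
    and the factor [expR 1] makes up for [expR (- x ^+ 2)]. *)
Lemma gauss_tail_le_gauss x : 0 <= x ->
  gauss_tail x <= Num.sqrt pi * expR 1 * expR (- x ^+ 2).
Proof.
move=> x0; have s1 := sqrt_pi_ge1; have e1 := expR_gt1Dx (@oner_neq0 R).
have [x1|x1] := leP x 1.
  rewrite (le_trans (gauss_tail_le x))// -mulrA -expRD ler_peMr// ?(le_trans _ s1)//.
  by rewrite -[leLHS]expR0 ler_expR subr_ge0 expr_le1.
have x00 : 0 < x by rewrite (lt_trans _ x1).
have := mul_gauss_tail_le x00; have := gauss_tail_ge0 x; have := expR_gt0 (- x ^+ 2).
move=> p0 t0 h.
have c1 : 1 <= Num.sqrt pi * expR 1 :> R by rewrite mulr_ege1// ltW// (lt_trans _ e1)// ltrDl.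
nra.
Qed.

End gauss_tail.

(** * Bounded solutions of the homogeneous equation *)

Section bounded_ode.
Context {R : realType}.

Lemma le_expRN_eq0 (c K a : R) : 0 < a ->
  (forall x : R, 0 <= x -> `|c| <= K * expR (- (a * x))) -> c = 0.
Proof.
move=> a0 h; apply/eqP; rewrite -normr_eq0; apply/negPn/negP => c0.
have cp : 0 < `|c| by rewrite lt_def c0/=.
have K0 : 0 < K.
  by have := h 0 (lexx _); rewrite mulr0 oppr0 expR0 mulr1; exact: lt_le_trans.
(* At this point [expR (a * x)] exceeds [a * x = K / |c|], which contradicts the assumed bound. *)
have x0 : 0 <= K / (a * `|c|) by rewrite divr_ge0 ?mulr_ge0// ltW.
have := h _ x0; rewrite expRN.
have -> : a * (K / (a * `|c|)) = K / `|c| by field; rewrite c0 gt_eqF.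
rewrite leNgt => /negP; apply.
rewrite ltr_pdivrMr ?expR_gt0// -ltr_pdivrMl// mulrC.
apply: lt_le_trans (expR_ge1Dx _); by rewrite ltrDr.
Qed.

(* If [s ^+ 2 = a ^+ 2], then [D1 + s * D] solves a first-order equation, so it is a multiple of an exponential,
   and boundedness forces it to vanish. *)
Lemma bounded_ode_eq0 (D D1 : R -> R) (a K : R) : 0 < a ->
  (forall b : R, is_derive b 1 D (D1 b)) ->
  (forall b : R, is_derive b 1 D1 (a ^+ 2 * D b)) ->
  (forall b, `|D b| <= K) -> (forall b, `|D1 b| <= K) ->
  forall b, D b = 0.
Proof.
move=> a0 dD dD1 DK D1K.
have step (s : R) : s ^+ 2 = a ^+ 2 -> forall b, D1 b + s * D b = 0.
  move=> s2 b.
  have d (x : R) : is_derive x 1 (fun x => (D1 x + s * D x) * expR (- (s * x))) 0.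
    have h1 := dD x; have h2 := dD1 x.
    der_eq; rewrite -s2; ring.
  have c x : (D1 x + s * D x) * expR (- (s * x)) = (D1 b + s * D b) * expR (- (s * b)).
    exact: is_derive_0_is_cst _ _ d.
  suff : (D1 b + s * D b) * expR (- (s * b)) = 0.
    by move/eqP; rewrite mulf_eq0 (gt_eqF (expR_gt0 _)) orbF => /eqP.
  apply: (@le_expRN_eq0 _ (K + `|s| * K) a) => // x x0.
  (* The constant is read off on the side of the line where [expR (- (s * y))] decays: the right one
     for [s = a], the left one for [s = - a]. *)
  have [y sy] : exists y, s * y = a * x.
    have [se|se] : s = a \/ s = - a.
      by move/eqP: s2; rewrite eqf_sqr => /orP[]/eqP; [left|right].
    - by exists x; rewrite se.
    - by exists (- x); rewrite se mulrNN.
  rewrite -(c y) sy normrM [X in _ * X <= _]ger0_norm ?expR_ge0// ler_wpM2r ?expR_ge0//.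
  by rewrite (le_trans (ler_normD _ _))// lerD// normrM ler_wpM2l.
move=> b; have h1 := step a erefl b.
have h2 := step (- a) (sqrrN _) b.
have : 2 * a * D b = 0 by lra.
by move/eqP; rewrite !mulf_eq0 pnatr_eq0/= (gt_eqF a0) => /eqP.
Qed.

End bounded_ode.

(** * The transform of the kernel for nonzero lateral modes *)

Section screened_fourier.
Context {R : realType}.
Variable a : R.
Hypothesis a0 : 0 < a.
Implicit Types (b t : R).

Let a2t t : 0 < a ^+ 2 + t ^+ 2.
Proof. by rewrite ltr_wpDr ?sqr_ge0// exprn_gt0. Qed.

Let inv_le t : (a ^+ 2 + t ^+ 2)^-1 <= a ^- 2.
Proof. by rewrite lef_pV2 ?posrE ?exprn_gt0// lerDl sqr_ge0. Qed.

Lemma continuous_screen : continuous (fun t : R => (a ^+ 2 + t ^+ 2)^-1).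
Proof.
apply: (@der_continuous _ _ (fun t => - (a ^+ 2 + t ^+ 2) ^- 2 * (0 + 2%:R * t ^+ 1 * 1))) => t.
apply: isder_inv; first by rewrite gt_eqF.
by der_eq.
Qed.

(* [expR (- a ^+ 2) * J b] is the integral of the kernel of [fourier_integrand]. *)
Let J b := intR (fun t : R => expR (- t ^+ 2) * ((a ^+ 2 + t ^+ 2)^-1 * cos (b * t))).
Let J1 b := intR (fun t : R => expR (- t ^+ 2) * (- t * (a ^+ 2 + t ^+ 2)^-1 * sin (b * t))).

Let mcos b : measurable_fun [set: R] (fun t => (a ^+ 2 + t ^+ 2)^-1 * cos (b * t)).
Proof.
apply: measurable_funM; first exact: (measurable_of_continuous continuous_screen).
exact: (measurable_of_continuous (@continuous_cosM _ b)).
Qed.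

Let mtsin b : measurable_fun [set: R] (fun t => - t * (a ^+ 2 + t ^+ 2)^-1 * sin (b * t)).
Proof.
apply: measurable_funM; last exact: (measurable_of_continuous (@continuous_sinM _ b)).
apply: measurable_funM; last exact: (measurable_of_continuous continuous_screen).
exact: measurable_funN.
Qed.

Let bcos b t : `|(a ^+ 2 + t ^+ 2)^-1 * cos (b * t)| <= a ^- 2 * (1 + t ^+ 2).
Proof.
rewrite normrM ler_pM//.
  by rewrite ger0_norm ?invr_ge0 ?(ltW (a2t _)).
by rewrite (le_trans _ (oneDsqr_ge1 t))// ler_norml cos_geN1 cos_le1.
Qed.

Let btsin b t : `|- t * (a ^+ 2 + t ^+ 2)^-1 * sin (b * t)| <= a ^- 2 * (1 + t ^+ 2).
Proof.
have s1 : `|sin (b * t)| <= 1 by rewrite ler_norml sin_geN1 sin_le1.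
rewrite normrM -[leRHS]mulr1 ler_pM// normrM mulrC ler_pM//.
  by rewrite ger0_norm ?invr_ge0 ?(ltW (a2t _)).
by rewrite normrN normr_le_oneDsqr.
Qed.

Let bt2cos b t : `|- t * (a ^+ 2 + t ^+ 2)^-1 * (t * cos (b * t))| <= a ^- 2 * (1 + t ^+ 2).
Proof.
have s1 : `|cos (b * t)| <= 1 by rewrite ler_norml cos_geN1 cos_le1.
rewrite (_ : - t * _ * _ = - ((a ^+ 2 + t ^+ 2)^-1 * t ^+ 2 * cos (b * t))); last by ring.
rewrite normrN normrM -[leRHS]mulr1 ler_pM// normrM ler_pM//.
  by rewrite ger0_norm ?invr_ge0 ?(ltW (a2t _)).
by rewrite ger0_norm ?sqr_ge0// lerDr.
Qed.

Let a2 : 0 <= a ^- 2. Proof. by rewrite invr_ge0 sqr_ge0. Qed.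

Let dJ b : is_derive b 1 J (J1 b).
Proof.
apply: (@is_derive_integral R (fun b t => expR (- t ^+ 2) * ((a ^+ 2 + t ^+ 2)^-1 * cos (b * t)))
  (fun b t => expR (- t ^+ 2) * (- t * (a ^+ 2 + t ^+ 2)^-1 * sin (b * t))) (4 * a ^- 2) (`|b| + 1)).
- by move=> x; apply: (integrable_gaussM a2 (mcos x)) => t; exact: bcos.
- by move=> x t; der_eq; ring.
- by move=> x t _; apply: (gauss_dominatedM (f := fun t => - t * (a ^+ 2 + t ^+ 2)^-1 * sin (x * t))).
- by rewrite ltrDl.
Qed.

(** Since [t ^+ 2 / (a ^+ 2 + t ^+ 2) = 1 - a ^+ 2 / (a ^+ 2 + t ^+ 2)], the second derivative of
    [J] is [a ^+ 2 * J] minus the transform of the Gaussian. *)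
Let dJ1 b : is_derive b 1 J1 (a ^+ 2 * J b - Num.sqrt pi * expR (- (b ^+ 2 / 4))).
Proof.
have := @is_derive_integral R (fun b t => expR (- t ^+ 2) * (- t * (a ^+ 2 + t ^+ 2)^-1 * sin (b * t)))
  (fun b t => expR (- t ^+ 2) * (- t * (a ^+ 2 + t ^+ 2)^-1 * (t * cos (b * t)))) (4 * a ^- 2) (`|b| + 1) b.
have -> : intR (fun t : R => expR (- t ^+ 2) * (- t * (a ^+ 2 + t ^+ 2)^-1 * (t * cos (b * t)))) =
    a ^+ 2 * J b - Num.sqrt pi * expR (- (b ^+ 2 / 4)).
  rewrite -integral_gauss_cos /J.
  have i1 := integrable_gaussM a2 (mcos b) (bcos b).
  rewrite -RintegralZl// -RintegralB//; last 2 first.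
  - exact: (integrableZl measurableT (a ^+ 2) i1).
  - exact: integrable_gauss_cos.
  by apply: eq_Rintegral => t _; field; rewrite gt_eqF.
apply.
- by move=> x; apply: (integrable_gaussM a2 (mtsin x)) => t; exact: btsin.
- by move=> x t; der_eq; ring.
- by move=> x t _; apply: (gauss_dominatedM (f := fun t => - t * (a ^+ 2 + t ^+ 2)^-1 * (t * cos (x * t)))).
- by rewrite ltrDl.
Qed.

(** Closed form of the bounded solution of the equation for [J]. The Gaussians produced by
    differentiating the two tails cancel in [V1]; in the derivative of [V1] they add up to the
    source term. *)
Let V b := expR (a ^+ 2) * (Num.sqrt pi / a) *
  (expR (a * b) * gauss_tail (a + b / 2) + expR (- (a * b)) * gauss_tail (a - b / 2)).
Let V1 b := expR (a ^+ 2) * Num.sqrt pi *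
  (expR (a * b) * gauss_tail (a + b / 2) - expR (- (a * b)) * gauss_tail (a - b / 2)).

Let esq b : expR (- (a + b / 2) ^+ 2) = expR (- a ^+ 2) * expR (- (a * b)) * expR (- (b ^+ 2 / 4)).
Proof. by rewrite -!expRD; congr expR; field. Qed.

Let esqN b : expR (- (a - b / 2) ^+ 2) = expR (- a ^+ 2) * expR (a * b) * expR (- (b ^+ 2 / 4)).
Proof. by rewrite -!expRD; congr expR; field. Qed.

Let dtail1 b : is_derive b 1 (fun b => gauss_tail (a + b / 2)) (- expR (- (a + b / 2) ^+ 2) / 2).
Proof.
have d : is_derive b 1 (fun b : R => a + b / 2) (2^-1) by der_eq; ring.
by apply: is_derive_eq (isder_comp (is_derive_gauss_tail _) d) _.
Qed.

Let dtail2 b : is_derive b 1 (fun b => gauss_tail (a - b / 2)) (expR (- (a - b / 2) ^+ 2) / 2).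
Proof.
have d : is_derive b 1 (fun b : R => a - b / 2) (- 2^-1) by der_eq; ring.
by apply: is_derive_eq (isder_comp (is_derive_gauss_tail _) d) _; rewrite mulrNN.
Qed.

Let dV b : is_derive b 1 V (V1 b).
Proof.
have d1 := dtail1 b; have d2 := dtail2 b; rewrite /V /V1; der_eq.
by rewrite esq esqN !expRN; field; rewrite !gt_eqF ?expR_gt0.
Qed.

Let dV1 b : is_derive b 1 V1 (a ^+ 2 * V b - Num.sqrt pi * expR (- (b ^+ 2 / 4))).
Proof.
have d1 := dtail1 b; have d2 := dtail2 b; rewrite /V /V1; der_eq.
by rewrite esq esqN !expRN; field; rewrite !gt_eqF ?expR_gt0.
Qed.

Let C : R := Num.sqrt pi * expR 1.

Lemma exp_gauss_tail_le b : 0 <= b ->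
  expR (a * b) * gauss_tail (a + b / 2) <= C * expR (- a ^+ 2) * expR (- (b ^+ 2 / 4)).
Proof.
move=> b0; have ab : 0 <= a + b / 2 by rewrite addr_ge0 ?divr_ge0 ?(ltW a0).
have := ler_wpM2l (expR_ge0 (a * b)) (gauss_tail_le_gauss ab).
rewrite esq => /le_trans; apply.
by rewrite le_eqVlt; apply/orP; left; apply/eqP; rewrite -/C !expRN; field; rewrite !gt_eqF ?expR_gt0.
Qed.

Let C1 : 1 <= C.
Proof.
rewrite mulr_ege1 ?sqrt_pi_ge1//; have := expR_ge1Dx (1 : R); lra.
Qed.

Let tailC x : gauss_tail x <= C.
Proof.
rewrite (le_trans (gauss_tail_le x))// ler_peMr ?sqrtr_ge0//.
have := expR_ge1Dx (1 : R); lra.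
Qed.

(** Gives the boundedness of [V] and [V1] that uniqueness requires; their second tail term is the
    first one taken at [- b]. For [b >= 0] the tail outweighs [expR (a * b)], and for [b < 0] the
    exponential is at most 1. *)
Let Vpart b : 0 <= expR (a * b) * gauss_tail (a + b / 2) <= C.
Proof.
rewrite mulr_ge0 ?expR_ge0 ?gauss_tail_ge0//=.
have [b0|b0] := leP 0 b.
  rewrite (le_trans (exp_gauss_tail_le b0))// -mulrA ler_piMr ?(le_trans _ C1)//.
  by rewrite -expRD -[leRHS]expR0 ler_expR; have := sqr_ge0 a; have := sqr_ge0 b; lra.
rewrite (le_trans _ (tailC (a + b / 2)))// ler_piMl ?gauss_tail_ge0//.
by rewrite -expR0 ler_expR pmulr_rle0// ltW.
Qed.

(** [J] and [V] solve the same inhomogeneous equation, so their difference is a bounded solution of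
    [y'' = a ^+ 2 * y] and vanishes. *)
Let JV b : J b = V b.
Proof.
apply/eqP; rewrite -subr_eq0; apply/eqP.
pose G := intR (fun t : R => (1 + t ^+ 2)^-1).
have G0 : 0 <= G by apply: Rintegral_ge0 => t _; rewrite invr_ge0 ltW// oneDsqr_gt0.
pose E := expR (a ^+ 2) * (Num.sqrt pi / a).
pose E1 := expR (a ^+ 2) * Num.sqrt pi.
have E0 : 0 <= E by rewrite mulr_ge0 ?expR_ge0// divr_ge0 ?sqrtr_ge0 ?(ltW a0).
have E10 : 0 <= E1 by rewrite mulr_ge0 ?expR_ge0// sqrtr_ge0.
apply: (@bounded_ode_eq0 R (fun b => J b - V b) (fun b => J1 b - V1 b) a
  (4 * a ^- 2 * G + (E + E1) * (2 * C))) => // {}b.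
- have h1 := dJ b; have h2 := dV b; exact: isder_add h1 (isder_opp h2).
- have h1 := dJ1 b; have h2 := dV1 b.
  apply: is_derive_eq (isder_add h1 (isder_opp h2)) _; ring.
- rewrite (le_trans (ler_normB _ _))// lerD//.
    apply: normr_integral_dominated.
      apply: measurable_funM; last exact: mcos.
      by apply: measurable_of_continuous; exact: continuous_gauss_fun.
    by move=> t; apply: (gauss_dominatedM (f := fun t => (a ^+ 2 + t ^+ 2)^-1 * cos (b * t))).
  have /andP[p1 p2] := Vpart b; have /andP[] := Vpart (- b).
  rewrite mulrN mulNr => q1 q2.
  rewrite /V -/E ger0_norm; last by rewrite mulr_ge0// addr_ge0.
  by rewrite ler_pM ?addr_ge0 ?lerDl// mulr2n mulrDl mul1r lerD.
- rewrite (le_trans (ler_normB _ _))// lerD//.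
    apply: normr_integral_dominated.
      apply: measurable_funM; last exact: mtsin.
      by apply: measurable_of_continuous; exact: continuous_gauss_fun.
    by move=> t; apply: (gauss_dominatedM (f := fun t => - t * (a ^+ 2 + t ^+ 2)^-1 * sin (b * t))).
  have /andP[p1 p2] := Vpart b; have /andP[] := Vpart (- b).
  rewrite mulrN mulNr => q1 q2.
  rewrite /V1 -/E1 normrM [X in X * _]ger0_norm// ler_pM ?lerDr//.
  by rewrite (le_trans (ler_normB _ _))// !ger0_norm// mulr2n mulrDl mul1r lerD.
Qed.

Lemma screened_fourierE b :
  intR (fun t : R => expR (- a ^+ 2 - t ^+ 2) / (a ^+ 2 + t ^+ 2) * cos (b * t)) =
  Num.sqrt pi / a *
  (expR (a * b) * gauss_tail (a + b / 2) + expR (- (a * b)) * gauss_tail (a - b / 2)).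
Proof.
transitivity (expR (- a ^+ 2) * J b).
  rewrite -RintegralZl//; last exact: integrable_gaussM a2 (mcos b) (bcos b).
  by apply: eq_Rintegral => t _; rewrite expRD; ring.
by rewrite JV /V !mulrA -expRD addNr expR0 mul1r.
Qed.

(* For [a > b / 2] the second tail is only bounded by a constant, and the
   Gaussian factor comes from [expR (- (a * b))]. *)
Lemma screened_fourier_tail b : 2 <= b ->
  `|intR (fun t : R => expR (- a ^+ 2 - t ^+ 2) / (a ^+ 2 + t ^+ 2) * cos (b * t)) -
    pi / a * expR (- (a * b))| <=
  2 * pi * expR 1 ^+ 2 / a * expR (- a) * expR (- (b ^+ 2 / 4)).
Proof.
move=> b2; have b0 : 0 <= b by rewrite (le_trans _ b2).
have pE : pi = Num.sqrt pi * Num.sqrt pi :> R by rewrite -expr2 sqr_sqrtr// pi_ge0.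
have sa : 0 <= Num.sqrt pi / a by rewrite divr_ge0 ?sqrtr_ge0// ltW.
have -> : intR (fun t : R => expR (- a ^+ 2 - t ^+ 2) / (a ^+ 2 + t ^+ 2) * cos (b * t)) -
    pi / a * expR (- (a * b)) = Num.sqrt pi / a *
    (expR (a * b) * gauss_tail (a + b / 2) - expR (- (a * b)) * gauss_tail (b / 2 - a)).
  (* Reflecting the second tail splits off the constant [sqrt pi], which produces the main term
     [pi / a * expR (- (a * b))]. *)
  have tE : gauss_tail (a - b / 2) = Num.sqrt pi - gauss_tail (b / 2 - a).
    by rewrite -(gauss_tailD (a - b / 2)) opprB addrK.
  have pa : pi / a = Num.sqrt pi * Num.sqrt pi / a by rewrite -pE.
  by rewrite screened_fourierE tE pa; ring.
have e1 : 1 <= expR 1 :> R by have := expR_ge1Dx (1 : R); lra.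
have C0 : 0 <= C by rewrite (le_trans _ C1).
have goalE : 2 * pi * expR 1 ^+ 2 / a * expR (- a) * expR (- (b ^+ 2 / 4)) =
    Num.sqrt pi / a * (2 * (C * (expR 1 * expR (- a)) * expR (- (b ^+ 2 / 4)))).
  by rewrite /C (_ : 2 * pi = 2 * (Num.sqrt pi * Num.sqrt pi)); [ring|rewrite -pE].
rewrite goalE normrM [X in X * _ <= _]ger0_norm// ler_wpM2l//.
(* Trades [expR (- a ^+ 2)] for [expR (- a)], the decay that is available in both cases below and
   makes the errors summable over the modes. *)
have ea : expR (- a ^+ 2) <= expR 1 * expR (- a).
  by rewrite -expRD ler_expR; have := sqr_ge0 (a - 1); nra.
have t1 : expR (a * b) * gauss_tail (a + b / 2) <= C * (expR 1 * expR (- a)) * expR (- (b ^+ 2 / 4)).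
  by rewrite (le_trans (exp_gauss_tail_le b0))// ler_wpM2r ?expR_ge0// ler_wpM2l.
have t2 : expR (- (a * b)) * gauss_tail (b / 2 - a) <= C * (expR 1 * expR (- a)) * expR (- (b ^+ 2 / 4)).
  have [ab|/ltW ab] := leP a (b / 2).
    have h : 0 <= b / 2 - a by rewrite subr_ge0.
    have := ler_wpM2l (expR_ge0 (- (a * b))) (gauss_tail_le_gauss h).
    rewrite -sqrrN opprB esqN => /le_trans; apply.
    apply: (@le_trans _ _ (C * expR (- a ^+ 2) * expR (- (b ^+ 2 / 4)))); last first.
      by rewrite ler_wpM2r ?expR_ge0// ler_wpM2l.
    rewrite le_eqVlt; apply/orP; left; apply/eqP.
    by rewrite -/C !expRN; field; rewrite !gt_eqF ?expR_gt0.
  apply: (@le_trans _ _ (C * expR (- (a * b)))).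
    by rewrite mulrC ler_wpM2r ?expR_ge0.
  (* Half of [a * b] dominates [b ^+ 2 / 4] because [a >= b / 2], and the other half dominates [a]
     because [b >= 2]. *)
  rewrite -!mulrA ler_wpM2l// -!expRD ler_expR.
  nra.
rewrite (le_trans (ler_normB _ _))// !ger0_norm ?mulr_ge0 ?expR_ge0 ?gauss_tail_ge0//.
by rewrite mulr2n mulrDl mul1r lerD.
Qed.

End screened_fourier.

(** * The transform of the kernel for the zero lateral mode *)

Section unscreened_fourier.
Context {R : realType}.
Implicit Types (b t : R).

(** The values at [t = 0] of [cosm1] and [sinc] are the limits there, so that [- sinc b t] is the
    derivative of [cosm1 b t] in [b] for every [t], and [- cos (b * t)] that of [- sinc b t]. *)
Definition cosm1 b t : R := if t == 0 then - (b ^+ 2 / 2) else (cos (b * t) - 1) / t ^+ 2.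
Definition sinc b t : R := if t == 0 then b else sin (b * t) / t.

Lemma measurable_cosm1 b : measurable_fun [set: R] (cosm1 b).
Proof.
apply: measurable_except0 => t t0.
have c : {for t, continuous (fun t => (cos (b * t) - 1) / t ^+ 2)}.
  apply: differentiable_continuous; apply/derivable1_diffP.
  have d1 : is_derive t 1 (fun t : R => (t ^+ 2)^-1) (- (t ^+ 2) ^- 2 * (2%:R * t ^+ 1 * 1)).
    by apply: isder_inv; [rewrite sqrf_eq0|exact: isder_exp (isder_id t)].
  have d2 := isder_mul (isder_add (isder_cos (isder_mul (isder_cst t b) (isder_id t))) (isder_cst t (-1))) d1.
  exact: ex_derive.
have e : cosm1 b t = (cos (b * t) - 1) / t ^+ 2 by rewrite /cosm1 ifN.
rewrite /prop_for/= /continuous_at e; apply: cvg_trans c.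
apply: near_eq_cvg; near=> s; rewrite /cosm1 ifN//.
near: s; exists `|t| => /=; first by rewrite normr_gt0.
by move=> x /=; apply: contraTneq => ->; rewrite subr0 ltxx.
Unshelve. all: by end_near. Qed.

Lemma measurable_sinc b : measurable_fun [set: R] (sinc b).
Proof.
apply: measurable_except0 => t t0.
have c : {for t, continuous (fun t => sin (b * t) / t)}.
  apply: differentiable_continuous; apply/derivable1_diffP.
  have d1 : is_derive t 1 (fun t : R => t^-1) (- t ^- 2 * 1).
    by apply: isder_inv => //; exact: isder_id.
  have d2 := isder_mul (isder_sin (isder_mul (isder_cst t b) (isder_id t))) d1.
  exact: ex_derive.
have e : sinc b t = sin (b * t) / t by rewrite /sinc ifN.
rewrite /prop_for/= /continuous_at e; apply: cvg_trans c.
apply: near_eq_cvg; near=> s; rewrite /sinc ifN//.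
near: s; exists `|t| => /=; first by rewrite normr_gt0.
by move=> x /=; apply: contraTneq => ->; rewrite subr0 ltxx.
Unshelve. all: by end_near. Qed.

Lemma normr_cosm1 b t : `|cosm1 b t| <= b ^+ 2.
Proof.
rewrite /cosm1; case: eqP => [_|/eqP t0].
  by rewrite normrN ger0_norm ?divr_ge0 ?sqr_ge0//; have := sqr_ge0 b; lra.
have t2 : 0 < t ^+ 2 by rewrite lt_def sqrf_eq0 t0 sqr_ge0.
rewrite normrM [X in _ * X]ger0_norm ?invr_ge0 ?sqr_ge0// ler_pdivrMr//.
by rewrite -exprMn normr_cosB1_le.
Qed.

Lemma normr_sinc b t : `|sinc b t| <= `|b|.
Proof.
rewrite /sinc; case: eqP => [//|/eqP t0].
rewrite normrM normfV ler_pdivrMr ?normr_gt0// -normrM; exact: normr_sin_le.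
Qed.

Definition unscreened_fourier b : R := intR (fun t : R => expR (- t ^+ 2) * cosm1 b t).

Lemma integrable_cosm1 b : integrableR (fun t : R => expR (- t ^+ 2) * cosm1 b t).
Proof.
apply: (integrable_gaussM (sqr_ge0 b) (measurable_cosm1 b)) => t.
by rewrite (le_trans (normr_cosm1 b t))// ler_peMr ?sqr_ge0// oneDsqr_ge1.
Qed.

Let L b := intR (fun t : R => expR (- t ^+ 2) * - sinc b t).

Let dK b : is_derive b 1 unscreened_fourier (L b).
Proof.
apply: (@is_derive_integral R (fun b t => expR (- t ^+ 2) * cosm1 b t)
  (fun b t => expR (- t ^+ 2) * - sinc b t) (4 * (`|b| + 1)) (`|b| + 1)).
- exact: integrable_cosm1.
- move=> x t; rewrite /cosm1 /sinc; case: eqP => [t0|/eqP t0].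
    by der_eq; field.
  by der_eq; field.
- move=> x t xb; apply: (gauss_dominatedM (f := fun t => - sinc x t)).
    by rewrite (le_trans _ (ltW xb)).
  rewrite normrN (le_trans (normr_sinc x t))// (le_trans (ltW xb))//.
  by rewrite ler_peMr ?oneDsqr_ge1 ?addr_ge0.
- by rewrite ltrDl.
Qed.

Let dL b : is_derive b 1 L (- (Num.sqrt pi * expR (- (b ^+ 2 / 4)))).
Proof.
have := @is_derive_integral R (fun b t => expR (- t ^+ 2) * - sinc b t)
  (fun b t => -1 * (expR (- t ^+ 2) * cos (b * t))) 4 (`|b| + 1) b.
rewrite RintegralZl ?integral_gauss_cos ?mulN1r//; last exact: integrable_gauss_cos.
apply.
- move=> x; apply: (@integrable_gaussM _ _ `|x|) => //.
    by apply: measurableT_comp => //; exact: measurable_sinc.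
  by move=> t; rewrite normrN (le_trans (normr_sinc x t))// ler_peMr ?oneDsqr_ge1.
- move=> x t; rewrite /sinc; case: eqP => [->|/eqP t0].
    by rewrite mulr0 cos0; der_eq; ring.
  by der_eq; field.
- move=> x t _; rewrite mulN1r normrN -[4]mulr1.
  apply: (gauss_dominatedM (f := fun t => cos (x * t))) => //.
  by rewrite mul1r (le_trans _ (oneDsqr_ge1 t))// ler_norml cos_geN1 cos_le1.
- by rewrite ltrDl.
Qed.

Let V b := - (pi * b) + 2 * Num.sqrt pi +
  2 * Num.sqrt pi * (b * gauss_tail (b / 2) - expR (- (b ^+ 2 / 4))).
Let V1 b := - pi + 2 * Num.sqrt pi * gauss_tail (b / 2).

Let dtail b : is_derive b 1 (fun b => gauss_tail (b / 2)) (- expR (- (b ^+ 2 / 4)) / 2).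
Proof.
have d : is_derive b 1 (fun b : R => b / 2) (2^-1) by der_eq; ring.
apply: is_derive_eq (isder_comp (is_derive_gauss_tail _) d) _.
by congr (- expR (- _) / _); field.
Qed.

Let pE : pi = Num.sqrt pi * Num.sqrt pi :> R.
Proof. by rewrite -expr2 sqr_sqrtr// pi_ge0. Qed.

(** The second derivative in [b] is explicit here, namely minus the transform of the Gaussian. Two
    integrations from the vanishing value and slope at [b = 0] take the place of the boundedness
    argument, which fails because the function grows linearly. *)
Lemma unscreened_fourierE b : unscreened_fourier b = - (pi * b) + 2 * Num.sqrt pi +
  2 * Num.sqrt pi * (b * gauss_tail (b / 2) - expR (- (b ^+ 2 / 4))).
Proof.
have dV (x : R) : is_derive x 1 V (V1 x).
  by have d1 := dtail x; rewrite /V /V1; der_eq; field.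
have dV1 (x : R) : is_derive x 1 V1 (- (Num.sqrt pi * expR (- (x ^+ 2 / 4)))).
  by have d1 := dtail x; rewrite /V1; der_eq; field.
have LV1 x : L x - V1 x = 0.
  have d (y : R) : is_derive y 1 (fun y => L y - V1 y) 0.
    have h1 := dL y; have h2 := dV1 y.
    by apply: is_derive_eq (isder_add h1 (isder_opp h2)) _; rewrite subrr.
  rewrite (is_derive_0_is_cst x 0 d) /V1 mul0r gauss_tail0.
  rewrite /L [X in X - _](_ : _ = 0).
    by rewrite sub0r opprD opprK {1}pE; field.
  under eq_Rintegral => t _.
    rewrite (_ : _ * _ = 0); last by rewrite /sinc mul0r sin0 mul0r if_same oppr0 mulr0.
  over.
  by rewrite /Rintegral integral0.
have d (y : R) : is_derive y 1 (fun y => unscreened_fourier y - V y) 0.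
  have h1 := dK y; have h2 := dV y.
  by apply: is_derive_eq (isder_add h1 (isder_opp h2)) _; exact: LV1.
have := is_derive_0_is_cst b 0 d.
rewrite [RHS](_ : _ = 0); first by move/eqP; rewrite subr_eq0 => /eqP.
have -> : V 0 = 0 by rewrite /V expr0n/= !mul0r oppr0 expR0; ring.
rewrite subr0.
rewrite /unscreened_fourier; under eq_Rintegral => t _.
  rewrite (_ : _ * _ = 0); last first.
    by rewrite /cosm1 mul0r cos0 subrr mul0r expr0n/= mul0r oppr0 if_same mulr0.
over.
by rewrite /Rintegral integral0.
Qed.

(** By Mills' inequality the bracket in the closed form lies between [- expR (- (b ^+ 2 / 4))] and
    [0]. *)
Lemma unscreened_fourier_tail b : 0 < b ->
  `|unscreened_fourier b + pi * b - 2 * Num.sqrt pi| <=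
  2 * Num.sqrt pi * expR (- (b ^+ 2 / 4)).
Proof.
move=> b0; have b20 : 0 < b / 2 by rewrite divr_gt0.
have := mul_gauss_tail_le b20.
have -> : (b / 2) ^+ 2 = b ^+ 2 / 4 by field.
have -> : 2 * (b / 2) = b by field.
move=> h; rewrite unscreened_fourierE.
have -> : - (pi * b) + 2 * Num.sqrt pi + 2 * Num.sqrt pi *
   (b * gauss_tail (b / 2) - expR (- (b ^+ 2 / 4))) + pi * b - 2 * Num.sqrt pi =
   2 * Num.sqrt pi * (b * gauss_tail (b / 2) - expR (- (b ^+ 2 / 4))) by ring.
rewrite normrM ger0_norm ?mulr_ge0 ?sqrtr_ge0// ler_wpM2l ?mulr_ge0 ?sqrtr_ge0//.
have g0 := mulr_ge0 (ltW b0) (gauss_tail_ge0 (b / 2)).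
by rewrite ler_norml; apply/andP; split; [rewrite lerBrDr addNr|rewrite lerBlDr (le_trans h)// lerDl expR_ge0].
Qed.

End unscreened_fourier.

(** * Poisson summation *)

Section trigonometry.
Context {R : realType}.

Lemma sin_natpi (n : nat) (x : R) : sin (x + n%:R * pi) = (-1) ^+ n * sin x.
Proof.
elim: n => [|n IH]; first by rewrite mul0r addr0 expr0 mul1r.
by rewrite -natr1 mulrDl mul1r addrA sinDpi IH exprS mulN1r mulNr.
Qed.

Lemma normr_sin_intpi (n : int) (x : R) : `|sin (x + n%:~R * pi)| = `|sin x|.
Proof.
case: n => n; first by rewrite sin_natpi normrM normrX normrN1 expr1n mul1r.
rewrite NegzE mulrNz mulNr -[in RHS](subrK (n.+1%:R * pi) x) sin_natpi.
by rewrite normrM normrX normrN1 expr1n mul1r.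
Qed.

Lemma sin_intpi (n : int) : sin (n%:~R * pi) = 0 :> R.
Proof. by apply/eqP; rewrite -normr_eq0 -[_ * _]add0r normr_sin_intpi sin0 normr0. Qed.

(** The quotient [sin x / x] is non-increasing up to [pi / 2], because [sin x - x * cos x] starts at
    [0] with derivative [x * sin x >= 0]; its value at [pi / 2] is therefore a lower bound. *)
Lemma sin_jordan (y : R) : 0 < y -> y <= pi / 2 -> 2 / pi * y <= sin y.
Proof.
move=> y0 yp.
have h (x : R) : 0 <= x <= pi / 2 -> 0 <= sin x - x * cos x.
  move=> /andP[x0 xp].
  have [||c] := @MVT_segment R (fun x => sin x - x * cos x) (fun x => x * sin x) 0 x x0.
  - by move=> t _; der_eq; ring.
  - by apply: (@der_within _ _ (fun x => x * sin x)) => t; der_eq; ring.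
  - rewrite in_itv/= mul0r sin0 !subr0 => /andP[c0 cx] ->.
    rewrite !mulr_ge0// sin_ge0_pi// c0/= (le_trans cx)// (le_trans xp)//.
    by have := pi_ge0 R; lra.
have d (x : R) : 0 < x -> is_derive x 1 (fun x => sin x * x^-1) (- (sin x - x * cos x) * (x ^- 2)).
  move=> x0; have d1 : is_derive x 1 (fun t : R => t^-1) (- x ^- 2 * 1).
    exact: (isder_inv (lt0r_neq0 x0) (isder_id x)).
  by der_eq; field; rewrite gt_eqF.
have := @ler0_derive1_nincr R (fun x => sin x * x^-1) y (pi / 2) _ _ _ y (pi / 2) (lexx _) yp (lexx _).
rewrite sin_pihalf mul1r => H.
have : (pi / 2)^-1 <= sin y * y^-1.
  apply: H.
  - by move=> x; rewrite in_itv/= => /andP[yx _]; have := d x (lt_trans y0 yx) => dx; exact: ex_derive.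
  - move=> x; rewrite in_itv/= => /andP[yx xp]; have dx := d x (lt_trans y0 yx).
    rewrite derive1E derive_val mulr_le0_ge0// ?invr_ge0 ?sqr_ge0// oppr_le0 h//.
    by rewrite (ltW (lt_trans y0 yx)) ltW.
  - apply: derivable_within_continuous => x; rewrite in_itv/= => /andP[yx _].
    by have := d x (lt_le_trans y0 yx) => dx; exact: ex_derive.
by rewrite invf_div ler_pdivlMr.
Qed.

Lemma normr_sin_jordan (y : R) : `|y| <= pi / 2 -> 2 / pi * `|y| <= `|sin y|.
Proof.
have [->|y0] := eqVneq y 0; first by rewrite normr0 mulr0.
have [yp|yn] := ltP 0 y.
  rewrite (gtr0_norm yp) => h; apply: le_trans (sin_jordan yp h) _; exact: ler_norm.
have {}yn : 0 < - y by rewrite oppr_gt0 lt_def eq_sym y0.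
rewrite -normrN (gtr0_norm yn) => h.
by rewrite (le_trans (sin_jordan yn h))// sinN -[X in _ <= X]normrN ler_norm.
Qed.

(** The Dirichlet kernel with period [2 * pi / L]. Multiplying by it shifts the frequency of a
    cosine by the multiples of [L] up to order [K], while for large [K] it concentrates at the
    multiples of its period. *)
Definition dirichlet (L : R) (K : nat) (t : R) : R :=
  1 + 2 * \sum_(m < K) cos (m.+1%:R * L * t).

Lemma dirichletM (L : R) (K : nat) (t : R) :
  dirichlet L K t * sin (L * t / 2) = sin ((2 * K%:R + 1) * (L * t / 2)).
Proof.
rewrite /dirichlet; elim: K => [|K IH]; first by rewrite big_ord0 !mulr0 addr0 add0r !mul1r.
rewrite big_ord_recr/= mulrDr addrA mulrDl IH -[K.+1%:R]natr1.
have -> : (2 * (K%:R + 1) + 1) * (L * t / 2) = (K%:R + 1) * L * t + L * t / 2 by field.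
have -> : (2 * K%:R + 1) * (L * t / 2) = (K%:R + 1) * L * t - L * t / 2 by field.
by rewrite !sinD cosN sinN; ring.
Qed.

Lemma continuous_dirichlet (L : R) K : continuous (dirichlet L K).
Proof.
move=> t; apply: cvgD; first exact: cvg_cst.
apply: cvgM; first exact: cvg_cst.
rewrite /continuous_at; move: t.
elim: K => [|K IH] t; first by under eq_fun do rewrite big_ord0; rewrite big_ord0; exact: cvg_cst.
under eq_fun do rewrite big_ord_recr/=; rewrite big_ord_recr/=.
by apply: cvgD; [exact: IH|exact: continuous_cosM].
Qed.

Lemma normr_dirichlet (L : R) K t : `|dirichlet L K t| <= 1 + 2 * K%:R.
Proof.
rewrite (le_trans (ler_normD _ _))// normr1 lerD2l normrM ger0_norm// ler_wpM2l//.
rewrite (le_trans (ler_norm_sum _ _ _))//.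
apply: (@le_trans _ _ (\sum_(i < K) 1)); last by rewrite sumr_const card_ord.
by apply: ler_sum => i _; rewrite ler_norml cos_geN1 cos_le1.
Qed.

End trigonometry.

Section interval_integrals.
Context {R : realType}.

Lemma measurable_invr : measurable_fun [set: R] (fun x : R => x^-1).
Proof.
apply: measurable_except0 => x x0; apply: differentiable_continuous; apply/derivable1_diffP.
by have d := isder_inv x0 (isder_id x); exact: ex_derive.
Qed.

Lemma integrable_bounded_itv (f : R -> R) (M a b : R) : measurable_fun [set: R] f ->
  (forall t, a <= t <= b -> `|f t| <= M) -> mu.-integrable `[a, b] (EFin \o f).
Proof.
move=> mf fM; apply: measurable_bounded_integrable => //.
- have e := lebesgue_measure_itv `[a, b]; rewrite [X in (X < _)%E]e/=.
  by case: ifP => // _; rewrite -EFinD ltry.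
- exact: measurable_funTS.
- exists M; split; first exact: num_real.
  by move=> y My x /= xab; rewrite (le_trans (fM x _))// ?ltW//; move: xab; rewrite in_itv.
Qed.

Lemma integrableZl_itv (f : R -> R) (c a b : R) : mu.-integrable `[a, b] (EFin \o f) ->
  mu.-integrable `[a, b] (EFin \o (fun t => c * f t)).
Proof. by move=> i; exact: (@integrableZl _ _ R (@lebesgue_measure R) _ (@measurable_itv R `[a, b]) c (EFin \o f) i). Qed.

Lemma Rintegral_split (f : R -> R) (a b c : R) : a <= b -> b <= c ->
  mu.-integrable `[a, c] (EFin \o f) ->
  \int[mu]_(t in `[a, c]) f t = \int[mu]_(t in `[a, b]) f t + \int[mu]_(t in `[b, c]) f t.
Proof.
move=> ab bc itg; apply/eqP; rewrite addrC -subr_eq; apply/eqP.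
rewrite Rintegral_itvB ?bnd_simp//; apply: Rintegral_itv_obnd_cbnd.
by apply: integrableS itg => //; apply: subset_itv; rewrite bnd_simp.
Qed.

Lemma normr_Rintegral_itv (f : R -> R) (M a b : R) : a <= b -> measurable_fun [set: R] f ->
  (forall t, a <= t <= b -> `|f t| <= M) -> `|\int[mu]_(t in `[a, b]) f t| <= M * (b - a).
Proof.
move=> ab mf fM; have itg := integrable_bounded_itv mf fM.
rewrite (le_trans (le_normr_Rintegral _ itg))//.
apply: (@le_trans _ _ (\int[mu]_(t in `[a, b]) M)).
  have ic : mu.-integrable `[a, b] (EFin \o (fun=> M)) by apply: (@integrable_bounded_itv _ `|M|).
  have ia : mu.-integrable `[a, b] (EFin \o (fun t => `|f t|)) by exact: (integrable_abse itg).
  apply: le_Rintegral; [exact: measurable_itv|exact: ia|exact: ic|].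
  by move=> t /=; rewrite in_itv; exact: fM.
rewrite Rintegral_cst//= lebesgue_measure_itv/= lte_fin.
case: ltP => //= ba; rewrite mulr0 mulr_ge0 ?subr_ge0//.
by rewrite (le_trans (normr_ge0 (f a)))// fM// lexx.
Qed.

Lemma Rintegral_der (f F : R -> R) (a b : R) : a < b -> continuous f ->
  (forall t : R, is_derive t 1 F (f t)) -> \int[mu]_(t in `[a, b]) f t = F b - F a.
Proof.
move=> ab cf dF; rewrite /Rintegral (continuous_FTC2 ab (F := F))//.
- exact: continuous_subspaceT.
- split.
  + by move=> x _; have dFx := dF x; exact: ex_derive.
  + exact/cvg_at_right_filter/(der_continuous dF).
  + exact/cvg_at_left_filter/(der_continuous dF).
- by move=> x _; have dFx := dF x; rewrite derive1E derive_val.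
Qed.

End interval_integrals.

(** * The Riemann-Lebesgue lemma on one cell of the mesh *)

Section riemann_lebesgue.
Context {R : realType}.
Variables (d : R) (n : int).
Hypothesis d0 : 0 < d.

Let L := 2 * pi / d.
Let lo := (n%:~R - 2^-1) * d.
Let hi := (n%:~R + 2^-1) * d.
Local Notation I := `[lo, hi]%classic.

Let lohi : lo < hi.
Proof. by rewrite /lo /hi ltr_pM2r// ltrD2l gtrN// invr_gt0. Qed.

Lemma integral_cos_cell (j : nat) :
  \int[mu]_(t in `[(n%:~R - 2^-1) * d, (n%:~R + 2^-1) * d]) cos (j%:R * (2 * pi / d) * t) =
  if j == 0%N then d else 0.
Proof.
rewrite -/lo -/hi -/L; case: eqP => [->|/eqP j0].
  under eq_Rintegral do rewrite !mul0r cos0.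
  by rewrite Rintegral_cst//= lebesgue_measure_itv/= lte_fin lohi mul1r/= /hi /lo; field.
have jL : j%:R * L != 0 by rewrite mulf_neq0 ?pnatr_eq0// mulf_neq0 ?invr_eq0 ?gt_eqF// mulr_gt0// pi_gt0.
have dF (t : R) : is_derive t 1 (fun t => (j%:R * L)^-1 * sin (j%:R * L * t)) (cos (j%:R * L * t)).
  by der_eq; rewrite !(mul0r, add0r, mulr1) mulrCA mulVf ?mulr1.
rewrite (Rintegral_der lohi (@continuous_cosM _ _) dF).
(* A cell ends at half-integer multiples of [d], where the antiderivative is the sine of an integer
   multiple of [pi]; [s] is the sign of the half. *)
have e (s : R) (k : int) : j%:R * (n%:~R * 2 + s) = k%:~R -> sin (j%:R * L * ((n%:~R + s / 2) * d)) = 0.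
  move=> H; have -> : j%:R * L * ((n%:~R + s / 2) * d) = k%:~R * pi.
    by rewrite -H /L; field; rewrite gt_eqF.
  exact: sin_intpi.
rewrite /hi /lo -[2^-1]mul1r -[- (1 / 2)]mulNr (e 1 (j%:Z * (n * 2 + 1))) ?(e (-1) (j%:Z * (n * 2 - 1))).
- by rewrite mulr0 subrr.
- by rewrite !(rmorphM, rmorphD, rmorphN)/=.
- by rewrite !(rmorphM, rmorphD, rmorphN)/=.
Qed.

(** The numerators of the Dirichlet kernels, as in [dirichletM]. On a cell they are orthogonal with
    squared norm [d / 2], so they are subject to Bessel's inequality. *)
Let e (k : nat) (t : R) : R := sin ((2 * k%:R + 1) * (L * t / 2)).

Let me k : measurable_fun [set: R] (e k).
Proof.
apply: measurable_of_continuous; rewrite /e.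
rewrite (_ : (fun t => _) = (fun t => sin ((2 * k%:R + 1) * (L / 2) * t))); first exact: continuous_sinM.
by apply/funext => t; congr sin; ring.
Qed.

Let e1 k t : `|e k t| <= 1.
Proof. by rewrite /e ler_norml sin_geN1 sin_le1. Qed.

(* Closed under the operations used in Bessel's inequality. *)
Let BM (f : R -> R) := measurable_fun [set: R] f /\
  exists2 M : R, 0 <= M & forall t, lo <= t <= hi -> `|f t| <= M.

Let BM_int f : BM f -> mu.-integrable I (EFin \o f).
Proof. by move=> [mf [M _ fM]]; exact: integrable_bounded_itv mf fM. Qed.

Let BM_add f g : BM f -> BM g -> BM (fun t => f t + g t).
Proof.
move=> [mf [M M0 fM]] [mg [N N0 gN]]; split; first exact: measurable_funD.
by exists (M + N) => [|t tI]; rewrite ?addr_ge0// (le_trans (ler_normD _ _))// lerD ?fM ?gN.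
Qed.

Let BM_mul f g : BM f -> BM g -> BM (fun t => f t * g t).
Proof.
move=> [mf [M M0 fM]] [mg [N N0 gN]]; split; first exact: measurable_funM.
by exists (M * N) => [|t tI]; rewrite ?mulr_ge0// normrM ler_pM ?fM ?gN.
Qed.

Let BM_cst c : BM (fun=> c).
Proof. by split => //; exists `|c|. Qed.

Let BM_e k : BM (e k).
Proof. by split; [exact: me|exists 1]. Qed.

Let BM_cosM c : BM (fun t => cos (c * t)).
Proof.
split; first exact: (measurable_of_continuous (@continuous_cosM _ c)).
by exists 1 => // t _; rewrite ler_norml cos_geN1 cos_le1.
Qed.

Let ee_le k l : (l <= k)%N -> \int[mu]_(t in I) (e k t * e l t) = if k == l then d / 2 else 0.
Proof.
move=> lk.
transitivity (\int[mu]_(t in I) (2^-1 * cos ((k - l)%:R * L * t) - 2^-1 * cos ((k + l).+1%:R * L * t))).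
  apply: eq_Rintegral => t _; rewrite /e natrB// -[(k + l).+1%:R]natr1 natrD.
  have -> : (k%:R - l%:R) * L * t = (2 * k%:R + 1) * (L * t / 2) - (2 * l%:R + 1) * (L * t / 2) by field.
  have -> : (k%:R + l%:R + 1) * L * t = (2 * k%:R + 1) * (L * t / 2) + (2 * l%:R + 1) * (L * t / 2) by field.
  by rewrite !cosD cosN sinN; field.
rewrite RintegralB//; last 2 first.
- by apply: BM_int; apply: BM_mul (BM_cst _) (BM_cosM _).
- by apply: BM_int; apply: BM_mul (BM_cst _) (BM_cosM _).
rewrite !RintegralZl//; do ?by apply: BM_int; exact: BM_cosM.
rewrite !integral_cos_cell/= mulr0 subr0 subn_eq0 eqn_leq lk andbT; case: ifP => _; last by rewrite mulr0.
by rewrite mulrC.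
Qed.

Let ee k l : \int[mu]_(t in I) (e k t * e l t) = if k == l then d / 2 else 0.
Proof.
have [|/ltnW lk] := leqP l k; first exact: ee_le.
by rewrite eq_sym -ee_le//; apply: eq_Rintegral => t _; rewrite mulrC.
Qed.

(** Bessel's inequality makes the coefficients [a k] square-summable, so they tend to [0]. No
    smoothness enters; boundedness on the cell is what the quotients [psi] will offer. *)
Lemma riemann_lebesgue_cell (f : R -> R) (M : R) : measurable_fun [set: R] f -> 0 <= M ->
  (forall t, (n%:~R - 2^-1) * d <= t <= (n%:~R + 2^-1) * d -> `|f t| <= M) ->
  \int[mu]_(t in `[(n%:~R - 2^-1) * d, (n%:~R + 2^-1) * d])
    (f t * sin ((2 * k%:R + 1) * (2 * pi / d * t / 2))) @[k --> \oo] --> (0 : R).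
Proof.
move=> mf M0 fM.
have BMf : BM f by split => //; exists M.
pose a k := \int[mu]_(t in I) (f t * e k t).
rewrite -/a.
(* What remains after projection on the first [m] sines; [2 / d] is the inverse of their squared
   norm. *)
pose r m t := f t - \sum_(k < m) (2 / d * a k * e k t).
have BMr m : BM (r m).
  rewrite /r; elim: m => [|m IH].
    by under eq_fun do rewrite big_ord0 subr0.
  under eq_fun do rewrite big_ord_recr/= opprD addrA -mulNr.
  by apply: BM_add IH (BM_mul (BM_cst _) (BM_e _)).
have re m k : (m <= k)%N -> \int[mu]_(t in I) (r m t * e k t) = a k.
  elim: m => [|m IH] mk.
    by apply: eq_Rintegral => t _; rewrite /r big_ord0 subr0.
  rewrite -(IH (ltnW mk)).
  transitivity (\int[mu]_(t in I) (r m t * e k t - 2 / d * a m * (e m t * e k t))).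
    by apply: eq_Rintegral => t _; rewrite /r big_ord_recr/=; ring.
  have i1 := BM_int (BM_mul (BM_e m) (BM_e k)).
  rewrite RintegralB//; [|exact: BM_int (BM_mul (BMr m) (BM_e k))|]; last first.
    exact: BM_int (BM_mul (BM_cst _) (BM_mul (BM_e m) (BM_e k))).
  by rewrite RintegralZl// ee ltn_eqF// mulr0 subr0.
have rr m : \int[mu]_(t in I) (r m t * r m t) =
    \int[mu]_(t in I) (f t * f t) - 2 / d * \sum_(k < m) a k ^+ 2.
  elim: m => [|m IH].
    by rewrite big_ord0 mulr0 subr0; apply: eq_Rintegral => t _; rewrite /r big_ord0 subr0.
  transitivity (\int[mu]_(t in I) (r m t * r m t +
      (- (2 * (2 / d * a m)) * (r m t * e m t) + (2 / d * a m) ^+ 2 * (e m t * e m t)))).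
    by apply: eq_Rintegral => t _; rewrite /r big_ord_recr/=; ring.
  have i1 := BM_int (BM_mul (BMr m) (BMr m)).
  have b2 := BM_mul (BMr m) (BM_e m).
  have b3 := BM_mul (BM_e m) (BM_e m).
  have i2 := BM_int (BM_mul (BM_cst (- (2 * (2 / d * a m)))) b2).
  have i3 := BM_int (BM_mul (BM_cst ((2 / d * a m) ^+ 2)) b3).
  have i4 := BM_int (BM_add (BM_mul (BM_cst (- (2 * (2 / d * a m)))) b2) (BM_mul (BM_cst ((2 / d * a m) ^+ 2)) b3)).
  rewrite RintegralD// RintegralD// RintegralZl//; last exact: BM_int.
  rewrite RintegralZl//; last exact: BM_int.
  rewrite IH re// ee eqxx big_ord_recr/=; by field; rewrite gt_eqF.
have bessel m : \sum_(k < m) a k ^+ 2 <= d / 2 * \int[mu]_(t in I) (f t * f t).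
  have : 0 <= \int[mu]_(t in I) (r m t * r m t).
    by apply: Rintegral_ge0 => t _; rewrite -expr2 sqr_ge0.
  rewrite rr subr_ge0 => /(ler_wpM2l (_ : 0 <= d / 2)) h.
  have := h (ltac:(by rewrite divr_ge0// ltW)).
  by rewrite mulrA (_ : d / 2 * (2 / d) = 1) ?mul1r//; field; rewrite gt_eqF.
have c2 : a k ^+ 2 @[k --> \oo] --> (0 : R).
  apply: cvg_series_cvg_0; apply: nondecreasing_is_cvgn.
    apply/nondecreasing_seqP => m; rewrite /series/= big_nat_recr//= lerDl sqr_ge0//.
  exists (d / 2 * \int[mu]_(t in I) (f t * f t)) => _ [m _ <-].
  by rewrite /series/= big_mkord.
apply/cvgrPdist_le => /= eps eps0.
move/cvgrPdist_le : c2 => /(_ (eps ^+ 2)) /(_ (exprn_gt0 _ eps0)).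
apply: filterS => k; rewrite !sub0r !normrN normrX.
by rewrite ler_pXn2r// nnegrE// ltW.
Qed.

End riemann_lebesgue.

(** * Poisson summation by the Dirichlet kernel *)

Section poisson_summation.
Context {R : realType}.
Variables (d C B : R) (f : R -> R) (w : nat -> R).
Hypothesis d0 : 0 < d.
Hypothesis mf : measurable_fun [set: R] f.
Hypothesis fC : forall t, `|f t| <= C * (1 + t ^+ 2)^-1.
Hypothesis w0 : forall k, 0 <= w k.
Hypothesis wB : forall m, \sum_(k < m) w k <= B.
Hypothesis fw : forall (n : int) t, `|t - n%:~R * d| <= d / 2 ->
  `|f t - f (n%:~R * d)| <= w `|n|%N * `|t - n%:~R * d|.
Hypothesis fs : abs_summable [set: int] (fun n : int => f (n%:~R * d)).

Let L := 2 * pi / d.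
Let lo (n : int) := (n%:~R - 2^-1) * d.
Let hi (n : int) := (n%:~R + 2^-1) * d.

Let lohi n : lo n < hi n.
Proof. by rewrite /lo /hi ltr_pM2r// ltrD2l gtrN// invr_gt0. Qed.

Let cellP n t : (lo n <= t <= hi n) = (`|t - n%:~R * d| <= d / 2).
Proof.
rewrite ler_norml lerBrDr lerBlDr /lo /hi.
by congr (_ && _); congr (_ <= _); field.
Qed.

Let mD K : measurable_fun [set: R] (dirichlet L K).
Proof. exact: (measurable_of_continuous (@continuous_dirichlet _ L K)). Qed.

Let mfD K : measurable_fun [set: R] (fun t => f t * dirichlet L K t).
Proof. exact: measurable_funM. Qed.

Let ifD K : integrableR (fun t => f t * dirichlet L K t).
Proof.
apply: (@integrable_dominated _ _ (C * (1 + 2 * K%:R))) => // t.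
rewrite normrM mulrAC ler_pM//; exact: normr_dirichlet.
Qed.

(** The defect of cell [n]: the Dirichlet kernel has integral [d] over each cell, so freezing [f] at
    the node would give exactly the trapezoidal term. *)
Let A K n := \int[mu]_(t in `[lo n, hi n]) ((f t - f (n%:~R * d)) * dirichlet L K t).

(** The factor left in front of the fast sine by [dirichletM]. The Lipschitz condition and Jordan's
    inequality bound it on the cell. At the node the inverse is [0] by convention, which agrees with
    the vanishing of the difference. *)
Let psi n t := (f t - f (n%:~R * d)) * (sin (L * t / 2))^-1.

Let mpsi n : measurable_fun [set: R] (psi n).
Proof.
apply: measurable_funM; first exact: measurable_funB.
apply: (measurableT_comp measurable_invr).
apply: measurable_of_continuous.
rewrite (_ : (fun t => _) = (fun t => sin (L / 2 * t))); first exact: continuous_sinM.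
by apply/funext => t; congr sin; ring.
Qed.

Let sinE n t : `|sin (L * t / 2)| = `|sin (pi / d * (t - n%:~R * d))|.
Proof.
rewrite -(normr_sin_intpi n (pi / d * _)); congr `|sin _|.
by rewrite /L; field; rewrite gt_eqF.
Qed.

Let sin_ge n t : lo n <= t <= hi n -> 2 / d * `|t - n%:~R * d| <= `|sin (L * t / 2)|.
Proof.
rewrite cellP (sinE n) => h.
have nE : `|pi / d * (t - n%:~R * d)| = pi / d * `|t - n%:~R * d|.
  by rewrite normrM ger0_norm// divr_ge0 ?pi_ge0// ltW.
have := @normr_sin_jordan R (pi / d * (t - n%:~R * d)); rewrite nE => H.
have h2 : pi / d * `|t - n%:~R * d| <= pi / 2.
  rewrite -ler_pdivlMl ?divr_gt0 ?pi_gt0// (_ : _ * (pi / 2) = d / 2)//.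
  by rewrite invf_div mulrA divfK ?gt_eqF ?pi_gt0.
apply: le_trans (H h2); rewrite mulrA (_ : 2 / pi * (pi / d) = 2 / d)//.
by rewrite mulrA divfK ?gt_eqF ?pi_gt0.
Qed.

Let psi_le n t : lo n <= t <= hi n -> `|psi n t| <= w `|n|%N * (d / 2).
Proof.
move=> tI; rewrite /psi normrM normfV.
have [->|s0] := eqVneq (sin (L * t / 2)) 0.
  by rewrite normr0 invr0 mulr0 mulr_ge0// divr_ge0// ltW.
rewrite ler_pdivrMr ?normr_gt0//.
have h : `|t - n%:~R * d| <= d / 2 by rewrite -cellP.
apply: (le_trans (fw h)); rewrite -[leRHS]mulrA; apply: ler_wpM2l => //.
rewrite -ler_pdivrMl ?divr_gt0// invf_div.
exact: sin_ge.
Qed.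

Let fDpsi K n t : lo n <= t <= hi n -> (f t - f (n%:~R * d)) * dirichlet L K t =
  psi n t * sin ((2 * K%:R + 1) * (L * t / 2)).
Proof.
move=> tI; rewrite /psi -dirichletM.
have [s0|s0] := eqVneq (sin (L * t / 2)) 0; last by field.
have := sin_ge tI; rewrite s0 normr0 => h.
have : `|t - n%:~R * d| <= 0 by move: h; rewrite pmulr_rle0// divr_gt0.
by rewrite normr_le0 subr_eq0 => /eqP ->; rewrite subrr !mul0r.
Qed.

Let AE K n : A K n = \int[mu]_(t in `[lo n, hi n]) (psi n t * sin ((2 * K%:R + 1) * (L * t / 2))).
Proof.
apply: eq_Rintegral => t; rewrite inE/= in_itv/= => tI; exact: fDpsi.
Qed.

Let A_cvg n : A K n @[K --> \oo] --> (0 : R).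
Proof.
under eq_fun do rewrite AE.
apply: (@riemann_lebesgue_cell _ _ _ d0 _ (w `|n|%N * (d / 2))) => //.
- by rewrite mulr_ge0// divr_ge0// ltW.
- exact: psi_le.
Qed.

Let A_le K n : `|A K n| <= w `|n|%N * (d ^+ 2 / 2).
Proof.
have := @normr_Rintegral_itv R (fun t => (f t - f (n%:~R * d)) * dirichlet L K t)
  (w `|n|%N * (d / 2)) (lo n) (hi n) (ltW (lohi n)).
have -> : w `|n|%N * (d / 2) * (hi n - lo n) = w `|n|%N * (d ^+ 2 / 2).
  by rewrite /hi /lo; field.
apply.
- by apply: measurable_funM => //; exact: measurable_funB.
- move=> t tI; rewrite fDpsi// normrM -[leRHS]mulr1 ler_pM// ?psi_le//.
  by rewrite ler_norml sin_geN1 sin_le1.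
Qed.

Let iD K n : mu.-integrable `[lo n, hi n] (EFin \o dirichlet L K).
Proof.
apply: (@integrable_bounded_itv _ _ (1 + 2 * K%:R)); first exact: mD.
by move=> t _; exact: normr_dirichlet.
Qed.

Let int_dirichlet K n : \int[mu]_(t in `[lo n, hi n]) dirichlet L K t = d.
Proof.
rewrite /dirichlet; elim: K => [|K IH].
  under eq_Rintegral do rewrite big_ord0 mulr0 addr0.
  by rewrite Rintegral_cst//= lebesgue_measure_itv/= lte_fin lohi mul1r/= /hi /lo; field.
transitivity (\int[mu]_(t in `[lo n, hi n])
   ((1 + 2 * \sum_(m < K) cos (m.+1%:R * L * t)) + 2 * cos (K.+1%:R * L * t))).
  by apply: eq_Rintegral => t _; rewrite big_ord_recr/= mulrDr addrA.
have ic : mu.-integrable `[lo n, hi n] (EFin \o (fun t => cos (K.+1%:R * L * t))).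
  apply: (@integrable_bounded_itv _ _ 1).
    exact: (measurable_of_continuous (@continuous_cosM _ _)).
  by move=> t _; rewrite ler_norml cos_geN1 cos_le1.
rewrite RintegralD//.
- by rewrite IH RintegralZl// /lo /hi /L (integral_cos_cell n d0 K.+1)/= mulr0 addr0.
- exact: (iD K n).
- exact: integrableZl_itv ic.
Qed.

Let int_cell K n : \int[mu]_(t in `[lo n, hi n]) (f t * dirichlet L K t) =
  A K n + d * f (n%:~R * d).
Proof.
have -> : d * f (n%:~R * d) = \int[mu]_(t in `[lo n, hi n]) (f (n%:~R * d) * dirichlet L K t).
  by rewrite RintegralZl ?int_dirichlet 1?mulrC//; exact: iD.
rewrite /A -RintegralD//.
- by apply: eq_Rintegral => t _; ring.
- apply: (@integrable_bounded_itv _ _ (w `|n|%N * (d / 2))).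
    by apply: measurable_funM => //; exact: measurable_funB.
  move=> t tI; rewrite fDpsi// normrM -[leRHS]mulr1 ler_pM// ?psi_le//.
  by rewrite ler_norml sin_geN1 sin_le1.
- exact: integrableZl_itv (iD K n).
Qed.

Let int_exhaust K N : \int[mu]_(t in `[lo (- N%:Z), hi N%:Z]) (f t * dirichlet L K t) =
  sym_partial_sum (A K) N + d * sym_partial_sum (fun n => f (n%:~R * d)) N.
Proof.
have step (n : int) : hi n = lo (n + 1).
  by rewrite /hi /lo rmorphD/=; field.
elim: N => [|N IH].
  by rewrite /sym_partial_sum !big_ord0 !addr0 oppr0 int_cell.
have e1 : hi (- N.+1%:Z) = lo (- N%:Z) by rewrite step; congr lo; rewrite -addn1 PoszD opprD subrK.
have e2 : lo N.+1%:Z = hi N%:Z by rewrite step -addn1 PoszD.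
have l1 : lo (- N.+1%:Z) <= lo (- N%:Z) by rewrite -e1 ltW.
have l2 : lo (- N%:Z) <= hi N%:Z.
  by rewrite /lo /hi ler_pM2r// rmorphN/= -!pmulrn; have := ler0n R N; lra.
have l3 : hi N%:Z <= hi N.+1%:Z by rewrite -e2 ltW.
rewrite (@Rintegral_split _ _ _ (lo (- N%:Z)))// ?(le_trans l2)//; last exact: integrableS (ifD K).
rewrite (@Rintegral_split _ _ (lo (- N%:Z)) (hi N%:Z))//; last exact: integrableS (ifD K).
rewrite IH -e1 int_cell -[X in `[X, _]]e2 int_cell /sym_partial_sum !big_ord_recr/=.
ring.
Qed.

(** The integral differs from the trapezoidal sum by the sum of all defects [A K n]. Each tends to
    [0] by the Riemann-Lebesgue lemma, and [w] bounds them by a summable sequence independent of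
    [K], so the limit passes under the sum. *)
Lemma poisson_summation :
  intR (fun t => f t * dirichlet (2 * pi / d) K t) @[K --> \oo] -->
  d * rsum [set: int] (fun n : int => f (n%:~R * d)).
Proof.
rewrite -/L; set T := d * _.
have lim K : sym_partial_sum (A K) N @[N --> \oo] --> intR (fun t => f t * dirichlet L K t) - T.
  rewrite (_ : (fun N => _) = (fun N => \int[mu]_(t in `[lo (- N%:Z), hi N%:Z]) (f t * dirichlet L K t)
     - d * sym_partial_sum (fun n => f (n%:~R * d)) N)); last first.
    by apply/funext => N; rewrite int_exhaust addrK.
  apply: cvgB.
  - apply: cvg_integral_exhaust => // t.
    near=> N; rewrite /= in_itv/=.
    have Nt : `|t| / d <= N%:R by near: N; exact: nbhs_infty_ger.
    have {}Nt : `|t| <= N%:R * d by rewrite -ler_pdivrMr.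
    have := ler_norm t; have := ler_norm (- t); rewrite normrN => h1 h2.
    rewrite /lo /hi !mulrDl rmorphN/= !mulNr -!pmulrn.
    have : 0 <= 2^-1 * d by rewrite mulr_ge0// ltW.
    by move=> h3; apply/andP; split; lra.
  - by apply: cvgMr; exact: cvg_sym_partial_sum.
have d2 : 0 < d ^+ 2 / 2 by rewrite divr_gt0 ?exprn_gt0.
pose s m := \sum_(k < m) w k.
have ws : cvgn s.
  apply: nondecreasing_is_cvgn.
    by apply/nondecreasing_seqP => m; rewrite /s big_ord_recr lerDl.
  by exists B => _ [m _ <-]; exact: wB.
have s_le m : s m <= limn s.
  apply: nondecreasing_cvgn_le ws _ => //.
  by apply/nondecreasing_seqP => k; rewrite /s big_ord_recr lerDl.
apply/subr_cvg0/cvgrPdist_le => /= eps eps0.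
(* The cells [n] and [- n] together contribute at most [d ^+ 2 * w n], so a tail of [w] below [eps']
   costs at most [eps / 2]. *)
pose eps' := eps / 2 / (d ^+ 2).
have eps'0 : 0 < eps' by rewrite !divr_gt0// exprn_gt0.
have [N0 N0P] : exists N0, limn s - s N0.+1 <= eps'.
  have /cvgrPdist_le/(_ _ eps'0) [N0 _ h] := ws.
  exists N0; apply: le_trans (ler_norm _) _; exact: (h N0.+1 (leqnSn _)).
have fin : sym_partial_sum (A K) N0 @[K --> \oo] --> (0 : R).
  rewrite /sym_partial_sum; elim: (N0) => [|N IH].
    by under eq_fun do rewrite big_ord0 addr0; exact: A_cvg.
  under eq_fun do rewrite big_ord_recr/= addrA.
  have h : A K 0 + \sum_(n < N) (A K n.+1 + A K (- n.+1%:Z)) +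
      (A K N.+1 + A K (- N.+1%:Z)) @[K --> \oo] --> (0 : R) + (0 + 0).
    by apply: cvgD; [exact: IH|apply: cvgD; exact: A_cvg].
  by rewrite !addr0 in h.
have e20 : 0 < eps / 2 by rewrite divr_gt0.
move/cvgrPdist_le : fin => /(_ _ e20); apply: filterS => K; rewrite !sub0r !normrN => hK.
have tailN N : `|sym_partial_sum (A K) (N0 + N)| <=
    `|sym_partial_sum (A K) N0| + d ^+ 2 * (s (N0 + N).+1 - s N0.+1).
  elim: N => [|N IH]; first by rewrite addn0 subrr mulr0 addr0.
  rewrite addnS {1}/sym_partial_sum big_ord_recr/= addrA -/(sym_partial_sum _ _).
  rewrite (le_trans (ler_normD _ _))// [s (N0 + N).+2]big_ord_recr/= -/(s _).
  have hA := A_le K (N0 + N).+1%:Z.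
  have hB := A_le K (- (N0 + N).+1%:Z); rewrite abszN in hB.
  have := ler_normD (A K (N0 + N).+1%:Z) (A K (- (N0 + N).+1%:Z)).
  move: hA hB => /=; lra.
have bound N : (N0 <= N)%N -> `|sym_partial_sum (A K) N| <= eps.
  move=> N0N; rewrite -(subnKC N0N) (le_trans (tailN _))// [eps]splitr lerD//.
  have := s_le (N0 + (N - N0)).+1; move: N0P; rewrite /eps' ler_pdivlMr ?exprn_gt0// => h1 h2.
  have : 0 < d ^+ 2 by rewrite exprn_gt0.
  nra.
have lim' : `|sym_partial_sum (A K) N| @[N --> \oo] --> `|intR (fun t => f t * dirichlet L K t) - T|.
  by apply: cvg_norm; exact: lim.
rewrite -(cvg_lim (@Rhausdorff R) lim'); apply: limr_le.
  by apply/cvg_ex; eexists; exact: lim'.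
by near=> N; apply: bound; near: N; exists N0.
Unshelve. all: by end_near. Qed.

End poisson_summation.

Section poisson_summation_der.
Context {R : realType}.
Variables (d C C1 : R) (f f' : R -> R).
Hypothesis d0 : 0 < d.
Hypothesis C10 : 0 <= C1.
Hypothesis mf : measurable_fun [set: R] f.
Hypothesis fC : forall t, `|f t| <= C * (1 + t ^+ 2)^-1.
Hypothesis df : forall t : R, d / 2 <= `|t| -> is_derive t 1 f (f' t).
Hypothesis f'C : forall t, d / 2 <= `|t| -> `|f' t| <= C1 * (1 + t ^+ 2)^-1.
Hypothesis f0C : forall t, `|t| <= d / 2 -> `|f t - f 0| <= C1 * `|t|.
Hypothesis fs : abs_summable [set: int] (fun n : int => f (n%:~R * d)).

(** A telescoping majorant of [C1 * (1 + t ^+ 2)^-1] on the cells. On cell [k >= 1] one has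
    [|t| >= k * d / 2], so the quotient is at most [4 / (k * d) ^+ 2], which is at most [8 / d ^+ 2]
    times [1 / (k * (k + 1))]. The central cell uses [f0C]. *)
Let w (k : nat) : R := C1 * (if k is k'.+1 then 8 / d ^+ 2 * (k'.+1%:R^-1 - k'.+2%:R^-1) else 1).

Let w_step (k : nat) : 0 <= k.+1%:R^-1 - k.+2%:R^-1 :> R.
Proof. by rewrite subr_ge0 lef_pV2 ?posrE// ler_nat. Qed.

Let d2 : 0 < d ^+ 2. Proof. by rewrite exprn_gt0. Qed.

Let w0 k : 0 <= w k.
Proof.
rewrite /w mulr_ge0//; case: k => // k.
by rewrite mulr_ge0 ?w_step// divr_ge0// ltW.
Qed.

Let wB m : \sum_(k < m) w k <= C1 * (1 + 8 / d ^+ 2).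
Proof.
have c8 : 0 <= 8 / d ^+ 2 by rewrite divr_ge0// ltW.
rewrite /w -mulr_sumr ler_wpM2l//; case: m => [|m]; first by rewrite big_ord0 addr_ge0.
rewrite big_ord_recl/= lerD2l -mulr_sumr -[leRHS]mulr1 ler_wpM2l//.
suff -> : \sum_(i < m) (i.+1%:R^-1 - i.+2%:R^-1) = 1 - m.+1%:R^-1 :> R.
  by rewrite gerBl invr_ge0.
elim: m => [|m IH]; first by rewrite big_ord0 invr1 subrr.
by rewrite big_ord_recr/= IH addrA subrK.
Qed.

Let cell_far (k : nat) (t : R) : (k.+1%:R - 2^-1) * d <= `|t| ->
  C1 * (1 + t ^+ 2)^-1 <= w k.+1.
Proof.
move=> h; rewrite /w ler_wpM2l//.
have k0 : 0 < k.+1%:R :> R by rewrite ltr0n.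
have k1 : k.+2%:R = k.+1%:R + 1 :> R by rewrite natr1.
have e : (k.+1%:R^-1 - k.+2%:R^-1 : R) = (k.+1%:R * k.+2%:R)^-1.
  by rewrite k1; field; rewrite !gt_eqF// ltr_wpDr.
rewrite e -[leRHS]invrK lef_pV2 ?posrE ?oneDsqr_gt0//; last first.
  by rewrite invr_gt0 !mulr_gt0 ?invr_gt0 ?mulr_gt0// ltr0n.
rewrite invfM invrK invf_div.
have k1' : 1 <= k.+1%:R :> R by rewrite ler1n.
have h2 : k.+1%:R * d / 2 <= `|t|.
  by apply: le_trans h; have := d0; nra.
have h3 : (k.+1%:R * d / 2) ^+ 2 <= t ^+ 2.
  rewrite -[leRHS]real_normK ?num_real// lerXn2r// nnegrE//.
  by rewrite divr_ge0// mulr_ge0// ltW.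
rewrite k1; have := d2; move: h3; set x := k.+1%:R in k1' *; nra.
Qed.

Let fw (n : int) t : `|t - n%:~R * d| <= d / 2 ->
  `|f t - f (n%:~R * d)| <= w `|n|%N * `|t - n%:~R * d|.
Proof.
have [->|n0] := eqVneq n 0.
  by rewrite /w/= mul0r subr0 mulr1; exact: f0C.
have [k nk] : exists k, `|n|%N = k.+1.
  by exists (`|n|%N.-1); rewrite prednK// absz_gt0.
have nE : `|n%:~R * d| = k.+1%:R * d.
  by rewrite normrM (gtr0_norm d0) -nk; congr (_ * _); rewrite -intr_norm -abszE.
rewrite nk => h.
have far (s : R) : Num.min (n%:~R * d) t <= s <= Num.max (n%:~R * d) t -> (k.+1%:R - 2^-1) * d <= `|s|.
  move=> hs; have : `|s - n%:~R * d| <= d / 2.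
    rewrite (le_trans _ h)//; move: hs; have [nt|tn] := leP (n%:~R * d) t => /andP[h1 h2].
      by rewrite !ger0_norm ?subr_ge0// lerB.
    by rewrite !ler0_norm ?subr_le0// ?(ltW tn)// lerN2 lerB.
  have := ler_normB s (s - n%:~R * d).
  rewrite opprB addrCA subrr addr0 nE mulrBl; lra.
have d2k (s : R) : (k.+1%:R - 2^-1) * d <= `|s| -> d / 2 <= `|s|.
  apply: le_trans; rewrite mulrC ler_pM2r//.
  have : 1 <= k.+1%:R :> R by rewrite ler1n.
  lra.
apply: (@mean_value_le _ f f') => s /far hs; first exact: (df (d2k _ hs)).
exact: le_trans (f'C (d2k _ hs)) (cell_far hs).
Qed.

(** The derivative is controlled only outside the central cell, because [gauss_cosm1] is defined by
    cases at [0]; inside, the increment from [0] is bounded directly. *)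
Lemma poisson_summation_der :
  intR (fun t => f t * dirichlet (2 * pi / d) K t) @[K --> \oo] -->
  d * rsum [set: int] (fun n : int => f (n%:~R * d)).
Proof. exact: (poisson_summation d0 mf fC w0 wB fw fs). Qed.

End poisson_summation_der.

(** * Trapezoidal errors *)

Lemma cvg_bound_le (R : realType) (u : nat -> R) (l B : R) :
  u n @[n --> \oo] --> l -> (forall n, u n <= B) -> l <= B.
Proof.
move=> ul uB; rewrite -(cvg_lim (@Rhausdorff R) ul); apply: limr_le.
  by apply/cvg_ex; exists l.
exact: nearW.
Qed.

(** * Poisson summation and trapezoidal errors for the two kernels *)

Section kernels.
Context {R : realType}.
Implicit Types (a b d t x : R).

Definition screened a t : R := expR (- a ^+ 2 - t ^+ 2) / (a ^+ 2 + t ^+ 2).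
Definition screened_cos a b t : R := screened a t * cos (b * t).
Definition gauss_cosm1 b t : R := expR (- t ^+ 2) * cosm1 b t.

Definition screened_fourier a b : R := intR (screened_cos a b).

Lemma screened_cosE a b t : screened_cos a b t =
  expR (- t ^+ 2) * (expR (- a ^+ 2) * ((a ^+ 2 + t ^+ 2)^-1 * cos (b * t))).
Proof. by rewrite /screened_cos /screened expRD; ring. Qed.

Lemma screened_ge0 a t : 0 <= screened a t.
Proof. by rewrite divr_ge0 ?expR_ge0// addr_ge0 ?sqr_ge0. Qed.

Lemma screened_le a t : 0 < a -> screened a t <= expR (- a ^+ 2) * a ^- 2 * expR (- t ^+ 2).
Proof.
move=> a0; rewrite /screened expRD mulrAC ler_wpM2r ?expR_ge0// ler_wpM2l ?expR_ge0//.
by rewrite lef_pV2 ?posrE ?exprn_gt0// ?ltr_wpDr ?sqr_ge0 ?exprn_gt0// lerDl sqr_ge0.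
Qed.

Lemma normr_screened_cos_le a b t : 0 < a ->
  `|screened_cos a b t| <= expR (- a ^+ 2) * a ^- 2 * expR (- t ^+ 2).
Proof.
move=> a0; rewrite (le_trans _ (screened_le t a0))// normrM ger0_norm ?screened_ge0//.
by rewrite ler_piMr ?screened_ge0// ler_norml cos_geN1 cos_le1.
Qed.

Lemma gauss_le_oneDsqrV t : expR (- t ^+ 2) <= 4 * (1 + t ^+ 2)^-1.
Proof. by rewrite -[leLHS]mul1r gauss_dominated// oneDsqr_ge1. Qed.

Lemma measurable_screened_cos a b : 0 < a -> measurable_fun [set: R] (screened_cos a b).
Proof.
move=> a0; rewrite (_ : screened_cos a b = fun t => expR (- t ^+ 2) *
  (expR (- a ^+ 2) * ((a ^+ 2 + t ^+ 2)^-1 * cos (b * t)))); last first.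
  by apply/funext => t; exact: screened_cosE.
apply: measurable_funM; first exact: (measurable_of_continuous continuous_gauss_fun).
apply: measurable_funM => //; apply: measurable_funM.
  exact: (measurable_of_continuous (continuous_screen a0)).
exact: (measurable_of_continuous (@continuous_cosM _ b)).
Qed.

Lemma integrable_screened_cos a b : 0 < a -> integrableR (screened_cos a b).
Proof.
move=> a0; have c0 : 0 <= expR (- a ^+ 2) * a ^- 2 by rewrite mulr_ge0 ?expR_ge0// invr_ge0 sqr_ge0.
apply: (@integrable_dominated _ _ (expR (- a ^+ 2) * a ^- 2 * 4)).
  exact: measurable_screened_cos.
move=> t; rewrite (le_trans (normr_screened_cos_le b t a0))// -[leRHS]mulrA ler_wpM2l//.
exact: gauss_le_oneDsqrV.
Qed.

Lemma measurable_gauss_cosm1 b : measurable_fun [set: R] (gauss_cosm1 b).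
Proof.
apply: measurable_funM; first exact: (measurable_of_continuous continuous_gauss_fun).
exact: measurable_cosm1.
Qed.

Lemma normr_gauss_cosm1_le b t : `|gauss_cosm1 b t| <= b ^+ 2 * expR (- t ^+ 2).
Proof.
by rewrite normrM ger0_norm ?expR_ge0// mulrC ler_wpM2r ?expR_ge0// normr_cosm1.
Qed.

(* n^2 >= |n| on the integers reduces Gaussian to geometric decay. *)
Lemma abs_summable_gauss d : 0 < d ->
  abs_summable [set: int] (fun n : int => expR (- (n%:~R * d) ^+ 2)).
Proof.
move=> d0; apply: (abs_summable_le (@abs_summable_expR R (d ^+ 2) (exprn_gt0 _ d0))) => n _.
rewrite ger0_norm ?expR_ge0// ler_expR lerN2 exprMn mulrC ler_wpM2r ?sqr_ge0//.
have [->|n0] := eqVneq n 0; first by rewrite normr0 expr0n.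
rewrite -[leRHS]real_normK ?num_real// expr2 ler_peMl// -intr_norm ler1z.
by rewrite -gtz0_ge1 normr_gt0.
Qed.

Lemma abs_summable_screened_cos a b d : 0 < a -> 0 < d ->
  abs_summable [set: int] (fun n : int => screened_cos a b (n%:~R * d)).
Proof.
move=> a0 d0; apply: (abs_summable_le (abs_summableZ (expR (- a ^+ 2) * a ^- 2) (abs_summable_gauss d0))).
by move=> n _; exact: normr_screened_cos_le.
Qed.

Lemma abs_summable_gauss_cosm1 b d : 0 < d ->
  abs_summable [set: int] (fun n : int => gauss_cosm1 b (n%:~R * d)).
Proof.
move=> d0; apply: (abs_summable_le (abs_summableZ (b ^+ 2) (abs_summable_gauss d0))).
by move=> n _; exact: normr_gauss_cosm1_le.
Qed.

Lemma screened_poisson a b d : 0 < a -> 0 < d ->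
  intR (fun t => screened_cos a b t * dirichlet (2 * pi / d) K t) @[K --> \oo] -->
  d * rsum [set: int] (fun n : int => screened_cos a b (n%:~R * d)).
Proof.
move=> a0 d0.
have a2 t : 0 < a ^+ 2 + t ^+ 2 by rewrite ltr_wpDr ?sqr_ge0// exprn_gt0.
pose s t := (a ^+ 2 + t ^+ 2)^-1.
have s_le t : 0 <= s t <= a ^- 2.
  by rewrite invr_ge0 ltW//= lef_pV2 ?posrE ?exprn_gt0// lerDl sqr_ge0.
pose g' t := expR (- a ^+ 2) *
  (- (2 * t) * s t * cos (b * t) - 2 * t * s t ^+ 2 * cos (b * t) - b * s t * sin (b * t)).
pose f' t := expR (- t ^+ 2) * g' t.
have df (t : R) : is_derive t 1 (screened_cos a b) (f' t).
  rewrite (_ : screened_cos a b = fun t => expR (- t ^+ 2) *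
    (expR (- a ^+ 2) * (s t * cos (b * t)))); last first.
    by apply/funext => u; exact: screened_cosE.
  have ds : is_derive t 1 s (- (a ^+ 2 + t ^+ 2) ^- 2 * (0 + 2%:R * t ^+ 1 * 1)).
    by apply: isder_inv; [rewrite gt_eqF|exact: isder_add (isder_cst _ _) (isder_exp 1 (isder_id t))].
  by rewrite /f' /g'; der_eq; rewrite /s; field; rewrite gt_eqF.
pose M := expR (- a ^+ 2) * (2 * a ^- 2 + 2 * (a ^- 2) ^+ 2 + `|b| * a ^- 2).
have i0 : 0 <= a ^- 2 by rewrite invr_ge0 sqr_ge0.
have M0 : 0 <= M by rewrite mulr_ge0 ?expR_ge0// !addr_ge0// mulr_ge0// sqr_ge0.
have g'M t : `|g' t| <= M * (1 + t ^+ 2).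
  rewrite /g' /M normrM ger0_norm ?expR_ge0// -[leRHS]mulrA ler_wpM2l ?expR_ge0//.
  have c1 : `|cos (b * t)| <= 1 by rewrite ler_norml cos_geN1 cos_le1.
  have s1 : `|sin (b * t)| <= 1 by rewrite ler_norml sin_geN1 sin_le1.
  have tt := normr_le_oneDsqr t; have t1 := oneDsqr_ge1 t.
  have /andP[s0 sa] := s_le t; have p0 := ltW (oneDsqr_gt0 t).
  have e1 : `|- (2 * t) * s t * cos (b * t)| <= 2 * a ^- 2 * (1 + t ^+ 2).
    rewrite normrM -[leRHS]mulr1 ler_pM// normrM normrN normrM (ger0_norm s0) ger0_norm//.
    by rewrite mulrAC ler_pM ?mulr_ge0// ler_wpM2l.
  have e2 : `|2 * t * s t ^+ 2 * cos (b * t)| <= 2 * (a ^- 2) ^+ 2 * (1 + t ^+ 2).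
    rewrite normrM -[leRHS]mulr1 ler_pM// normrM normrM (ger0_norm (sqr_ge0 (s t))) ger0_norm//.
    by rewrite mulrAC ler_pM ?mulr_ge0 ?sqr_ge0// ler_wpM2l// lerXn2r// nnegrE.
  have e3 : `|b * s t * sin (b * t)| <= `|b| * a ^- 2 * (1 + t ^+ 2).
    rewrite normrM ler_pM ?(le_trans s1)// normrM (ger0_norm s0).
    by rewrite ler_wpM2l.
  have := ler_normB (- (2 * t) * s t * cos (b * t)) (2 * t * s t ^+ 2 * cos (b * t)).
  have := ler_normB (- (2 * t) * s t * cos (b * t) - 2 * t * s t ^+ 2 * cos (b * t)) (b * s t * sin (b * t)).
  lra.
have f'C t : `|f' t| <= 4 * M * (1 + t ^+ 2)^-1 by exact: gauss_dominatedM.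
apply: (@poisson_summation_der _ d (expR (- a ^+ 2) * a ^- 2 * 4) (4 * M) _ f') => //.
- by rewrite mulr_ge0.
- exact: measurable_screened_cos.
- move=> t; rewrite (le_trans (normr_screened_cos_le b t a0))// -[leRHS]mulrA ler_wpM2l//.
    by rewrite mulr_ge0 ?expR_ge0.
  exact: gauss_le_oneDsqrV.
- move=> t _; rewrite -[X in _ * `|X|]subr0; apply: (@mean_value_le _ _ f') => // u _.
  have M40 : 0 <= 4 * M by rewrite mulr_ge0.
  rewrite (le_trans (f'C u))// ler_piMr//.
  by rewrite invf_le1 ?oneDsqr_gt0// oneDsqr_ge1.
- exact: abs_summable_screened_cos.
Qed.

Lemma normr_gauss_cosm1D_le b t : t != 0 ->
  `|gauss_cosm1 b t + b ^+ 2 / 2| <= (b ^+ 2 + b ^+ 4) * t ^+ 2.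
Proof.
move=> t0; have t20 : 0 < t ^+ 2 by rewrite lt_def sqrf_eq0 t0 sqr_ge0.
have -> : gauss_cosm1 b t + b ^+ 2 / 2 =
   (expR (- t ^+ 2) - 1) * cosm1 b t + (cosm1 b t + b ^+ 2 / 2) by rewrite /gauss_cosm1; ring.
have e1 : `|(expR (- t ^+ 2) - 1) * cosm1 b t| <= t ^+ 2 * b ^+ 2.
  rewrite normrM ler_pM ?normr_cosm1// distrC ger0_norm ?subr_ge0 ?gauss_le1//.
  by have := expR_ge1Dx (- t ^+ 2); lra.
have e2 : `|cosm1 b t + b ^+ 2 / 2| <= b ^+ 4 * t ^+ 2.
  rewrite /cosm1 (negbTE t0).
  have -> : (cos (b * t) - 1) / t ^+ 2 + b ^+ 2 / 2 =
    (cos (b * t) - 1 + (b * t) ^+ 2 / 2) / t ^+ 2 by field.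
  rewrite normrM [X in _ * X]ger0_norm ?invr_ge0 ?(ltW t20)// ler_pdivrMr//.
  rewrite (le_trans (normr_cosB1D_le _))// -normrX ger0_norm; last exact: exprn_even_ge0.
  by rewrite le_eqVlt; apply/orP; left; apply/eqP; ring.
rewrite (le_trans (ler_normD _ _))// (le_trans (lerD e1 e2))//.
by rewrite [X in X + _]mulrC -mulrDl.
Qed.

Lemma gauss_cosm1_0 b : gauss_cosm1 b 0 = - (b ^+ 2 / 2).
Proof. by rewrite /gauss_cosm1 /cosm1 eqxx expr0n/= oppr0 expR0 mul1r. Qed.

Lemma gauss_cosm1_poisson b d : 0 < d ->
  intR (fun t => gauss_cosm1 b t * dirichlet (2 * pi / d) K t) @[K --> \oo] -->
  d * rsum [set: int] (fun n : int => gauss_cosm1 b (n%:~R * d)).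
Proof.
move=> d0; have d20 : 0 < d / 2 by rewrite divr_gt0.
have tn0 t : d / 2 <= `|t| -> t != 0.
  by move=> h; rewrite -normr_gt0 (lt_le_trans _ h).
pose g' t := - (2 * t) * cosm1 b t - b * sin (b * t) / t ^+ 2 - 2 * cosm1 b t / t.
pose f' t := expR (- t ^+ 2) * g' t.
have df (t : R) : d / 2 <= `|t| -> is_derive t 1 (gauss_cosm1 b) (f' t).
  move=> /tn0 t0.
  have d1 : is_derive t 1 (fun t : R => (t ^+ 2)^-1) (- (t ^+ 2) ^- 2 * (2%:R * t ^+ 1 * 1)).
    by apply: isder_inv; [rewrite sqrf_eq0|exact: isder_exp (isder_id t)].
  have d2 : is_derive t 1 (fun t => expR (- t ^+ 2) * ((cos (b * t) - 1) * (t ^+ 2)^-1)) (f' t).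
    by rewrite /f' /g' /cosm1 (negbTE t0); der_eq; field.
  apply: near_eq_is_derive d2; near=> u; rewrite /gauss_cosm1 /cosm1 ifN//.
  near: u; exists `|t| => /=; first by rewrite normr_gt0.
  by move=> x /=; apply: contraTneq => ->; rewrite subr0 ltxx.
have b2 : 0 <= b ^+ 2 by rewrite sqr_ge0.
(* The first two summands bound [g'] outside the central cell, where [|t|^-1 <= 2 / d]; the last
   turns the quadratic Taylor estimate at [0] into a Lipschitz bound on that cell. *)
pose M := 2 * b ^+ 2 + 6 * b ^+ 2 / d + (b ^+ 2 + b ^+ 4) * d.
have b4 : 0 <= b ^+ 4 by exact: exprn_even_ge0.
have x1 : 0 <= 6 * b ^+ 2 / d by rewrite divr_ge0 ?(ltW d0)// mulr_ge0.
have x2 : 0 <= (b ^+ 2 + b ^+ 4) * d by rewrite mulr_ge0 ?(ltW d0)// addr_ge0.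
have M0 : 0 <= M by rewrite /M; lra.
have g'M t : d / 2 <= `|t| -> `|g' t| <= M * (1 + t ^+ 2).
  move=> h; have t0 := tn0 _ h; have tp : 0 < `|t| by rewrite normr_gt0.
  have k1 := normr_cosm1 b t; have tt := normr_le_oneDsqr t; have t1 := oneDsqr_ge1 t.
  have it : `|t|^-1 <= 2 / d by rewrite -[2 / d]invf_div lef_pV2 ?posrE.
  have e1 : `|- (2 * t) * cosm1 b t| <= 2 * b ^+ 2 * (1 + t ^+ 2).
    by rewrite normrM normrN normrM ger0_norm// mulrAC ler_pM ?mulr_ge0// ler_wpM2l.
  have e2 : `|b * sin (b * t) / t ^+ 2| <= 2 * b ^+ 2 / d.
    rewrite normrM normfV normrX.
    have -> : 2 * b ^+ 2 / d = b ^+ 2 * `|t| * (2 / d) / `|t| by field; rewrite !gt_eqF.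
    have hs : `|b * sin (b * t)| <= b ^+ 2 * `|t|.
      rewrite normrM -[b ^+ 2]real_normK ?num_real// expr2 -mulrA ler_wpM2l// -normrM.
      exact: normr_sin_le.
    by rewrite expr2 invfM mulrA ler_wpM2r ?invr_ge0// ler_pM.
  have e3 : `|2 * cosm1 b t / t| <= 4 * b ^+ 2 / d.
    rewrite normrM normrM normfV ger0_norm//.
    have -> : 4 * b ^+ 2 / d = 2 * b ^+ 2 * (2 / d) by field; rewrite gt_eqF.
    by rewrite ler_pM ?mulr_ge0// ler_wpM2l.
  have := ler_normB (- (2 * t) * cosm1 b t - b * sin (b * t) / t ^+ 2) (2 * cosm1 b t / t).
  have := ler_normB (- (2 * t) * cosm1 b t) (b * sin (b * t) / t ^+ 2).
  rewrite -/(g' t) /M => n1 n2.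
  have : 6 * b ^+ 2 / d * 1 <= 6 * b ^+ 2 / d * (1 + t ^+ 2).
    by rewrite ler_wpM2l// -mulrA mulr_ge0.
  have : 0 <= (b ^+ 2 + b ^+ 4) * d * (1 + t ^+ 2) by rewrite mulr_ge0// (le_trans _ t1).
  lra.
have f'C t : d / 2 <= `|t| -> `|f' t| <= 4 * M * (1 + t ^+ 2)^-1.
  by move=> h; apply: gauss_dominatedM => //; exact: g'M.
apply: (@poisson_summation_der _ d (b ^+ 2 * 4) (4 * M) _ f') => //.
- by rewrite mulr_ge0.
- exact: measurable_gauss_cosm1.
- move=> t; rewrite (le_trans (normr_gauss_cosm1_le b t))// -[leRHS]mulrA ler_wpM2l//.
  exact: gauss_le_oneDsqrV.
- move=> t td; rewrite gauss_cosm1_0 opprK.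
  have [->|t0] := eqVneq t 0; first by rewrite gauss_cosm1_0 addNr normr0 mulr0.
  rewrite (le_trans (normr_gauss_cosm1D_le b t0))// -[t ^+ 2]real_normK ?num_real// expr2 mulrA.
  rewrite ler_wpM2r// /M.
  have : (b ^+ 2 + b ^+ 4) * `|t| <= (b ^+ 2 + b ^+ 4) * d.
    by rewrite ler_wpM2l ?addr_ge0// (le_trans td)// ler_pdivrMr// ler_peMr// ?ler1n ?ltW.
  lra.
- exact: abs_summable_gauss_cosm1.
Unshelve. all: by end_near. Qed.

Lemma dirichlet_cosM a L K t : cos (a * t) * dirichlet L K t =
  cos (a * t) + \sum_(m < K) (cos ((m.+1%:R * L + a) * t) + cos ((m.+1%:R * L - a) * t)).
Proof.
rewrite /dirichlet mulrDr mulr1 mulrCA mulr_sumr mulr_sumr; congr (_ + _).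
apply: eq_bigr => m _; have e1 : cos ((m.+1%:R * L + a) * t) =
    cos (m.+1%:R * L * t) * cos (a * t) - sin (m.+1%:R * L * t) * sin (a * t).
  by rewrite mulrDl cosD.
have e2 : cos ((m.+1%:R * L - a) * t) =
    cos (m.+1%:R * L * t) * cos (a * t) + sin (m.+1%:R * L * t) * sin (a * t).
  by rewrite mulrBl cosB.
by rewrite e1 e2; ring.
Qed.

Lemma integral_screened_dirichlet a b L K : 0 < a ->
  intR (fun t => screened_cos a b t * dirichlet L K t) = screened_fourier a b +
  \sum_(m < K) (screened_fourier a (m.+1%:R * L + b) + screened_fourier a (m.+1%:R * L - b)).
Proof.
move=> a0.
have e t : screened_cos a b t * dirichlet L K t = screened_cos a b t +
   \sum_(m < K) (screened_cos a (m.+1%:R * L + b) t + screened_cos a (m.+1%:R * L - b) t).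
  rewrite /screened_cos -mulrA dirichlet_cosM mulrDr mulr_sumr; congr (_ + _).
  by apply: eq_bigr => m _; rewrite mulrDr.
under eq_Rintegral do rewrite e.
elim: K {e} => [|K IH].
  by under eq_Rintegral do rewrite big_ord0 addr0; rewrite big_ord0 addr0.
under eq_Rintegral do rewrite big_ord_recr/= addrA.
have ic c := @integrable_screened_cos a c a0.
have id2 k : integrableR (fun t => screened_cos a (k.+1%:R * L + b) t + screened_cos a (k.+1%:R * L - b) t).
  exact: (integrableD measurableT (ic _) (ic _)).
have isum k : integrableR (fun t => screened_cos a b t + \sum_(m < k)
    (screened_cos a (m.+1%:R * L + b) t + screened_cos a (m.+1%:R * L - b) t)).
  elim: k => [|k IHk]; first by under eq_fun do rewrite big_ord0 addr0; exact: ic.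
  under eq_fun do rewrite big_ord_recr/= addrA.
  exact: (integrableD measurableT IHk (id2 k)).
rewrite (RintegralD measurableT (isum K) (id2 K)) IH (RintegralD measurableT (ic _) (ic _)).
by rewrite [in RHS]big_ord_recr/= [RHS]addrA.
Qed.

Lemma cosm1M a b t : cosm1 b t * (2 * cos (a * t)) =
  cosm1 (a + b) t + cosm1 (a - b) t - 2 * cosm1 a t.
Proof.
rewrite /cosm1; case: eqP => [->|/eqP t0]; first by rewrite mulr0 cos0; field.
by rewrite !mulrDl !mulNr !cosD cosN sinN; field.
Qed.

Lemma integral_gauss_cosm1_dirichlet b L K :
  intR (fun t => gauss_cosm1 b t * dirichlet L K t) = unscreened_fourier b +
  \sum_(m < K) (unscreened_fourier (m.+1%:R * L + b) + unscreened_fourier (m.+1%:R * L - b)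
     - 2 * unscreened_fourier (m.+1%:R * L)).
Proof.
have e t : gauss_cosm1 b t * dirichlet L K t = gauss_cosm1 b t +
   \sum_(m < K) (gauss_cosm1 (m.+1%:R * L + b) t + gauss_cosm1 (m.+1%:R * L - b) t
     - 2 * gauss_cosm1 (m.+1%:R * L) t).
  rewrite /gauss_cosm1 -mulrA /dirichlet mulrDr mulr1 mulrDr mulr_sumr mulr_sumr mulr_sumr; congr (_ + _).
  by apply: eq_bigr => m _; rewrite cosm1M; ring.
under eq_Rintegral do rewrite e.
have ic (c : R) : integrableR (gauss_cosm1 c) := integrable_cosm1 c.
have id2 k : integrableR (fun t => gauss_cosm1 (k.+1%:R * L + b) t + gauss_cosm1 (k.+1%:R * L - b) t).
  exact: (integrableD measurableT (ic _) (ic _)).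
have id3 k : integrableR (fun t => 2 * gauss_cosm1 (k.+1%:R * L) t).
  exact: (integrableZl measurableT 2 (ic _)).
have id4 k : integrableR (fun t => gauss_cosm1 (k.+1%:R * L + b) t + gauss_cosm1 (k.+1%:R * L - b) t
    - 2 * gauss_cosm1 (k.+1%:R * L) t).
  exact: (integrableB measurableT (id2 k) (id3 k)).
have isum k : integrableR (fun t => gauss_cosm1 b t + \sum_(m < k)
    (gauss_cosm1 (m.+1%:R * L + b) t + gauss_cosm1 (m.+1%:R * L - b) t - 2 * gauss_cosm1 (m.+1%:R * L) t)).
  elim: k => [|k IHk]; first by under eq_fun do rewrite big_ord0 addr0; exact: ic.
  under eq_fun do rewrite big_ord_recr/= addrA.
  exact: (integrableD measurableT IHk (id4 k)).
elim: K {e} => [|K IH].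
  by under eq_Rintegral do rewrite big_ord0 addr0; rewrite big_ord0 addr0.
under eq_Rintegral do rewrite big_ord_recr/= addrA.
rewrite (RintegralD measurableT (isum K) (id4 K)) IH (RintegralB measurableT (id2 K) (id3 K)).
rewrite (RintegralD measurableT (ic _) (ic _)) (RintegralZl _ measurableT (ic _)).
by rewrite [in RHS]big_ord_recr/= [RHS]addrA.
Qed.

(** Expanding the square, the cross term [x * m * L / 2] is at least [2 * m], so the Gaussians are
    dominated by a geometric series of ratio [expR (- 2) <= 1 / 2]. *)
Lemma sum_gauss_shift_le x L K : 2 <= x -> x <= L ->
  \sum_(m < K) expR (- ((x + m%:R * L) ^+ 2 / 4)) <= 2 * expR (- (x ^+ 2 / 4)).
Proof.
move=> x2 xL; have q0 : 0 <= expR (- 2) :> R by exact: expR_ge0.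
have q1 : expR (- 2) <= 2^-1 :> R.
  by rewrite expRN lef_pV2 ?posrE ?expR_gt0// (le_trans _ (expR_ge1Dx _))// lerDr.
apply: (@le_trans _ _ (\sum_(m < K) (expR (- (x ^+ 2 / 4)) * expR (- 2) ^+ m))).
  apply: ler_sum => m _; rewrite -expRM_natr -expRD ler_expR.
  have m0 : 0 <= m%:R :> R by [].
  have : 2 * m%:R <= L * m%:R by rewrite ler_wpM2r// (le_trans x2).
  nra.
rewrite -mulr_sumr mulrC ler_wpM2r ?expR_ge0//.
elim: K => [|K IH]; first by rewrite big_ord0.
rewrite big_ord_recl expr0 (eq_bigr (fun i : 'I_K => expR (- 2) * expR (- 2) ^+ i)); last first.
  by move=> i _; rewrite /= exprS.
rewrite -mulr_sumr.
have : 0 <= \sum_(i < K) expR (- 2) ^+ i :> R by apply: sumr_ge0 => i _; rewrite exprn_ge0.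
nra.
Qed.

Lemma cvg_geometric_tail a L : 0 < a -> 0 < L ->
  \sum_(m < K) expR (- (a * (m.+1%:R * L))) @[K --> \oo] --> (expR (a * L) - 1)^-1.
Proof.
move=> a0 L0; have q1 : expR (- (a * L)) < 1 by rewrite -[ltRHS]expR0 ltr_expR oppr_lt0 mulr_gt0.
have q2 : `|expR (- (a * L))| < 1 by rewrite ger0_norm ?expR_ge0.
have := cvg_geometric_series (a := expR (- (a * L))) q2.
have -> : expR (- (a * L)) / (1 - expR (- (a * L))) = (expR (a * L) - 1)^-1.
  have e1 : expR (- (a * L)) != 0 by rewrite gt_eqF ?expR_gt0.
  have e2 : 1 - expR (- (a * L)) != 0 by rewrite gt_eqF ?subr_gt0.
  have -> : expR (a * L) = (expR (- (a * L)))^-1 by rewrite -expRN opprK.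
  have -> : (expR (- (a * L)))^-1 - 1 = (1 - expR (- (a * L))) / expR (- (a * L)) by field.
  by rewrite invf_div.
rewrite (_ : series _ = fun K => \sum_(m < K) expR (- (a * (m.+1%:R * L))))//.
apply/funext => K; rewrite /series/= big_mkord.
by apply: eq_bigr => m _; rewrite /geometric/= -exprS -expRM_natr; congr expR; ring.
Qed.

Definition tail_const : R := 2 * pi * expR 1 ^+ 2.

(** The exponential main terms are subtracted from each pair of shifted transforms before summing,
    and their geometric series is evaluated exactly. In the constant 4, one factor 2 counts the
    shifts by [b] and [- b], the other is the sum of the Gaussians. *)
Lemma screened_trapezoid_error a b d : 0 < a -> 0 < d -> 2 <= 2 * pi / d - `|b| ->
  `|d * rsum [set: int] (fun n : int => screened_cos a b (n%:~R * d)) - screened_fourier a b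
    - pi / a * (expR (a * b) + expR (- (a * b))) / (expR (a * (2 * pi / d)) - 1)| <=
  4 * tail_const / a * expR (- a) * expR (- ((2 * pi / d - `|b|) ^+ 2 / 4)).
Proof.
move=> a0 d0; set L := 2 * pi / d => Lb.
have L0 : 0 < L by rewrite (lt_le_trans _ (le_trans Lb _))// gerBl.
have key : \sum_(m < K) (screened_fourier a (m.+1%:R * L + b) + screened_fourier a (m.+1%:R * L - b)
     - pi / a * (expR (a * b) + expR (- (a * b))) * expR (- (a * (m.+1%:R * L)))) @[K --> \oo] -->
   d * rsum [set: int] (fun n : int => screened_cos a b (n%:~R * d)) - screened_fourier a b
    - pi / a * (expR (a * b) + expR (- (a * b))) / (expR (a * L) - 1).
  rewrite (_ : (fun K => _) = (fun K => intR (fun t => screened_cos a b t * dirichlet L K t)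
    - screened_fourier a b - pi / a * (expR (a * b) + expR (- (a * b))) *
      \sum_(m < K) expR (- (a * (m.+1%:R * L))))); last first.
    apply/funext => K; rewrite integral_screened_dirichlet// [X in X - _ - _]addrC addrK.
    by rewrite mulr_sumr -sumrB.
  apply: cvgB; last by apply: cvgMr; exact: cvg_geometric_tail.
  by apply: cvgB; [exact: screened_poisson|exact: cvg_cst].
have tail0 : 0 <= tail_const / a by rewrite divr_ge0 ?(ltW a0)// !mulr_ge0 ?pi_ge0 ?sqr_ge0.
have term (m : nat) : `|screened_fourier a (m.+1%:R * L + b) + screened_fourier a (m.+1%:R * L - b)
     - pi / a * (expR (a * b) + expR (- (a * b))) * expR (- (a * (m.+1%:R * L)))| <=
   2 * (tail_const / a * expR (- a)) * expR (- ((L - `|b| + m%:R * L) ^+ 2 / 4)).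
  have e1 : m.+1%:R * L = L + m%:R * L by rewrite -natr1 mulrDl mul1r addrC.
  have mL : 0 <= m%:R * L by rewrite mulr_ge0// ltW.
  have [nb pb] : - `|b| <= b /\ b <= `|b| by split; [rewrite lerNl -normrN ler_norm|exact: ler_norm].
  have half x : L - `|b| + m%:R * L <= x ->
     `|screened_fourier a x - pi / a * expR (- (a * x))| <=
     tail_const / a * expR (- a) * expR (- ((L - `|b| + m%:R * L) ^+ 2 / 4)).
    move=> hx; have x0 : 0 <= L - `|b| + m%:R * L by rewrite addr_ge0// (le_trans _ Lb).
    have x2 : 2 <= x by rewrite (le_trans _ hx)// (le_trans Lb)// lerDl.
    rewrite (le_trans (screened_fourier_tail a0 x2))// ler_wpM2l ?(mulr_ge0 tail0 (expR_ge0 _))//.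
    by rewrite ler_expR lerN2 ler_wpM2r// lerXn2r// nnegrE// (le_trans x0).
  have h1 := half (m.+1%:R * L + b); have h2 := half (m.+1%:R * L - b).
  have -> : screened_fourier a (m.+1%:R * L + b) + screened_fourier a (m.+1%:R * L - b)
     - pi / a * (expR (a * b) + expR (- (a * b))) * expR (- (a * (m.+1%:R * L))) =
    (screened_fourier a (m.+1%:R * L + b) - pi / a * expR (- (a * (m.+1%:R * L + b)))) +
    (screened_fourier a (m.+1%:R * L - b) - pi / a * expR (- (a * (m.+1%:R * L - b)))).
    have -> : - (a * (m.+1%:R * L + b)) = - (a * (m.+1%:R * L)) - a * b by ring.
    have -> : - (a * (m.+1%:R * L - b)) = - (a * (m.+1%:R * L)) + a * b by ring.
    by rewrite !expRD; ring.
  rewrite (le_trans (ler_normD _ _))//.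
  by have := h1 (ltac:(rewrite e1; lra)); have := h2 (ltac:(rewrite e1; lra)); lra.
have lim' : `|\sum_(m < K) (screened_fourier a (m.+1%:R * L + b) + screened_fourier a (m.+1%:R * L - b)
     - pi / a * (expR (a * b) + expR (- (a * b))) * expR (- (a * (m.+1%:R * L))))| @[K --> \oo] -->
   `|d * rsum [set: int] (fun n : int => screened_cos a b (n%:~R * d)) - screened_fourier a b
    - pi / a * (expR (a * b) + expR (- (a * b))) / (expR (a * L) - 1)|.
  by apply: cvg_norm.
have bound K : `|\sum_(m < K) (screened_fourier a (m.+1%:R * L + b) + screened_fourier a (m.+1%:R * L - b)
     - pi / a * (expR (a * b) + expR (- (a * b))) * expR (- (a * (m.+1%:R * L))))| <=
   4 * tail_const / a * expR (- a) * expR (- ((L - `|b|) ^+ 2 / 4)).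
  rewrite (le_trans (ler_norm_sum _ _ _))// (le_trans (ler_sum _ (fun (m : 'I_K) _ => term m)))//.
  rewrite -mulr_sumr.
  have -> : 4 * tail_const / a * expR (- a) * expR (- ((L - `|b|) ^+ 2 / 4)) =
    2 * (tail_const / a * expR (- a)) * (2 * expR (- ((L - `|b|) ^+ 2 / 4))) by ring.
  by rewrite ler_wpM2l ?sum_gauss_shift_le ?gerBl// mulr_ge0// (mulr_ge0 tail0 (expR_ge0 _)).
exact: cvg_bound_le lim' bound.
Qed.

(** All three arguments of each second difference are positive, so they lie on the same affine
    branch. The weights [1 + 1 + 2] of a tail [2 * sqrt pi], doubled by the sum of the Gaussians,
    give the constant 16. *)
Lemma unscreened_trapezoid_error b d : 0 < d -> 2 <= 2 * pi / d - `|b| ->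
  `|d * rsum [set: int] (fun n : int => gauss_cosm1 b (n%:~R * d)) - unscreened_fourier b| <=
  16 * Num.sqrt pi * expR (- ((2 * pi / d - `|b|) ^+ 2 / 4)).
Proof.
move=> d0; set L := 2 * pi / d => Lb.
have L0 : 0 < L by rewrite (lt_le_trans _ (le_trans Lb _))// gerBl.
have key : \sum_(m < K) (unscreened_fourier (m.+1%:R * L + b) + unscreened_fourier (m.+1%:R * L - b)
     - 2 * unscreened_fourier (m.+1%:R * L)) @[K --> \oo] -->
   d * rsum [set: int] (fun n : int => gauss_cosm1 b (n%:~R * d)) - unscreened_fourier b.
  rewrite (_ : (fun K => _) = (fun K => intR (fun t => gauss_cosm1 b t * dirichlet L K t)
    - unscreened_fourier b)); last first.
    by apply/funext => K; rewrite integral_gauss_cosm1_dirichlet// [X in X - _]addrC addrK.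
  by apply: cvgB; [exact: gauss_cosm1_poisson|exact: cvg_cst].
have term (m : nat) : `|unscreened_fourier (m.+1%:R * L + b) + unscreened_fourier (m.+1%:R * L - b)
     - 2 * unscreened_fourier (m.+1%:R * L)| <=
   8 * Num.sqrt pi * expR (- ((L - `|b| + m%:R * L) ^+ 2 / 4)).
  have e1 : m.+1%:R * L = L + m%:R * L by rewrite -natr1 mulrDl mul1r addrC.
  have mL : 0 <= m%:R * L by rewrite mulr_ge0// ltW.
  have [nb pb] : - `|b| <= b /\ b <= `|b| by split; [rewrite lerNl -normrN ler_norm|exact: ler_norm].
  have half x : L - `|b| + m%:R * L <= x ->
     `|unscreened_fourier x + pi * x - 2 * Num.sqrt pi| <=
     2 * Num.sqrt pi * expR (- ((L - `|b| + m%:R * L) ^+ 2 / 4)).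
    move=> hx; have x0 : 0 <= L - `|b| + m%:R * L by rewrite addr_ge0// (le_trans _ Lb).
    have x2 : 0 < x by lra.
    rewrite (le_trans (unscreened_fourier_tail x2))// ler_wpM2l ?mulr_ge0 ?sqrtr_ge0//.
    by rewrite ler_expR lerN2 ler_wpM2r// lerXn2r// nnegrE// (le_trans x0).
  have h1 := half (m.+1%:R * L + b); have h2 := half (m.+1%:R * L - b).
  have h3 := half (m.+1%:R * L).
  have := h1 (ltac:(rewrite e1; lra)); have := h2 (ltac:(rewrite e1; lra)).
  have := h3 (ltac:(rewrite e1; have := normr_ge0 b; lra)).
  rewrite !ler_norml => /andP[? ?] /andP[? ?] /andP[? ?]; apply/andP; split; lra.
have lim' : `|\sum_(m < K) (unscreened_fourier (m.+1%:R * L + b) + unscreened_fourier (m.+1%:R * L - b)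
     - 2 * unscreened_fourier (m.+1%:R * L))| @[K --> \oo] -->
   `|d * rsum [set: int] (fun n : int => gauss_cosm1 b (n%:~R * d)) - unscreened_fourier b|.
  by apply: cvg_norm.
have bound K : `|\sum_(m < K) (unscreened_fourier (m.+1%:R * L + b) + unscreened_fourier (m.+1%:R * L - b)
     - 2 * unscreened_fourier (m.+1%:R * L))| <=
   16 * Num.sqrt pi * expR (- ((L - `|b|) ^+ 2 / 4)).
  rewrite (le_trans (ler_norm_sum _ _ _))// (le_trans (ler_sum _ (fun (m : 'I_K) _ => term m)))//.
  rewrite -mulr_sumr.
  have -> : 16 * Num.sqrt pi * expR (- ((L - `|b|) ^+ 2 / 4)) =
    8 * Num.sqrt pi * (2 * expR (- ((L - `|b|) ^+ 2 / 4))) by ring.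
  rewrite ler_wpM2l ?mulr_ge0 ?sqrtr_ge0// sum_gauss_shift_le//.
  by rewrite gerBl.
exact: cvg_bound_le lim' bound.
Qed.

End kernels.

(** * Principal values *)

Section odd_functions.
Context {R : realType}.

Lemma Rintegral_odd (D : set R) (f : R -> R) : measurable (D : set (measurableTypeR R)) ->
  (forall t, D t -> D (- t)) -> measurable_fun [set: R] f ->
  mu.-integrable D (EFin \o f) -> (forall t, D t -> f (- t) = - f t) ->
  \int[mu]_(t in D) f t = 0.
Proof.
move=> mD symD mf itg oddf.
have preD : (-%R : measurableTypeR R -> measurableTypeR R) @^-1` D = D.
  by apply/seteqP; split => t /= Dt; [rewrite -[t]opprK|]; exact: symD.
have mN : measurable_fun [set: measurableTypeR R] (-%R : measurableTypeR R -> measurableTypeR R).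
  exact: oppr_measurable.
have mEf : measurable_fun [set: measurableTypeR R] (EFin \o f) by exact/measurable_EFinP.
have e : \int[mu]_(t in D) f t = \int[mu]_(t in D) (- f t).
  rewrite /Rintegral; congr fine.
  have -> : (\int[mu]_(t in D) (f t)%:E =
      \int[pushforward mu (-%R : measurableTypeR R -> measurableTypeR R)]_(t in D) (f t)%:E)%E.
    by apply: eq_measure_integral => A mA _; exact/esym/lebesgue_measureN.
  have itg' : mu.-integrable ((-%R : measurableTypeR R -> measurableTypeR R) @^-1` D) ((EFin \o f) \o -%R).
    rewrite preD; have iN := integrableN itg.
    apply: (eq_integrable mD _ _ _ iN) => t /set_mem Dt; by rewrite /= oddf.
  rewrite (integral_pushforward mN mEf itg' mD).
  by rewrite preD; apply: eq_integral => t /set_mem Dt /=; rewrite oddf.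
have e2 : \int[mu]_(t in D) (- f t) = - \int[mu]_(t in D) f t.
  rewrite -[RHS]mulN1r -(RintegralZl (-1) mD itg).
  by apply: eq_Rintegral => t _; rewrite mulN1r.
by move/eqP: e; rewrite e2 -addr_eq0 -mulr2n mulrn_eq0/= => /eqP.
Qed.

Lemma rsum_odd (f : int -> R) : (forall n, f (- n) = - f n) -> rsum [set: int] f = 0.
Proof.
move=> oddf; have bij : set_bij [set: int] [set: int] (-%R : int -> int).
  split; [by []|by move=> m n _ _; exact: oppr_inj|].
  by move=> n _; exists (- n) => //; rewrite opprK.
have := reindex_rsum f bij; rewrite [RHS](eq_rsum (g := fun n => - f n)) ?rsumN; last by move=> n _; exact: oddf.
by lra.
Qed.

Lemma integrable_Rsum (I : Type) (r : seq I) (D : set R) (F : I -> R -> R) :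
  measurable (D : set (measurableTypeR R)) ->
  (forall i, mu.-integrable D (EFin \o F i)) ->
  mu.-integrable D (EFin \o (fun t => \sum_(i <- r) F i t)).
Proof.
move=> mD itg; elim: r => [|i r IH].
  rewrite (_ : (fun t => _) = fun=> 0); first exact: integrable0.
  by apply/funext => t; rewrite big_nil.
rewrite (_ : (fun t => _) = fun t => F i t + \sum_(j <- r) F j t).
  exact: (integrableD mD (itg i) IH).
by apply/funext => t; rewrite big_cons.
Qed.

Lemma Rintegral_sum (I : Type) (r : seq I) (D : set R) (F : I -> R -> R) :
  measurable (D : set (measurableTypeR R)) ->
  (forall i, mu.-integrable D (EFin \o F i)) ->
  \int[mu]_(t in D) (\sum_(i <- r) F i t) = \sum_(i <- r) \int[mu]_(t in D) F i t.
Proof.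
move=> mD itg; elim: r => [|i r IH].
  by under eq_Rintegral do rewrite big_nil; rewrite big_nil /Rintegral integral0.
under eq_Rintegral do rewrite big_cons.
by rewrite big_cons -IH (RintegralD mD (itg i) (integrable_Rsum r mD itg)).
Qed.

End odd_functions.

(** * Removal of the singularity at the origin *)

Section principal_value.
Context {R : realType}.
Implicit Types (b d e t : R).

Definition outside e : set R := [set t | e < `|t|].

Lemma setC_outside e : ~` outside e = `[- e, e]%classic.
Proof.
apply/seteqP; split => t; rewrite /outside /= in_itv/= -ler_norml.
  by move/negP; rewrite -leNgt.
by move=> h; apply/negP; rewrite -leNgt.
Qed.

Lemma measurable_outside e : measurable (outside e : set (measurableTypeR R)).
Proof. by rewrite -[outside e]setCK setC_outside; apply: measurableC; exact: measurable_itv. Qed.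

(** The removed interval has length [2 * e], so for a bounded integrand the principal value is the
    ordinary integral. *)
Lemma cvg_integral_outside (f : R -> R) (C : R) : measurable_fun [set: R] f -> integrableR f ->
  (forall t, `|f t| <= C) ->
  \int[mu]_(t in outside e) f t @[e --> (0 : R)^'+] --> intR f.
Proof.
move=> mf itg fC; have C0 : 0 <= C := le_trans (normr_ge0 _) (fC 0).
have near_e e : 0 < e -> `|intR f - \int[mu]_(t in outside e) f t| <= C * (2 * e).
  move=> e0; have mo := measurable_outside e.
  have -> : intR f = \int[mu]_(t in outside e) f t + \int[mu]_(t in ~` outside e) f t.
    have := @Rintegral_setU _ _ _ (@lebesgue_measure R) (outside e) (~` outside e) f mo (measurableC mo).
    by rewrite setUv; apply => //; exact/disj_setPCl.
  rewrite [X in X - _]addrC addrK setC_outside.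
  have -> : 2 * e = e - (- e) by ring.
  by apply: normr_Rintegral_itv => //; rewrite ge0_cp// ltW.
apply/cvgrPdist_le => /= r r0; near=> e.
have e0 : 0 < e by near: e; exact: nbhs_right_gt.
rewrite (le_trans (near_e e e0))//.
have : e <= r / (2 * (C + 1)).
  by near: e; apply: nbhs_right_le; rewrite divr_gt0// mulr_gt0// ltr_wpDl.
rewrite ler_pdivlMr ?mulr_gt0 ?ltr_wpDl// => h.
by have := ltW e0; nra.
Unshelve. all: by end_near. Qed.

(** The part of the zero-mode integrand without frequency: [expR (- t ^+ 2) * cos (b * t) - 1] is
    [expR (- t ^+ 2) * (cos (b * t) - 1)] plus [expR (- t ^+ 2) - 1]. At [t = 0] it is [0] by
    convention rather than its limit. *)
Definition gaussm1 t : R := (expR (- t ^+ 2) - 1) / t ^+ 2.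

Lemma normr_gaussm1 t : `|gaussm1 t| <= 2 * (1 + t ^+ 2)^-1.
Proof.
have [->|t0] := eqVneq t 0.
  by rewrite /gaussm1 expr0n/= invr0 mulr0 normr0 mulr_ge0 ?invr_ge0// addr0.
have t2 : 0 < t ^+ 2 by rewrite lt_def sqrf_eq0 t0 sqr_ge0.
have p := oneDsqr_gt0 t.
rewrite normrM normfV (gtr0_norm t2) ler_pdivrMr// mulrAC ler_pdivlMr//.
rewrite distrC ger0_norm ?subr_ge0 ?gauss_le1//.
have h1 := expR_ge1Dx (- t ^+ 2); have h2 := expR_ge0 (- t ^+ 2).
nra.
Qed.

Lemma normr_gaussm1_le2 t : `|gaussm1 t| <= 2.
Proof.
by rewrite (le_trans (normr_gaussm1 t))// ler_piMr// invf_le1 ?oneDsqr_gt0// oneDsqr_ge1.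
Qed.

Lemma measurable_gaussm1 : measurable_fun [set: R] gaussm1.
Proof.
apply: measurable_except0 => t t0.
apply: differentiable_continuous; apply/derivable1_diffP.
have d1 : is_derive t 1 (fun t : R => (t ^+ 2)^-1) (- (t ^+ 2) ^- 2 * (2%:R * t ^+ 1 * 1)).
  by apply: isder_inv; [rewrite sqrf_eq0|exact: isder_exp (isder_id t)].
have d2 := isder_mul (isder_add (isder_expR (isder_opp (isder_exp 1 (isder_id t)))) (isder_cst t (-1))) d1.
exact: ex_derive.
Qed.

Lemma integrable_gaussm1 : integrableR gaussm1.
Proof. exact: integrable_dominated measurable_gaussm1 normr_gaussm1. Qed.

Lemma normr_gauss_cosm1 b t : `|gauss_cosm1 b t| <= b ^+ 2.
Proof. by rewrite (le_trans (normr_gauss_cosm1_le b t))// ler_piMr ?sqr_ge0 ?gauss_le1. Qed.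

Lemma cvg_gauss_cosm1 b : gauss_cosm1 b t @[t --> (0 : R)^'] --> - (b ^+ 2 / 2).
Proof.
have c0 : 0 <= b ^+ 2 + b ^+ 4 by rewrite addr_ge0 ?sqr_ge0// exprn_even_ge0.
apply/cvgrPdist_le => /= r r0.
have s0 : 0 < r / (b ^+ 2 + b ^+ 4 + 1) by rewrite divr_gt0// ltr_wpDl.
near=> t.
have t0 : t != 0 by near: t; exact: nbhs_dnbhs_neq.
have t1 : `|t| <= 1.
  by near: t; apply: dnbhs0_le.
rewrite -opprD normrN addrC (le_trans (normr_gauss_cosm1D_le b t0))//.
have : `|t| <= r / (b ^+ 2 + b ^+ 4 + 1).
  by near: t; apply: dnbhs0_le.
rewrite ler_pdivlMr ?ltr_wpDl// => h.
have : t ^+ 2 <= `|t| by rewrite -[t ^+ 2]real_normK ?num_real// expr2 ler_piMr.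
by have := normr_ge0 t; nra.
Unshelve. all: by end_near. Qed.

(** The sine part alone has a singularity [b / t]. Subtracting the linear term removes it, and after
    summation over the charges neutrality makes this subtraction free of charge. The conventional
    value [0] at [t = 0] is the limit. *)
Definition gauss_sinB b t : R := expR (- t ^+ 2) * ((sin (b * t) - b * t) / t ^+ 2).

Lemma gauss_sinBN b t : gauss_sinB b (- t) = - gauss_sinB b t.
Proof. by rewrite /gauss_sinB sqrrN !mulrN sinN; ring. Qed.

Lemma gauss_sinB0 b : gauss_sinB b 0 = 0.
Proof. by rewrite /gauss_sinB expr0n/= invr0 !mulr0. Qed.

Lemma normr_gauss_sinB b t : `|gauss_sinB b t| <= `|b| ^+ 3 * (`|t| * expR (- t ^+ 2)).
Proof.
rewrite normrM (ger0_norm (expR_ge0 _)) mulrA [leRHS]mulrC ler_wpM2l ?expR_ge0//.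
have [->|t0] := eqVneq t 0; first by rewrite expr0n/= invr0 mulr0 !normr0 mulr0.
have t20 : 0 < t ^+ 2 by rewrite lt_def sqrf_eq0 t0 sqr_ge0.
rewrite normrM normfV (gtr0_norm t20) ler_pdivrMr// (le_trans (normr_sinBx_le _))//.
by rewrite normrM exprMn -[t ^+ 2]real_normK ?num_real// le_eqVlt; apply/orP; left; apply/eqP; ring.
Qed.

Lemma cvg_gauss_sinB b : gauss_sinB b t @[t --> (0 : R)^'] --> (0 : R).
Proof.
have b0 : 0 <= `|b| ^+ 3 by rewrite exprn_ge0.
apply/cvgrPdist_le => /= r r0.
have s0 : 0 < r / (`|b| ^+ 3 + 1) by rewrite divr_gt0// ltr_wpDl.
near=> t; rewrite sub0r normrN.
rewrite (le_trans (normr_gauss_sinB b t))//.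
have : `|t| <= r / (`|b| ^+ 3 + 1).
  by near: t; apply: dnbhs0_le.
rewrite ler_pdivlMr ?ltr_wpDl// => h.
have : `|b| ^+ 3 * (`|t| * expR (- t ^+ 2)) <= `|b| ^+ 3 * `|t|.
  by rewrite ler_wpM2l// ler_piMr// gauss_le1.
by have := normr_ge0 t; lra.
Unshelve. all: by end_near. Qed.

Lemma abs_summable_gauss_sinB b d : 0 < d ->
  abs_summable [set: int] (fun n : int => gauss_sinB b (n%:~R * d)).
Proof.
move=> d0; have d20 : 0 < d / 2 by rewrite divr_gt0.
apply: (abs_summable_le (abs_summableZ (`|b| ^+ 3) (abs_summable_gauss d20))) => n _.
rewrite (le_trans (normr_gauss_sinB b _))// ler_wpM2l ?exprn_ge0//.
set t := n%:~R * d; have -> : n%:~R * (d / 2) = t / 2 by rewrite mulrA.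
(* The factor [|t|] costs half of the exponent; the other half still dominates the Gaussian of mesh
   [d / 2]. *)
have h1 : `|t| <= expR (t ^+ 2 / 2).
  rewrite (le_trans _ (expR_ge1Dx _))// -[t ^+ 2]real_normK ?num_real//.
  by have := sqr_ge0 (`|t| - 1); nra.
rewrite (le_trans (ler_wpM2r (expR_ge0 _) h1))// -expRD ler_expR.
by have := sqr_ge0 t; nra.
Qed.

End principal_value.

(** * Images and the Fourier terms *)

Section vectors.
Context {R : realType}.

Lemma dot_vec3 (a b c a' b' c' : R) :
  dot (vec3 a b c) (vec3 a' b' c') = a * a' + b * b' + c * c'.
Proof. by rewrite /dot !big_ord_recl big_ord0 !mxE/= addr0 addrA. Qed.

Lemma scale_vec3 (s a b c : R) : s *: vec3 a b c = vec3 (s * a) (s * b) (s * c).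
Proof.
by apply/rowP => i; rewrite !mxE; case: i => [[|[|[|i]]]] //= hi; rewrite !(tnth_nth 0).
Qed.

Lemma sub_vec3 (a b c a' b' c' : R) :
  vec3 a b c - vec3 a' b' c' = vec3 (a - a') (b - b') (c - c').
Proof.
by apply/rowP => i; rewrite !mxE; case: i => [[|[|[|i]]]] //= hi; rewrite !(tnth_nth 0).
Qed.

Lemma enorm_vec3_sqr (a b c : R) : enorm (vec3 a b c) ^+ 2 = a ^+ 2 + b ^+ 2 + c ^+ 2.
Proof.
by rewrite /enorm sqr_sqrtr dot_vec3 -!expr2// !addr_ge0// sqr_ge0.
Qed.

End vectors.

Section lattice.
Context {R : realType} {N : nat} (S : sandwich R N).
Hypotheses (Lx_gt0 : 0 < Lx S) (Ly_gt0 : 0 < Ly S).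

Lemma hnorm_ge0 n : 0 <= hnorm S n.
Proof. exact: sqrtr_ge0. Qed.

Lemma hnorm_sqr n : hnorm S n ^+ 2 =
  (2 * pi * (n.1%:~R / Lx S)) ^+ 2 + (2 * pi * (n.2%:~R / Ly S)) ^+ 2.
Proof. by rewrite /hnorm /hvec scale_vec3 enorm_vec3_sqr mulr0 expr0n addr0. Qed.

Lemma hnorm0 : hnorm S (0, 0) = 0.
Proof.
by apply/eqP; rewrite -sqrf_eq0 hnorm_sqr/= !mul0r !mulr0 expr0n addr0.
Qed.

Definition hmin : R := 2 * pi / Num.max (Lx S) (Ly S).

Let Lmax_gt0 : 0 < Num.max (Lx S) (Ly S).
Proof. by rewrite lt_max Lx_gt0. Qed.

Lemma hmin_gt0 : 0 < hmin.
Proof. by rewrite divr_gt0// mulr_gt0// pi_gt0. Qed.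

Lemma hmin_le n : nonzero2 n -> hmin <= hnorm S n.
Proof.
have pi0 := pi_gt0 R.
have int1 (m : int) : m != 0 -> 1 <= `|m%:~R| :> R.
  by move=> m0; rewrite -intr_norm ler1z -gtz0_ge1 normr_gt0.
have one (m : int) (L : R) : 0 < L -> L <= Num.max (Lx S) (Ly S) -> m != 0 ->
    hmin ^+ 2 <= (2 * pi * (m%:~R / L)) ^+ 2.
  move=> L0 LL m0; rewrite -[leRHS]real_normK ?num_real// lerXn2r ?nnegrE ?(ltW hmin_gt0)//.
  rewrite normrM ger0_norm ?mulr_ge0 ?(ltW pi0)// ler_wpM2l ?mulr_ge0 ?(ltW pi0)//.
  rewrite normrM normfV (gtr0_norm L0) (le_trans _ (ler_wpM2r _ (int1 m m0))) ?invr_ge0 ?(ltW L0)//.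
  by rewrite mul1r lef_pV2 ?posrE.
move=> n0; rewrite -(@ler_pXn2r _ 2) ?nnegrE ?(ltW hmin_gt0) ?hnorm_ge0// hnorm_sqr.
case: n n0 => n1 n2; rewrite /nonzero2/= xpair_eqE negb_and => /orP[n0|n0].
  by rewrite (le_trans (one n1 (Lx S) Lx_gt0 _ n0)) ?le_max ?lexx// lerDl sqr_ge0.
by rewrite (le_trans (one n2 (Ly S) Ly_gt0 _ n0)) ?le_max ?lexx ?orbT// lerDr sqr_ge0.
Qed.

Lemma hnorm_gt0 n : nonzero2 n -> 0 < hnorm S n.
Proof. by move=> n0; rewrite (lt_le_trans hmin_gt0)// hmin_le. Qed.

(** A lower bound by a sum of one-dimensional terms lets [expR (- (s * hnorm S n))] be compared with
    a product of two summable families. *)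
Lemma hnorm_ge_l1 n : pi / Lx S * `|n.1%:~R| + pi / Ly S * `|n.2%:~R| <= hnorm S n.
Proof.
have pi0 := ltW (pi_gt0 R); have [x0 y0] := (ltW Lx_gt0, ltW Ly_gt0).
have u0 : 0 <= pi / Lx S * `|n.1%:~R| by rewrite mulr_ge0// divr_ge0.
have v0 : 0 <= pi / Ly S * `|n.2%:~R| by rewrite mulr_ge0// divr_ge0.
rewrite -(@ler_pXn2r _ 2) ?nnegrE ?hnorm_ge0 ?addr_ge0// hnorm_sqr.
set u := pi / Lx S * _ in u0 *; set v := pi / Ly S * _ in v0 *.
have -> : (2 * pi * (n.1%:~R / Lx S)) ^+ 2 = 4 * u ^+ 2.
  by rewrite /u !exprMn real_normK ?num_real//; ring.
have -> : (2 * pi * (n.2%:~R / Ly S)) ^+ 2 = 4 * v ^+ 2.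
  by rewrite /v !exprMn real_normK ?num_real//; ring.
by have := sqr_ge0 (u - v); nra.
Qed.

Lemma abs_summable_expR_hnorm (s : R) : 0 < s ->
  abs_summable [set: int * int] (fun n => expR (- (s * hnorm S n))).
Proof.
move=> s0; have pi0 := pi_gt0 R.
have c1 : 0 < s * (pi / Lx S) by rewrite mulr_gt0// divr_gt0.
have c2 : 0 < s * (pi / Ly S) by rewrite mulr_gt0// divr_gt0.
rewrite -setXTT.
apply: (abs_summable_le (abs_summable_prod (abs_summable_expR c1) (abs_summable_expR c2))) => n _.
rewrite ger0_norm ?expR_ge0// -expRD ler_expR -opprD lerN2 -!mulrA -mulrDr ler_wpM2l ?(ltW s0)//.
by rewrite !mulrA hnorm_ge_l1.
Qed.

End lattice.

Section images.
Context {R : realType} {N : nat} (S : sandwich R N).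

(* [(l, true)] and [(l, false)] stand for the upper and lower images of order [l]; the formulas for the
   upper images at [l = 0] give the charge itself, so that [(0, true)] stands for it. *)
Definition images (M : nat) : seq (nat * bool) :=
  (0%N, true) :: [seq (l, b) | l <- index_iota 1 M.+1, b <- [:: true; false]].

Definition image_factor (p : nat * bool) : R := if p.2 then gamma_p S p.1 else gamma_m S p.1.

Definition image_z (p : nat * bool) (j : 'I_N) : R := if p.2 then z_p S p.1 j else z_m S p.1 j.

Definition image_dist (i j : 'I_N) (p : nat * bool) : R := zpos S i - image_z p j.

Lemma sum_images (V : nmodType) (M : nat) (F : nat * bool -> V) :
  \sum_(p <- images M) F p =
  F (0%N, true) + \sum_(1 <= l < M.+1) (F (l, true) + F (l, false)).
Proof.
rewrite big_cons big_allpairs_dep; congr (_ + _).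
by apply: eq_bigr => l _; rewrite !big_cons big_nil /= addr0.
Qed.

Lemma image_factor0 : image_factor (0%N, true) = 1.
Proof. by rewrite /image_factor/= /gamma_p/= !expr0 mulr1. Qed.

Lemma image_z0 j : image_z (0%N, true) j = zpos S j.
Proof. by rewrite /image_z/= /z_p/= expr0 mul1r mulr0 mul0r addr0. Qed.

(** The upper image of order [l] lies in the layer between [l * H] and [(l + 1) * H], the lower one
    in the layer between [- l * H] and [(1 - l) * H]; the parity of [l] decides the orientation
    inside the layer. *)
Lemma normr_image_dist i j p : (forall i, 0 < zpos S i < height S) ->
  `|image_dist i j p| <= p.1.+1%:R * height S.
Proof.
move=> inside; have /andP[zi0 ziH] := inside i; have /andP[zj0 zjH] := inside j.
case: p => l b; rewrite /image_dist /image_z/=.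
have e : l%:R = (odd l)%:R + 2 * (l./2)%:R :> R.
  by rewrite -{1}(odd_double_half l) natrD -mul2n natrM.
have k0 : 0 <= (l./2)%:R * height S by rewrite mulr_ge0// (ltW (lt_trans zi0 ziH)).
have s : l.+1%:R = 1 + l%:R :> R by rewrite -[l.+1]add1n natrD.
have u : (uphalf l)%:R = (odd l)%:R + (l./2)%:R :> R by rewrite uphalf_half natrD.
rewrite s e /z_p /z_m u -signr_odd ler_norml.
by case: b; case: (odd l) => /=; rewrite ?expr0 ?expr1; apply/andP; split; nra.
Qed.

End images.

Lemma ReZ (R : realType) (r : R) (x : R[i]) : complex.Re (r%:C * x) = r * complex.Re x.
Proof. by rewrite Re_mul/= mul0r subr0. Qed.

Lemma ImZ (R : realType) (r : R) (x : R[i]) : complex.Im (r%:C * x) = r * complex.Im x.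
Proof. by rewrite Im_mul/= mul0r addr0. Qed.

(** * Fourier terms as finite sums over images of one-dimensional transforms *)

Section fourier_integrals.
Context {R : realType} {N : nat} (M : nat) (S : sandwich R N) (alpha : R).
Hypotheses (Lx_gt0 : 0 < Lx S) (Ly_gt0 : 0 < Ly S) (alpha_gt0 : 0 < alpha).

Local Notation im := (images M).
Local Notation g := (image_factor S).

Definition wavenum (n : int * int) : R := hnorm S n / (2 * alpha).

Definition freq (i j : 'I_N) (p : nat * bool) : R := 2 * alpha * image_dist S i j p.

Definition image_sum (F : nat * bool -> R) : R := \sum_(p <- im) g p * F p.

Let a2_gt0 : 0 < 2 * alpha. Proof. by rewrite mulr_gt0. Qed.

Lemma GammaME i j t :
  GammaM S M alpha i j t = \sum_(p <- im) (g p)%:C * expi (freq i j p * t).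
Proof.
rewrite sum_images image_factor0 mul1r /freq /image_dist image_z0; congr (_ + _).
by apply: eq_bigr => l _; congr (_ * expi _ + _ * expi _); rewrite mulrAC.
Qed.

Lemma Re_GammaM i j t :
  complex.Re (GammaM S M alpha i j t) = image_sum (fun p => cos (freq i j p * t)).
Proof. by rewrite GammaME Re_sum; apply: eq_bigr => p _; rewrite ReZ. Qed.

Lemma Im_GammaM i j t :
  complex.Im (GammaM S M alpha i j t) = image_sum (fun p => sin (freq i j p * t)).
Proof. by rewrite GammaME Im_sum; apply: eq_bigr => p _; rewrite ImZ. Qed.

Lemma wavenum_sqr n : wavenum n ^+ 2 = hnorm S n ^+ 2 / (4 * alpha ^+ 2).
Proof. by rewrite /wavenum expr_div_n exprMn -natrX. Qed.

Lemma wavenum_gt0 n : nonzero2 n -> 0 < wavenum n.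
Proof. by move=> n0; rewrite divr_gt0// hnorm_gt0. Qed.

Definition wavenum_min : R := hmin S / (2 * alpha).

Lemma wavenum_min_gt0 : 0 < wavenum_min.
Proof. by rewrite divr_gt0// hmin_gt0. Qed.

Lemma wavenum_min_le n : nonzero2 n -> wavenum_min <= wavenum n.
Proof. by move=> n0; rewrite ler_pM2r ?invr_gt0// hmin_le. Qed.

Lemma abs_summable_expR_wavenum :
  abs_summable [set: int * int] (fun n => expR (- wavenum n)).
Proof.
have i0 : 0 < (2 * alpha)^-1 by rewrite invr_gt0.
apply: eq_abs_summable (abs_summable_expR_hnorm Lx_gt0 Ly_gt0 i0) => n _.
by rewrite /wavenum mulrC.
Qed.

Lemma fourier_integrandE i j n t : fourier_integrand S M alpha i j n t =
  (screened (wavenum n) t)%:C * GammaM S M alpha i j t.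
Proof. by rewrite /fourier_integrand /screened wavenum_sqr. Qed.

Lemma Re_fourier_integrand i j n t : complex.Re (fourier_integrand S M alpha i j n t) =
  image_sum (fun p => screened_cos (wavenum n) (freq i j p) t).
Proof.
rewrite fourier_integrandE ReZ Re_GammaM mulr_sumr.
by apply: eq_bigr => p _; rewrite mulrCA.
Qed.

Lemma Im_fourier_integrand i j n t : complex.Im (fourier_integrand S M alpha i j n t) =
  image_sum (fun p => screened (wavenum n) t * sin (freq i j p * t)).
Proof.
rewrite fourier_integrandE ImZ Im_GammaM mulr_sumr.
by apply: eq_bigr => p _; rewrite mulrCA.
Qed.

Lemma integrable_screened_sin (a b : R) : 0 < a ->
  integrableR (fun t => screened a t * sin (b * t)).
Proof.
move=> a0; have c0 : 0 <= expR (- a ^+ 2) * a ^- 2.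
  by rewrite mulr_ge0 ?expR_ge0// invr_ge0 sqr_ge0.
apply: (@integrable_dominated _ _ (expR (- a ^+ 2) * a ^- 2 * 4)).
  have -> : (fun t => screened a t * sin (b * t)) =
      (fun t => screened_cos a 0 t * sin (b * t)).
    by apply/funext => t; rewrite /screened_cos mul0r cos0 mulr1.
  apply: measurable_funM; first exact: measurable_screened_cos.
  exact: (measurable_of_continuous (@continuous_sinM _ b)).
move=> t; rewrite normrM (@le_trans _ _ (screened a t))//.
  rewrite (ger0_norm (screened_ge0 _ _)) ler_piMr ?screened_ge0//.
  by rewrite ler_norml sin_geN1 sin_le1.
rewrite (le_trans (screened_le t a0))// -[leRHS]mulrA ler_wpM2l//.
exact: gauss_le_oneDsqrV.
Qed.

Lemma screened_sinN (a b t : R) : screened a (- t) * sin (b * - t) = - (screened a t * sin (b * t)).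
Proof. by rewrite /screened sqrrN mulrN sinN mulrN. Qed.

Lemma cintegrable_fourier_integrand i j n : nonzero2 n ->
  cintegrable [set: R] (fourier_integrand S M alpha i j n).
Proof.
move=> n0; have a0 := wavenum_gt0 n0; split.
  under eq_fun do rewrite Re_fourier_integrand.
  apply: integrable_Rsum => // p.
  exact: (integrableZl measurableT (g p) (integrable_screened_cos _ a0)).
under eq_fun do rewrite Im_fourier_integrand.
apply: integrable_Rsum => // p.
exact: (integrableZl measurableT (g p) (integrable_screened_sin _ a0)).
Qed.

Lemma image_sumN (F : nat * bool -> R) : image_sum (fun p => - F p) = - image_sum F.
Proof. by rewrite /image_sum -sumrN; apply: eq_bigr => p _; rewrite mulrN. Qed.

Lemma cintegral_fourier_integrand i j n : nonzero2 n ->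
  cintegral [set: R] (fourier_integrand S M alpha i j n) =
  (image_sum (fun p => screened_fourier (wavenum n) (freq i j p)))%:C.
Proof.
move=> n0; have a0 := wavenum_gt0 n0; have [iR iI] := cintegrable_fourier_integrand i j n0.
apply: eq_complexP => /=.
  under eq_Rintegral do rewrite Re_fourier_integrand.
  rewrite Rintegral_sum//; last first.
    by move=> p; exact: (integrableZl measurableT (g p) (integrable_screened_cos _ a0)).
  apply: eq_bigr => p _.
  exact: (RintegralZl (g p) measurableT (integrable_screened_cos _ a0)).
apply: Rintegral_odd => //.
  by apply/measurable_EFinP; exact: (measurable_int _ iI).
move=> t _; rewrite !Im_fourier_integrand -image_sumN.
by apply: eq_bigr => p _; rewrite screened_sinN.
Qed.

Lemma normr_screened_fourier (a b : R) : 0 < a ->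
  `|screened_fourier a b| <= expR (- a ^+ 2) * a ^- 2 * (4 * intR (fun t : R => (1 + t ^+ 2)^-1)).
Proof.
move=> a0; have c0 : 0 <= expR (- a ^+ 2) * a ^- 2.
  by rewrite mulr_ge0 ?expR_ge0// invr_ge0 sqr_ge0.
rewrite mulrA; apply: normr_integral_dominated; first exact: measurable_screened_cos.
move=> t; rewrite (le_trans (normr_screened_cos_le b t a0))// -[leRHS]mulrA ler_wpM2l//.
exact: gauss_le_oneDsqrV.
Qed.

Definition abs_image_sum : R := \sum_(p <- im) `|g p|.

Lemma abs_image_sum_ge0 : 0 <= abs_image_sum.
Proof. exact: sumr_ge0. Qed.

Lemma normr_image_sum (F : nat * bool -> R) (C : R) : (forall p, `|F p| <= C) ->
  `|image_sum F| <= abs_image_sum * C.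
Proof.
move=> FC; rewrite (le_trans (ler_norm_sum _ _ _))// mulr_suml.
by apply: ler_sum => p _; rewrite normrM ler_wpM2l.
Qed.

(* [a^2 >= a - 1] *)
Lemma gauss_wavenum_le n : nonzero2 n ->
  expR (- wavenum n ^+ 2) * (wavenum n) ^- 2 <= wavenum_min ^- 2 * expR 1 * expR (- wavenum n).
Proof.
move=> n0; have m0 := wavenum_min_gt0; have mn := wavenum_min_le n0.
have a0 := wavenum_gt0 n0.
rewrite mulrC -mulrA ler_pM ?expR_ge0 ?invr_ge0 ?sqr_ge0//.
  by rewrite lef_pV2 ?posrE ?exprn_gt0// lerXn2r// nnegrE ltW.
by rewrite -expRD ler_expR; have := sqr_ge0 (wavenum n - 1); nra.
Qed.

Lemma csummable_fourier_term i j : csummable nonzero2 (fourier_term S M alpha i j).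
Proof.
pose C := abs_image_sum * (wavenum_min ^- 2 * expR 1 * (4 * intR (fun t : R => (1 + t ^+ 2)^-1))).
have I0 : 0 <= intR (fun t : R => (1 + t ^+ 2)^-1).
  by apply: Rintegral_ge0 => t _; rewrite invr_ge0 ltW// oneDsqr_gt0.
have s : abs_summable nonzero2 (fun n => C * expR (- wavenum n)).
  exact: abs_summableS (abs_summableZ C abs_summable_expR_wavenum).
apply: (csummable_le s) => n n0.
rewrite normcM normc_expi mul1r cintegral_fourier_integrand// normcR.
have b p := normr_screened_fourier (freq i j p) (wavenum_gt0 n0).
rewrite (le_trans (normr_image_sum b))// /C -[leRHS]mulrA ler_wpM2l ?abs_image_sum_ge0//.
rewrite [leRHS]mulrAC ler_wpM2r ?mulr_ge0//; exact: gauss_wavenum_le.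
Qed.

End fourier_integrals.

(** * The zero mode *)

Lemma abs_summable_sum (R : realType) (T : choiceType) (D : set T) (I : Type) (r : seq I)
    (F : I -> T -> R) : (forall i, abs_summable D (F i)) ->
  abs_summable D (fun t => \sum_(i <- r) F i t).
Proof.
move=> sF; elim: r => [|i r IH].
  apply: (abs_summable_le (g := fun=> 0)); last by move=> t _; rewrite big_nil normr0.
  by rewrite /abs_summable /summable esum1// => t _; rewrite abse0.
by apply: eq_abs_summable (abs_summableD (sF i) IH) => t _; rewrite big_cons.
Qed.

Lemma rsum_sum (R : realType) (T : choiceType) (D : set T) (I : Type) (r : seq I)
    (F : I -> T -> R) : (forall i, abs_summable D (F i)) ->
  rsum D (fun t => \sum_(i <- r) F i t) = \sum_(i <- r) rsum D (F i).
Proof.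
move=> sF; elim: r => [|i r IH].
  rewrite big_nil (eq_rsum (g := fun=> 0)); last by move=> t _; rewrite big_nil.
  by rewrite /rsum oppr0 subrr.
rewrite big_cons -IH -rsumD//; last exact: abs_summable_sum.
by apply: eq_rsum => t _; rewrite big_cons.
Qed.

Section zero_mode.
Context {R : realType} {N : nat} (M : nat) (S : sandwich R N) (alpha : R).
Hypotheses (alpha_gt0 : 0 < alpha) (neutral : \sum_i charges S i = 0).

Local Notation im := (images M).
Local Notation g := (image_factor S).
Local Notation q := (charges S).
Local Notation b := (freq S alpha).
Local Notation isum := (@image_sum _ _ M S).

Definition pair_sum (F : 'I_N -> 'I_N -> R) : R := \sum_i \sum_j q i * q j * F i j.

Lemma eq_pair_sum (F G : 'I_N -> 'I_N -> R) : (forall i j, F i j = G i j) ->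
  pair_sum F = pair_sum G.
Proof. by move=> FG; apply: eq_bigr => i _; apply: eq_bigr => j _; rewrite FG. Qed.

Lemma pair_sumD (F G : 'I_N -> 'I_N -> R) :
  pair_sum (fun i j => F i j + G i j) = pair_sum F + pair_sum G.
Proof.
rewrite /pair_sum -big_split/=; apply: eq_bigr => i _; rewrite -big_split/=.
by apply: eq_bigr => j _; rewrite mulrDr.
Qed.

Lemma pair_sumZ (c : R) (F : 'I_N -> 'I_N -> R) :
  pair_sum (fun i j => c * F i j) = c * pair_sum F.
Proof.
rewrite /pair_sum mulr_sumr; apply: eq_bigr => i _; rewrite mulr_sumr.
by apply: eq_bigr => j _; rewrite mulrCA.
Qed.

Lemma pair_sum_prod (u v : 'I_N -> R) :
  pair_sum (fun i j => u i * v j) = (\sum_i q i * u i) * (\sum_j q j * v j).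
Proof.
rewrite mulr_suml; apply: eq_bigr => i _; rewrite mulr_sumr.
by apply: eq_bigr => j _; rewrite mulrACA.
Qed.

(** Neutrality kills whatever depends on one of the two charges only; the cancellations in the zero
    mode reduce to this lemma and the next. *)
Lemma pair_sum_left (u : 'I_N -> R) : pair_sum (fun i _ => u i) = 0.
Proof.
rewrite (eq_pair_sum (G := fun i j => u i * 1)); last by move=> i j; rewrite mulr1.
by rewrite (pair_sum_prod u (fun=> 1)) -mulr_suml neutral mul0r mulr0.
Qed.

Lemma pair_sum_right (v : 'I_N -> R) : pair_sum (fun _ j => v j) = 0.
Proof.
rewrite (eq_pair_sum (G := fun i j => 1 * v j)); last by move=> i j; rewrite mul1r.
by rewrite (pair_sum_prod (fun=> 1)) -mulr_suml neutral !mul0r.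
Qed.

Lemma realC_pair_sum (F : 'I_N -> 'I_N -> R) :
  \sum_i \sum_j (q i * q j)%:C * (F i j)%:C = (pair_sum F)%:C.
Proof.
rewrite realC_sum; apply: eq_bigr => i _; rewrite realC_sum; apply: eq_bigr => j _.
by rewrite [RHS]realCM.
Qed.

Lemma image_sumD (F G : nat * bool -> R) :
  isum (fun p => F p + G p) = isum F + isum G.
Proof. by rewrite /image_sum -big_split; apply: eq_bigr => p _; rewrite mulrDr. Qed.

Lemma image_sumZ (c : R) (F : nat * bool -> R) :
  isum (fun p => c * F p) = c * isum F.
Proof. by rewrite /image_sum mulr_sumr; apply: eq_bigr => p _; rewrite mulrCA. Qed.

Lemma eq_image_sum (F G : nat * bool -> R) : (forall p, F p = G p) ->
  isum F = isum G.
Proof. by move=> FG; apply: eq_bigr => p _; rewrite FG. Qed.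

Definition image_moment (j : 'I_N) : R := isum (fun p => image_z S p j).

Definition image_charge : R := isum (fun=> 1).

Lemma pair_sum_freq : pair_sum (fun i j => isum (b i j)) = 0.
Proof.
rewrite (eq_pair_sum (G := fun i j => 2 * alpha * (zpos S i * image_charge) +
    - (2 * alpha) * image_moment j)).
  by rewrite pair_sumD pair_sum_left (pair_sum_right (fun j => _ * _)) addr0.
move=> i j; rewrite /image_charge /image_moment -!image_sumZ -image_sumD.
by apply: eq_image_sum => p; rewrite /freq /image_dist; ring.
Qed.

(** Expanding the square of [z_i - z_p], the two pure squares depend on one charge only and drop
    out. The cross term is the product of dipole moments that appears in [U_IBC]. *)
Lemma pair_sum_freq_sqr : pair_sum (fun i j => isum (fun p => - (b i j p ^+ 2 / 2))) =
  4 * alpha ^+ 2 * ((\sum_i q i * zpos S i) * (\sum_j q j * image_moment j)).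
Proof.
rewrite -(pair_sum_prod (zpos S)) -pair_sumZ.
pose A i := - (2 * alpha ^+ 2 * zpos S i ^+ 2) * image_charge.
pose B j := isum (fun p => - (2 * alpha ^+ 2 * image_z S p j ^+ 2)).
rewrite (eq_pair_sum (G := fun i j => 4 * alpha ^+ 2 * (zpos S i * image_moment j) + (A i + B j))).
  by rewrite pair_sumD pair_sumD (pair_sum_left A) (pair_sum_right B) !addr0.
move=> i j; rewrite /A /B /image_charge /image_moment -!image_sumZ -!image_sumD.
by apply: eq_image_sum => p; rewrite /freq /image_dist; field.
Qed.

Lemma GammaM0 i j : GammaM S M alpha i j 0 = image_charge%:C.
Proof.
apply: eq_complexP; first by rewrite Re_GammaM; apply: eq_image_sum => p; rewrite mulr0 cos0.
rewrite Im_GammaM /= /image_sum big1// => p _; by rewrite mulr0 sin0 mulr0.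
Qed.

Lemma Re_J0_integrand i j t : t != 0 -> complex.Re (J0_integrand S M alpha i j t) =
  isum (fun p => gauss_cosm1 (b i j p) t) + image_charge * gaussm1 t.
Proof.
move=> t0; rewrite /J0_integrand -realC_inv mulrC ReZ GammaM0 Re_add ReZ Re_opp Re_GammaM /=.
rewrite /image_charge -image_sumZ mulrBr -!image_sumZ [X in _ = _ + X]mulrC -image_sumZ -image_sumD.
rewrite -image_sumN -image_sumD.
apply: eq_image_sum => p; rewrite /gauss_cosm1 /cosm1 /gaussm1 (negbTE t0).
by field.
Qed.

Lemma Im_J0_integrand i j t : complex.Im (J0_integrand S M alpha i j t) =
  isum (fun p => expR (- t ^+ 2) * (sin (b i j p * t) / t ^+ 2)).
Proof.
rewrite /J0_integrand -realC_inv mulrC ImZ GammaM0 Im_add ImZ Im_opp Im_GammaM /= oppr0 addr0.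
rewrite -!image_sumZ; apply: eq_image_sum => p; ring.
Qed.

Lemma measurable_gauss_sin (c : R) :
  measurable_fun [set: R] (fun t : R => expR (- t ^+ 2) * (sin (c * t) / t ^+ 2)).
Proof.
apply: measurable_funM; first exact: (measurable_of_continuous continuous_gauss_fun).
apply: measurable_funM; first exact: (measurable_of_continuous (@continuous_sinM _ c)).
apply: (measurableT_comp (@measurable_invr R)).
exact: (measurable_of_continuous (@exprn_continuous _ 2)).
Qed.

Lemma integrable_gauss_sin_outside (c e : R) : 0 < e ->
  mu.-integrable (outside e) (EFin \o (fun t => expR (- t ^+ 2) * (sin (c * t) / t ^+ 2))).
Proof.
move=> e0; have mo := measurable_outside e.
have mf := measurable_gauss_sin c.
have ig : mu.-integrable (outside e) (EFin \o (fun t => e ^- 2 * (expR (- t ^+ 2) * cos (0 * t)))).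
  apply: integrableS (integrableZl measurableT (e ^- 2) (integrable_gauss_cos 0)) => //.
apply: le_integrable ig => //; first by apply/measurable_EFinP; exact: measurable_funTS.
move=> t te; rewrite !abse_EFin lee_fin mul0r cos0 mulr1 normrM [leRHS]ger0_norm; last first.
  by rewrite mulr_ge0 ?expR_ge0// invr_ge0 sqr_ge0.
rewrite (ger0_norm (expR_ge0 _)) mulrC ler_wpM2r ?expR_ge0//.
have t0 : 0 < `|t| by rewrite (lt_trans e0).
have s1 : `|sin (c * t)| <= 1 by rewrite ler_norml sin_geN1 sin_le1.
rewrite normrM normfV normrX (le_trans (ler_piMl _ s1)) ?invr_ge0 ?sqr_ge0//.
by rewrite lef_pV2 ?posrE ?exprn_gt0// lerXn2r ?nnegrE// ltW.
Qed.

Let realJ0 i j t := isum (fun p => gauss_cosm1 (b i j p) t) + image_charge * gaussm1 t.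

Let integrable_image i j p : integrableR (fun t => g p * gauss_cosm1 (b i j p) t).
Proof. exact: (integrableZl measurableT (g p) (integrable_cosm1 (b i j p))). Qed.

Let integrable_realJ0 i j : integrableR (realJ0 i j).
Proof.
apply: (@integrableD _ _ _ mu setT measurableT (EFin \o (fun t => _)) (EFin \o (fun t => _))).
  by apply: integrable_Rsum => // p; exact: integrable_image.
exact: (integrableZl measurableT image_charge integrable_gaussm1).
Qed.

Let normr_realJ0 i j t : `|realJ0 i j t| <=
  \sum_(p <- im) `|g p| * b i j p ^+ 2 + `|image_charge| * 2.
Proof.
rewrite (le_trans (ler_normD _ _))// lerD//.
  rewrite (le_trans (ler_norm_sum _ _ _))//; apply: ler_sum => p _.
  by rewrite normrM ler_wpM2l// normr_gauss_cosm1.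
by rewrite normrM ler_wpM2l// normr_gaussm1_le2.
Qed.

Let outside_neq0 (e t : R) : 0 < e -> outside e t -> t != 0.
Proof. by move=> e0 /= te; rewrite -normr_gt0 (lt_trans e0). Qed.

Let J0_limit i j := isum (fun p => unscreened_fourier (b i j p)) + image_charge * intR gaussm1.

Let integral_realJ0 i j : intR (realJ0 i j) = J0_limit i j.
Proof.
rewrite (@RintegralD _ _ _ mu setT (fun t => _) (fun t => _)) => //; last 2 first.
- by apply: integrable_Rsum => // p; exact: integrable_image.
- exact: (integrableZl measurableT image_charge integrable_gaussm1).
rewrite (RintegralZl image_charge measurableT integrable_gaussm1) Rintegral_sum//.
by congr (_ + _); apply: eq_bigr => p _; exact: (RintegralZl (g p) measurableT (integrable_cosm1 (b i j p))).
Qed.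

Let symmetric_outside (e t : R) : outside e t -> outside e (- t).
Proof. by rewrite /outside/= normrN. Qed.

Let integrable_imJ0 i j e : 0 < e ->
  mu.-integrable (outside e) (EFin \o (fun t => complex.Im (J0_integrand S M alpha i j t))).
Proof.
move=> e0; under eq_fun do rewrite Im_J0_integrand.
apply: integrable_Rsum => [|p]; first exact: measurable_outside.
exact: (integrableZl (measurable_outside e) (g p) (integrable_gauss_sin_outside _ e0)).
Qed.

Let cintegral_J0 i j e : 0 < e ->
  cintegral (outside e) (J0_integrand S M alpha i j) = (\int[mu]_(t in outside e) realJ0 i j t)%:C.
Proof.
move=> e0; apply: eq_complexP => /=.
  by apply: eq_Rintegral => t /set_mem te; rewrite Re_J0_integrand// (outside_neq0 e0 te).
apply: (Rintegral_odd (measurable_outside e) (@symmetric_outside e) _ (integrable_imJ0 i j e0)).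
  under eq_fun do rewrite Im_J0_integrand.
  apply: measurable_sum => p; apply: measurable_funM => //; exact: measurable_gauss_sin.
move=> t _; rewrite !Im_J0_integrand -image_sumN; apply: eq_image_sum => p.
by rewrite sqrrN mulrN sinN; ring.
Qed.

Let cvg_J0 i j : \int[mu]_(t in outside e) realJ0 i j t @[e --> (0 : R)^'+] --> J0_limit i j.
Proof.
rewrite -integral_realJ0; have iJ := integrable_realJ0 i j.
apply: (cvg_integral_outside _ iJ (normr_realJ0 i j)).
by apply/measurable_EFinP; exact: (measurable_int _ iJ).
Qed.

Let cvg_Re_J0 i j :
  (complex.Re (cintegral (outside e) (J0_integrand S M alpha i j)) : R) @[e --> (0 : R)^'+] -->
  J0_limit i j.
Proof.
have := @cvg_J0 i j; apply: cvg_trans; apply: near_eq_cvg; near=> e.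
by rewrite cintegral_J0.
Unshelve. all: by end_near. Qed.

Let cvg_Im_J0 i j :
  (complex.Im (cintegral (outside e) (J0_integrand S M alpha i j)) : R) @[e --> (0 : R)^'+] -->
  (0 : R).
Proof.
have : (fun _ : R => 0 : R) @ (0 : R)^'+ --> (0 : R) by exact: cvg_cst.
apply: cvg_trans; apply: near_eq_cvg; near=> e.
by rewrite cintegral_J0.
Unshelve. all: by end_near. Qed.

Lemma pv_integrable_J0 i j : pv_integrable (J0_integrand S M alpha i j).
Proof.
split=> [e e0|]; last first.
  by split; apply/cvg_ex; [exists (J0_limit i j); exact: cvg_Re_J0|exists (0 : R); exact: cvg_Im_J0].
split; last exact: integrable_imJ0.
apply: (eq_integrable (measurable_outside e) _ _ _ (integrableS _ _ _ (integrable_realJ0 i j))) => //.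
- by move=> t /set_mem te; rewrite /= Re_J0_integrand// (outside_neq0 e0 te).
- exact: measurable_outside.
Qed.

Lemma J0E : J0 S M alpha = (1 / (2 * alpha * Lx S * Ly S) *
  pair_sum (fun i j => isum (fun p => unscreened_fourier (b i j p))))%:C.
Proof.
rewrite /J0 [RHS]realCM; congr (_ * _).
rewrite (eq_bigr (fun i => \sum_j (q i * q j)%:C * (J0_limit i j)%:C)); last first.
  move=> i _; apply: eq_bigr => j _; congr (_ * _); apply: eq_complexP => /=.
    exact: (cvg_lim (@Rhausdorff R) (@cvg_Re_J0 i j)).
  exact: (cvg_lim (@Rhausdorff R) (@cvg_Im_J0 i j)).
by rewrite realC_pair_sum /J0_limit pair_sumD pair_sum_left addr0.
Qed.

Lemma Re_J0_total t : t != 0 -> complex.Re (J0_total_integrand S M alpha t) =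
  pair_sum (fun i j => isum (fun p => gauss_cosm1 (b i j p) t)).
Proof.
move=> t0; rewrite -[RHS]addr0 -(pair_sum_left (fun=> image_charge * gaussm1 t)) -pair_sumD.
rewrite /J0_total_integrand Re_sum; apply: eq_bigr => i _; rewrite Re_sum; apply: eq_bigr => j _.
by rewrite ReZ Re_J0_integrand.
Qed.

Lemma Im_J0_total t : complex.Im (J0_total_integrand S M alpha t) =
  pair_sum (fun i j => isum (fun p => gauss_sinB (b i j p) t)).
Proof.
(* Adds a multiple of the sum of all frequencies, which is zero by [pair_sum_freq]; this restores
   the linear term subtracted in [gauss_sinB]. *)
rewrite -[RHS]addr0 -[X in _ + X](mulr0 (expR (- t ^+ 2) * t / t ^+ 2)) -pair_sum_freq -pair_sumZ -pair_sumD.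
rewrite /J0_total_integrand Im_sum; apply: eq_bigr => i _; rewrite Im_sum; apply: eq_bigr => j _.
rewrite [LHS]ImZ Im_J0_integrand -[X in _ * (_ + X)]image_sumZ -[X in _ = _ * X]image_sumD; congr (_ * _).
by apply: eq_image_sum => p; rewrite /gauss_sinB; ring.
Qed.

Let cvg_sum (I : Type) (r : seq I) (F : I -> R -> R) (l : I -> R) :
  (forall i, F i t @[t --> (0 : R)^'] --> l i) ->
  \sum_(i <- r) F i t @[t --> (0 : R)^'] --> \sum_(i <- r) l i.
Proof.
move=> Fl; elim: r => [|i r IH].
  by under eq_fun do rewrite big_nil; rewrite big_nil; exact: cvg_cst.
by under eq_fun do rewrite big_cons; rewrite big_cons; apply: cvgD.
Qed.

Lemma cvg_pair_sum (F : 'I_N -> 'I_N -> nat * bool -> R -> R) (l : 'I_N -> 'I_N -> nat * bool -> R) :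
  (forall i j p, F i j p t @[t --> (0 : R)^'] --> l i j p) ->
  pair_sum (fun i j => isum (fun p => F i j p t)) @[t --> (0 : R)^'] -->
  pair_sum (fun i j => isum (l i j)).
Proof.
move=> Fl; apply: cvg_sum => i; apply: cvg_sum => j; apply: cvgMr; apply: cvg_sum => p.
by apply: cvgMr.
Qed.

Let cvg_Re_J0_total : (complex.Re (J0_total_integrand S M alpha t) : R) @[t --> (0 : R)^'] -->
  pair_sum (fun i j => isum (fun p => gauss_cosm1 (b i j p) 0)).
Proof.
have c i j p : gauss_cosm1 (b i j p) t @[t --> (0 : R)^'] --> gauss_cosm1 (b i j p) 0.
  by rewrite [X in _ --> X]gauss_cosm1_0; exact: cvg_gauss_cosm1.
have := cvg_pair_sum c; apply: cvg_trans; apply: near_eq_cvg; near=> t.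
by rewrite Re_J0_total//; near: t; exact: nbhs_dnbhs_neq.
Unshelve. all: by end_near. Qed.

Let cvg_Im_J0_total : (complex.Im (J0_total_integrand S M alpha t) : R) @[t --> (0 : R)^'] -->
  pair_sum (fun i j => isum (fun p => gauss_sinB (b i j p) 0)).
Proof.
have c i j p : gauss_sinB (b i j p) t @[t --> (0 : R)^'] --> gauss_sinB (b i j p) 0.
  by rewrite gauss_sinB0; exact: cvg_gauss_sinB.
by under eq_fun do rewrite Im_J0_total; exact: cvg_pair_sum.
Qed.

Lemma ccvg_J0_total : ccvg (0 : R)^' (J0_total_integrand S M alpha).
Proof. by split; apply/cvg_ex; eexists; [exact: cvg_Re_J0_total|exact: cvg_Im_J0_total]. Qed.

(** The same formula covers [t = 0] because [gauss_cosm1] and [gauss_sinB] take their limits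
    there. *)
Lemma extend0_J0_total t : extend0 (J0_total_integrand S M alpha) t =
  pair_sum (fun i j => isum (fun p => gauss_cosm1 (b i j p) t)) +i*
  pair_sum (fun i j => isum (fun p => gauss_sinB (b i j p) t)).
Proof.
rewrite /extend0; case: eqP => [->|/eqP t0].
  apply: eq_complexP; [exact: (cvg_lim (@Rhausdorff R) cvg_Re_J0_total)|].
  exact: (cvg_lim (@Rhausdorff R) cvg_Im_J0_total).
by apply: eq_complexP; [rewrite Re_J0_total|rewrite Im_J0_total].
Qed.

Lemma extend0_J0_total0 : extend0 (J0_total_integrand S M alpha) 0 =
  (4 * alpha ^+ 2 * ((\sum_i q i * zpos S i) * (\sum_j q j * image_moment j)))%:C.
Proof.
rewrite extend0_J0_total -pair_sum_freq_sqr; apply: eq_complexP => /=.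
  by apply: eq_pair_sum => i j; apply: eq_image_sum => p; rewrite gauss_cosm1_0.
rewrite (eq_pair_sum (G := fun i j => 0 * isum (b i j))) ?pair_sumZ ?mul0r// => i j.
by rewrite -image_sumZ; apply: eq_image_sum => p; rewrite gauss_sinB0 mul0r.
Qed.

Lemma abs_summable_pair_sum (T : choiceType) (D : set T) (F : 'I_N -> 'I_N -> nat * bool -> T -> R) :
  (forall i j p, abs_summable D (F i j p)) ->
  abs_summable D (fun t => pair_sum (fun i j => isum (fun p => F i j p t))).
Proof.
move=> sF; apply: abs_summable_sum => i; apply: abs_summable_sum => j; apply: abs_summableZ.
by apply: abs_summable_sum => p; apply: abs_summableZ.
Qed.

Lemma rsum_image_sum (T : choiceType) (D : set T) (F : nat * bool -> T -> R) :
  (forall p, abs_summable D (F p)) ->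
  rsum D (fun t => isum (fun p => F p t)) = isum (fun p => rsum D (F p)).
Proof.
move=> sF; rewrite rsum_sum => [|p]; last exact: abs_summableZ.
by apply: eq_bigr => p _; rewrite rsumZ.
Qed.

Lemma rsum_pair_sum (T : choiceType) (D : set T) (F : 'I_N -> 'I_N -> nat * bool -> T -> R) :
  (forall i j p, abs_summable D (F i j p)) ->
  rsum D (fun t => pair_sum (fun i j => isum (fun p => F i j p t))) =
  pair_sum (fun i j => isum (fun p => rsum D (F i j p))).
Proof.
move=> sF; have s i j : abs_summable D (fun t => isum (fun p => F i j p t)).
  by apply: abs_summable_sum => p; apply: abs_summableZ.
rewrite rsum_sum => [|i]; last by apply: abs_summable_sum => j; exact: abs_summableZ.
apply: eq_bigr => i _; rewrite rsum_sum => [|j]; last exact: abs_summableZ.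
by apply: eq_bigr => j _; rewrite rsumZ// rsum_image_sum.
Qed.

Section trapezoidal_rule.
Variable d : R.
Hypothesis d_gt0 : 0 < d.

Lemma trapezoid_summable_J0 : trapezoid_summable d (extend0 (J0_total_integrand S M alpha)).
Proof.
apply/csummableP; split; under eq_fun do rewrite extend0_J0_total /=.
  apply: (abs_summable_pair_sum (F := fun i j p (n : int) => gauss_cosm1 (b i j p) (n%:~R * d))) => i j p.
  exact: abs_summable_gauss_cosm1.
apply: (abs_summable_pair_sum (F := fun i j p (n : int) => gauss_sinB (b i j p) (n%:~R * d))) => i j p.
exact: abs_summable_gauss_sinB.
Qed.

Lemma trapezoid_J0 : trapezoid d (extend0 (J0_total_integrand S M alpha)) =
  (pair_sum (fun i j => isum (fun p =>
     d * rsum [set: int] (fun n : int => gauss_cosm1 (b i j p) (n%:~R * d)))))%:C.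
Proof.
rewrite /trapezoid; have -> : csum [set: int]
    (fun n : int => extend0 (J0_total_integrand S M alpha) (n%:~R * d)) =
  (pair_sum (fun i j => isum (fun p =>
     rsum [set: int] (fun n : int => gauss_cosm1 (b i j p) (n%:~R * d)))))%:C.
  apply: eq_complexP => /=; under eq_fun do rewrite extend0_J0_total /=.
    by rewrite rsum_pair_sum// => i j p; exact: abs_summable_gauss_cosm1.
  rewrite rsum_pair_sum => [|i j p]; last exact: abs_summable_gauss_sinB.
  rewrite (eq_pair_sum (G := fun i j => 0 * isum (b i j))) ?pair_sumZ ?mul0r// => i j.
  rewrite -image_sumZ; apply: eq_image_sum => p; rewrite rsum_odd ?mul0r// => n.
  by rewrite rmorphN mulNr gauss_sinBN.
rewrite -realCM -pair_sumZ; congr (_ %:C); apply: eq_pair_sum => i j; by rewrite -image_sumZ.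
Qed.

End trapezoidal_rule.

End zero_mode.

(** * The reciprocal sum *)

Section reciprocal_sum.
Context {R : realType} {N : nat} (M : nat) (S : sandwich R N) (alpha Lz : R).
Hypotheses (Lx_gt0 : 0 < Lx S) (Ly_gt0 : 0 < Ly S) (Lz_gt0 : 0 < Lz) (alpha_gt0 : 0 < alpha).
Hypothesis neutral : \sum_i charges S i = 0.

Local Notation im := (images M).
Local Notation g := (image_factor S).
Local Notation q := (charges S).
Local Notation b := (freq S alpha).
Local Notation wnum := (@wavenum _ _ S alpha).
Local Notation d := (mesh alpha Lz).
Local Notation phase i j n := (expi (dot (hvec S n) (rvec S i - rvec S j))).

Lemma mesh_gt0 : 0 < d.
Proof. by rewrite divr_gt0 ?pi_gt0// mulr_gt0. Qed.

(** The node [t = k * mesh] satisfies [2 * alpha * t = 2 * pi * k / Lz], the third component of the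
    reciprocal vector, so that [(n, k)] indexes both the nodes and the reciprocal lattice. *)
Definition node (i j : 'I_N) (p : int * int * int) : R[i] :=
  phase i j p.1 * fourier_integrand S M alpha i j p.1 (p.2%:~R * d).

Lemma normc_GammaM i j t : Normc.normc (GammaM S M alpha i j t) <= abs_image_sum M S.
Proof.
rewrite GammaME (le_trans (normc_sum _ _ _))//; apply: ler_sum => p _.
by rewrite normcM normc_expi mulr1 normcR.
Qed.

Lemma normc_node i j p : Normc.normc (node i j p) <=
  abs_image_sum M S * screened (wnum p.1) (p.2%:~R * d).
Proof.
rewrite normcM normc_expi mul1r fourier_integrandE normcM normcR.
by rewrite (ger0_norm (screened_ge0 _ _)) mulrC ler_wpM2r ?screened_ge0// normc_GammaM.
Qed.

Lemma abs_summable_screened :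
  abs_summable nonzero3 (fun p : int * int * int => screened (wnum p.1) (p.2%:~R * d)).
Proof.
have d0 := mesh_gt0; have w0 := wavenum_min_gt0 Lx_gt0 alpha_gt0.
(* A lower bound for the denominator [a ^+ 2 + t ^+ 2] off the origin: either [n] is nonzero and [a]
   is at least the smallest wave number, or [k] is nonzero and [|t| >= d]. *)
pose m := Num.min (wavenum_min S alpha ^+ 2) (d ^+ 2).
have m0 : 0 < m by rewrite lt_min !exprn_gt0.
have s : abs_summable nonzero3 (fun p : int * int * int =>
    m^-1 * expR 1 * (expR (- wnum p.1) * expR (- (p.2%:~R * d) ^+ 2))).
  apply: abs_summableS (@subsetT _ _) _; rewrite -setXTT; apply: abs_summableZ.
  exact: (abs_summable_prod (abs_summable_expR_wavenum Lx_gt0 Ly_gt0 alpha_gt0) (abs_summable_gauss d0)).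
apply: (abs_summable_le s) => -[n k] nk /=; rewrite ger0_norm ?screened_ge0// /screened.
rewrite expRD mulrC -[leRHS]mulrA [leRHS]mulrCA; set t := k%:~R * d.
have e1 : expR (- wnum n ^+ 2) * expR (- t ^+ 2) <=
    expR 1 * (expR (- wnum n) * expR (- t ^+ 2)).
  rewrite mulrA ler_wpM2r ?expR_ge0// -expRD ler_expR.
  by have := sqr_ge0 (wnum n - 1); nra.
rewrite [leRHS]mulrCA ler_pM ?invr_ge0 ?addr_ge0 ?sqr_ge0 ?mulr_ge0 ?expR_ge0//.
have le : m <= wnum n ^+ 2 + t ^+ 2.
  have [n0|] := eqVneq n (0, 0); last first.
    move=> n0; rewrite ge_min; apply/orP; left.
    have h : wavenum_min S alpha <= wnum n by exact: wavenum_min_le.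
    rewrite (@le_trans _ _ (wnum n ^+ 2)) ?lerDl ?sqr_ge0//.
    by rewrite lerXn2r// nnegrE ?(ltW w0)// (le_trans (ltW w0)).
  have k0 : k != 0 by apply: contraNneq nk => k0; rewrite n0 k0.
  have k1 : 1 <= `|k%:~R| :> R by rewrite -intr_norm ler1z -gtz0_ge1 normr_gt0.
  rewrite ge_min; apply/orP; right; rewrite (@le_trans _ _ (t ^+ 2)) ?lerDr ?sqr_ge0//.
  have -> : t ^+ 2 = `|k%:~R| ^+ 2 * d ^+ 2 by rewrite real_normK ?num_real// -exprMn.
  by rewrite ler_peMl ?sqr_ge0// exprn_ege1.
by rewrite lef_pV2 ?posrE// (lt_le_trans m0).
Qed.

Lemma csummable_node i j : csummable nonzero3 (node i j).
Proof.
apply: (csummable_le (abs_summableZ (abs_image_sum M S) abs_summable_screened)) => p _.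
exact: normc_node.
Qed.

(** The reciprocal vector has squared length [4 * alpha ^+ 2 * (a ^+ 2 + t ^+ 2)], so its kernel is
    the screened kernel at the node, and the two phases combine to the phase of each image. *)
Lemma ktermE n k : kterm S M alpha Lz (n, k) =
  (4 * alpha ^+ 2)^-1%:C * (\sum_i \sum_j (q i * q j)%:C * node i j (n, k)).
Proof.
have a0 : alpha != 0 by rewrite gt_eqF.
have z0 : Lz != 0 by rewrite gt_eqF.
have x0 : Lx S != 0 by rewrite gt_eqF.
have y0 : Ly S != 0 by rewrite gt_eqF.
set t := k%:~R * d.
have kE : enorm (kvec S Lz (n, k)) ^+ 2 = 4 * alpha ^+ 2 * (wnum n ^+ 2 + t ^+ 2).
  rewrite /kvec scale_vec3 enorm_vec3_sqr/= -hnorm_sqr wavenum_sqr /t /mesh.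
  by field; rewrite z0 a0.
have sE : expR (- (enorm (kvec S Lz (n, k)) ^+ 2 / (4 * alpha ^+ 2))) / enorm (kvec S Lz (n, k)) ^+ 2 =
    (4 * alpha ^+ 2)^-1 * screened (wnum n) t.
  have c0 : 4 * alpha ^+ 2 != 0 by rewrite mulf_neq0// sqrf_eq0.
  by rewrite kE mulrAC mulfV// mul1r opprD /screened invfM; ring.
rewrite /kterm sE realCM -!mulrA; congr (_ * _).
have -> : rhobar S M (kvec S Lz (n, k)) = \sum_j (q j)%:C * (\sum_(p <- im)
    (g p)%:C * expi (- dot (kvec S Lz (n, k)) (vec3 (xpos S j) (ypos S j) (image_z S p j)))).
  apply: eq_bigr => j _; rewrite sum_images image_factor0 mul1r image_z0//.
rewrite /rho mulr_suml mulr_sumr; apply: eq_bigr => i _.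
rewrite mulr_sumr mulr_sumr; apply: eq_bigr => j _.
rewrite /node /= fourier_integrandE GammaME realCM.
have key : expi (dot (kvec S Lz (n, k)) (rvec S i)) * (\sum_(p <- im)
    (g p)%:C * expi (- dot (kvec S Lz (n, k)) (vec3 (xpos S j) (ypos S j) (image_z S p j)))) =
    phase i j n * (\sum_(p <- im) (g p)%:C * expi (b i j p * t)).
  rewrite mulr_sumr mulr_sumr; apply: eq_bigr => p _.
  rewrite mulrCA [RHS]mulrCA -!expiD; congr (_ * expi _).
  rewrite /kvec /hvec /rvec !scale_vec3 sub_vec3 !dot_vec3/= /freq /image_dist /t /mesh.
  by field; rewrite z0 a0 x0 y0.
rewrite [X in _ * X]mulrACA key; ring.
Qed.

Lemma csummable_kterm : csummable nonzero3 (kterm S M alpha Lz).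
Proof.
apply: (@eq_csummable _ _ _ (fun p => (4 * alpha ^+ 2)^-1%:C *
    (\sum_i \sum_j (q i * q j)%:C * node i j p))) => [[n k] _|].
  by rewrite ktermE.
apply: csummableZ; apply: csummable_sum => i; apply: csummable_sum => j; apply: csummableZ.
exact: csummable_node.
Qed.

Lemma trapezoid_summable_fourier i j n : nonzero2 n ->
  trapezoid_summable d (fourier_integrand S M alpha i j n).
Proof.
move=> n0; have a0 := wavenum_gt0 Lx_gt0 Ly_gt0 alpha_gt0 n0.
have s : abs_summable [set: int] (fun k : int => abs_image_sum M S * screened_cos (wnum n) 0 (k%:~R * d)).
  by apply: abs_summableZ; apply: abs_summable_screened_cos => //; exact: mesh_gt0.
apply: (csummable_le s) => k _; have := normc_node i j (n, k).
by rewrite normcM normc_expi mul1r /screened_cos mul0r cos0 mulr1.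
Qed.

Let nz2T : set (int * int * int) := nonzero2 `*` [set: int].

Let sub_nz2T : nz2T `<=` nonzero3.
Proof. by move=> [n k] /= [n0 _]; move: n0; apply: contraNN => /eqP[-> _]. Qed.

Let csum_nz2T i j : csummable nonzero2 (fourier_term_trapezoid S M alpha Lz i j) /\
  csum nonzero2 (fourier_term_trapezoid S M alpha Lz i j) = d%:C * csum nz2T (node i j).
Proof.
have [s e] := csum_fubini (csummableS sub_nz2T (csummable_node i j)).
have eq n : nonzero2 n -> d%:C * csum [set: int] (fun k => node i j (n, k)) =
    fourier_term_trapezoid S M alpha Lz i j n.
  move=> n0; rewrite /node /= csumZ; last exact: trapezoid_summable_fourier.
  by rewrite mulrCA.
split; first exact: eq_csummable eq (csummableZ d%:C s).
by rewrite e -csumZ//; apply: eq_csum => n n0; rewrite eq.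
Qed.

Lemma csummable_fourier_term_trapezoid i j :
  csummable nonzero2 (fourier_term_trapezoid S M alpha Lz i j).
Proof. by have [] := csum_nz2T i j. Qed.

Let zero_modes : set (int * int * int) := [set (0, 0)] `*` [set k | k != 0].

Let sub_zero_modes : zero_modes `<=` nonzero3.
Proof. by move=> [n k] /= [_]; apply: contraNN => /eqP[_ ->]. Qed.

Let node0 i j k : node i j ((0, 0), k) = fourier_integrand S M alpha i j (0, 0) (k%:~R * d).
Proof.
rewrite /node /= /hvec /= !mul0r scale_vec3 !mulr0 sub_vec3 dot_vec3 !mul0r !addr0 expi0.
by rewrite mul1r.
Qed.

Let csum_zero_modes i j : csum zero_modes (node i j) =
  csum [set k : int | k != 0] (fun k => fourier_integrand S M alpha i j (0, 0) (k%:~R * d)).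
Proof.
have [_ ->] := csum_fubini (csummableS sub_zero_modes (csummable_node i j)).
rewrite csum_set1; by apply: eq_csum => k _; exact: node0.
Qed.

Let sum_csum_zero_modes : \sum_i \sum_j (q i * q j)%:C * csum zero_modes (node i j) =
  csum [set k : int | k != 0] (fun k => extend0 (J0_total_integrand S M alpha) (k%:~R * d)).
Proof.
have s i j : csummable [set k : int | k != 0]
    (fun k => fourier_integrand S M alpha i j (0, 0) (k%:~R * d)).
  have := csummable_section (i := (0, 0)) (csummableS sub_zero_modes (csummable_node i j)) erefl.
  by apply: eq_csummable => k _; exact: node0.
under eq_bigr do under eq_bigr do rewrite csum_zero_modes -csumZ//.
rewrite (eq_bigr (fun i => csum [set k : int | k != 0] (fun k => \sum_j (q i * q j)%:C *
  fourier_integrand S M alpha i j (0, 0) (k%:~R * d)))); last first.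
  by move=> i _; rewrite csum_sum// => j; exact: csummableZ.
rewrite -csum_sum; last by move=> i; apply: csummable_sum => j; exact: csummableZ.
apply: eq_csum => k k0; have t0 : k%:~R * d != 0.
  by apply: mulf_neq0; [rewrite intr_eq0|rewrite gt_eqF// mesh_gt0].
rewrite /extend0 (negbTE t0); set t := k%:~R * d.
(* The constant [GammaM] at [0] subtracted in [J0_integrand] is the same for all pairs, so at a node
   other than [t = 0] it may be added back by neutrality. *)
have zero : 0 = \sum_i \sum_j (q i * q j)%:C * (t ^- 2 * image_charge M S)%:C.
  by rewrite realC_pair_sum pair_sum_left.
rewrite -[RHS]addr0 [X in _ = _ + X]zero /J0_total_integrand -big_split; apply: eq_bigr => i _; rewrite -big_split; apply: eq_bigr => j _ /=.
rewrite -mulrDr; congr (_ * _).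
rewrite fourier_integrandE /screened /wavenum hnorm0 mul0r expr0n/= oppr0 !add0r.
rewrite /J0_integrand GammaM0 // realCM -realC_inv mulrC realCM; ring.
Qed.

Lemma csummable_trapezoid_J0 :
  trapezoid_summable d (extend0 (J0_total_integrand S M alpha)).
Proof. exact: trapezoid_summable_J0 mesh_gt0. Qed.

(** The nodes split into those with [h] nonzero, those with [h = 0] and [k] nonzero, and the origin.
    The first two make up the reciprocal sum. The third is supplied by the value of [extend0] at
    [0]. *)
Lemma U_trapezoidE : U_trapezoid S M alpha Lz =
  U_reciprocal S M alpha Lz - U_self S alpha + U_IBC S M Lz.
Proof.
have a0 : alpha != 0 by rewrite gt_eqF.
have z0 : Lz != 0 by rewrite gt_eqF.
have x0 : Lx S != 0 by rewrite gt_eqF.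
have y0 : Ly S != 0 by rewrite gt_eqF.
have split3 i j : csum nonzero3 (node i j) = csum nz2T (node i j) + csum zero_modes (node i j).
  rewrite (csumID [set p | p.1 != (0, 0)] (csummable_node i j)).
  have -> : nonzero3 `&` [set p | p.1 != (0, 0)] = nz2T.
    apply/seteqP; split => -[n k] /=; first by case.
    by move=> h; split; [exact: sub_nz2T|case: h].
  have -> // : nonzero3 `&` ~` [set p | p.1 != (0, 0)] = zero_modes.
  apply/seteqP; split => -[n k] /=; last first.
    by move=> h; split; [exact: sub_zero_modes|case: h => /= -> _; rewrite eqxx].
  move=> [h /negP]; rewrite negbK => /eqP n0; split => //.
  by move: h; apply: contraNneq => /= k0; rewrite n0 k0.
pose c : R := 1 / (2 * alpha * Lx S * Ly S).
pose ext := fun k : int => extend0 (J0_total_integrand S M alpha) (k%:~R * d).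
have extID : csum [set: int] ext = ext 0 + csum [set k : int | k != 0] ext.
  rewrite (csumID [set 0] csummable_trapezoid_J0) !setTI csum_set1; congr (_ + csum _ _).
  by apply/seteqP; split => k /= /eqP.
have ext0 : c%:C * d%:C * ext 0 = U_IBC S M Lz.
  rewrite /ext mul0r extend0_J0_total0// /U_IBC -!realCM; congr (_ %:C).
  have -> : \sum_j q j * image_moment M S j = \sum_j q j * (zpos S j +
      \sum_(1 <= l < M.+1) (gamma_p S l * z_p S l j + gamma_m S l * z_m S l j)).
    apply: eq_bigr => j _; congr (_ * _).
    by rewrite /image_moment /image_sum sum_images image_factor0 mul1r image_z0.
  by rewrite /c /mesh; field; rewrite a0 x0 y0 z0.
have recip : U_reciprocal S M alpha Lz = c%:C * d%:C *
    \sum_i \sum_j (q i * q j)%:C * csum nonzero3 (node i j).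
  rewrite /U_reciprocal (eq_csum (g := fun p => (4 * alpha ^+ 2)^-1%:C *
    (\sum_i \sum_j (q i * q j)%:C * node i j p))); last by move=> [n k] _; exact: ktermE.
  have s i j : csummable nonzero3 (fun p => (q i * q j)%:C * node i j p).
    by apply: csummableZ; exact: csummable_node.
  rewrite csumZ; last by apply: csummable_sum => i; exact: csummable_sum.
  rewrite csum_sum; last by move=> i; exact: csummable_sum.
  under eq_bigr do rewrite csum_sum//.
  rewrite mulrA -!realCM; congr (_ * _); last first.
    apply: eq_bigr => i _; apply: eq_bigr => j _; rewrite csumZ//; exact: csummable_node.
  congr (_ %:C).
  by rewrite /c /mesh; field; rewrite a0 x0 y0 z0.
rewrite /U_trapezoid /J0_trapezoid /trapezoid -/c -/ext extID mulrDr mulrDr mulrA ext0 recip.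
have -> : \sum_i \sum_j (q i * q j)%:C * csum nonzero3 (node i j) =
    \sum_i \sum_j (q i * q j)%:C * csum nz2T (node i j) + csum [set k : int | k != 0] ext.
  rewrite -sum_csum_zero_modes -big_split; apply: eq_bigr => i _; rewrite -big_split.
  by apply: eq_bigr => j _; rewrite split3 mulrDr.
have -> : \sum_i \sum_j (q i * q j)%:C * csum nonzero2 (fourier_term_trapezoid S M alpha Lz i j) =
    d%:C * \sum_i \sum_j (q i * q j)%:C * csum nz2T (node i j).
  rewrite mulr_sumr; apply: eq_bigr => i _; rewrite mulr_sumr; apply: eq_bigr => j _.
  by have [_ ->] := csum_nz2T i j; rewrite mulrCA.
ring.
Qed.

Lemma U_trapezoid_cvg : U_trapezoid_converges S M alpha Lz.
Proof.
split; [exact: trapezoid_summable_fourier|exact: csummable_fourier_term_trapezoid| |].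
  exact: ccvg_J0_total.
exact: csummable_trapezoid_J0.
Qed.

End reciprocal_sum.

(** * Truncation errors *)

Lemma mem_images (M : nat) (p : nat * bool) : p \in images M -> (p.1 <= M)%N.
Proof.
rewrite /images in_cons => /orP[/eqP->//|/allpairsP[[l b'] [/= lM _ ->]]].
by move: lM; rewrite mem_index_iota ltnS => /andP[].
Qed.

Section truncation_errors.
Context {R : realType} {N : nat} (M : nat) (S : sandwich R N) (alpha : R).
Hypotheses (Lx_gt0 : 0 < Lx S) (Ly_gt0 : 0 < Ly S) (H_gt0 : 0 < height S) (alpha_gt0 : 0 < alpha).
Hypothesis inside : forall i, 0 < zpos S i < height S.

Local Notation H := (height S).
Local Notation im := (images M).
Local Notation g := (image_factor S).
Local Notation q := (charges S).
Local Notation b := (freq S alpha).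
Local Notation wnum := (@wavenum _ _ S alpha).
Local Notation isum := (@image_sum _ _ M S).
Local Notation phase i j n := (expi (dot (hvec S n) (rvec S i - rvec S j))).
Local Notation h_min := (@hmin _ _ S).

(* Both bounds of the theorem have this shape, with [e] exponential and Gaussian respectively. *)
Definition image_bound (e : R -> R) (Lz : R) : R :=
  \sum_(p <- im) `|g p| * e (Lz - p.1.+1%:R * H).

Lemma image_boundE e Lz : image_bound e Lz = e (Lz - H) +
  \sum_(1 <= l < M.+1) (`|gamma_p S l| + `|gamma_m S l|) * e (Lz - l.+1%:R * H).
Proof.
rewrite /image_bound sum_images image_factor0 normr1 !mul1r; congr (_ + _).
by apply: eq_bigr => l _; rewrite mulrDl.
Qed.

Lemma image_bound_ge0 e Lz : (forall u, 0 <= e u) -> 0 <= image_bound e Lz.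
Proof. by move=> e0; apply: sumr_ge0 => p _; rewrite mulr_ge0. Qed.

Lemma normr_image_sum_le (F : nat * bool -> R) (C : R) (e : R -> R) Lz :
  (forall p, (p.1 <= M)%N -> `|F p| <= C * e (Lz - p.1.+1%:R * H)) ->
  `|isum F| <= C * image_bound e Lz.
Proof.
move=> FC; rewrite (le_trans (ler_norm_sum _ _ _))// mulr_sumr big_seq [leRHS]big_seq.
apply: ler_sum => p /mem_images pM; rewrite normrM mulrCA ler_wpM2l//; exact: FC.
Qed.

Lemma ELC_termE Lz i j n : ELC_term S M Lz i j n = phase i j n *
  (isum (fun p => cosh (hnorm S n * image_dist S i j p) / (hnorm S n * (1 - expR (hnorm S n * Lz)))))%:C.
Proof.
rewrite /ELC_term -realC_inv -mulrA -realCM; congr (_ * (_ %:C)).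
have -> : cosh (hnorm S n * (zpos S i - zpos S j)) + calG S M i j (hnorm S n) =
    isum (fun p => cosh (hnorm S n * image_dist S i j p)).
  by rewrite /image_sum sum_images image_factor0 mul1r /image_dist image_z0.
rewrite mulrA mulrAC -invfM /image_sum mulr_sumr; apply: eq_bigr => p _.
by rewrite mulrC mulrA.
Qed.

Lemma cosh_le (u v : R) : `|u| <= v -> `|cosh u| <= expR v.
Proof.
rewrite ler_norml => /andP[uv1 uv2]; rewrite /cosh.
rewrite ger0_norm ?divr_ge0 ?addr_ge0 ?expR_ge0// ler_pdivrMr//.
have h1 : expR u <= expR v by rewrite ler_expR.
have h2 : expR (- u) <= expR v by rewrite ler_expR; lra.
lra.
Qed.

(** For [h >= h_min] and [Lz > H] one has [expR (h * Lz) - 1 >= (1 - expR (- (h_min * H))) * expR (h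
    * Lz)], so this constant accounts for the denominator uniformly in [h] and [Lz]. *)
Let elc_const : R := (h_min * (1 - expR (- (h_min * H))))^-1.

Let elc_den_gt0 : 0 < h_min * (1 - expR (- (h_min * H))).
Proof.
have m0 := hmin_gt0 Lx_gt0.
by rewrite mulr_gt0// subr_gt0 -[ltRHS]expR0 ltr_expR oppr_lt0 mulr_gt0.
Qed.

Lemma elc_summand_le Lz i j n p : H < Lz -> nonzero2 n ->
  `|cosh (hnorm S n * image_dist S i j p) / (hnorm S n * (1 - expR (hnorm S n * Lz)))| <=
  elc_const * expR (- (hnorm S n * (Lz - p.1.+1%:R * H))).
Proof.
move=> HL n0; set h := hnorm S n; have h0 : 0 < h by exact: hnorm_gt0.
have m0 := hmin_gt0 Lx_gt0; have mh : h_min <= h by exact: hmin_le.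
have cD : `|cosh (h * image_dist S i j p)| <= expR (h * (p.1.+1%:R * H)).
  apply: cosh_le; rewrite normrM (gtr0_norm h0) ler_wpM2l ?(ltW h0)//.
  exact: normr_image_dist.
have E0 := expR_gt0 (h * Lz).
have den : h_min * (1 - expR (- (h_min * H))) * expR (h * Lz) <= `|h * (1 - expR (h * Lz))|.
  have d1 : 0 <= 1 - expR (- (h_min * H)) by move: elc_den_gt0; rewrite pmulr_rgt0// => /ltW.
  rewrite normrM (gtr0_norm h0) -mulrA ler_pM ?(ltW m0)//; first by rewrite mulr_ge0// ltW.
  rewrite distrC mulrBl mul1r (le_trans _ (ler_norm _))// lerB//.
  rewrite -expRD -[leLHS]expR0 ler_expR addrC subr_ge0.
  by rewrite ler_pM ?(ltW m0) ?(ltW H_gt0) ?(ltW HL).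
have den0 := mulr_gt0 elc_den_gt0 E0.
rewrite normrM normfV.
have -> : elc_const * expR (- (h * (Lz - p.1.+1%:R * H))) =
    expR (h * (p.1.+1%:R * H)) / (h_min * (1 - expR (- (h_min * H))) * expR (h * Lz)).
  have -> : expR (- (h * (Lz - p.1.+1%:R * H))) = expR (h * (p.1.+1%:R * H)) / expR (h * Lz).
    by rewrite -expRN -expRD; congr expR; ring.
  by rewrite invfM -/elc_const mulrCA.
by rewrite ler_pM ?invr_ge0// lef_pV2 ?posrE// (lt_le_trans den0).
Qed.

Lemma csummable_ELC Lz : M.+1%:R * H < Lz -> U_ELC_converges S M Lz.
Proof.
move=> ML i j; have H1 : H <= M.+1%:R * H by rewrite ler_peMl ?(ltW H_gt0)// ler1n.
have s0 : 0 < Lz - M.+1%:R * H by rewrite subr_gt0.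
pose e u := expR (- ((Lz - M.+1%:R * H) * hnorm S u)).
have s : abs_summable nonzero2 (fun n => elc_const * abs_image_sum M S * e n).
  apply: abs_summableS (@subsetT _ _) _; apply: abs_summableZ; exact: abs_summable_expR_hnorm.
apply: (csummable_le s) => n n0; rewrite ELC_termE normcM normc_expi mul1r normcR.
rewrite mulrAC [leRHS](_ : _ = elc_const * e n * image_bound (fun=> 1) Lz); last first.
  by rewrite /image_bound; under eq_bigr do rewrite mulr1.
apply: normr_image_sum_le => p pM; rewrite mulr1 (le_trans (elc_summand_le _ _ _ _ n0)) ?(le_lt_trans H1)//.
rewrite ler_wpM2l ?invr_ge0 ?(ltW elc_den_gt0)// ler_expR lerN2 mulrC ler_wpM2l ?hnorm_ge0//.
by rewrite lerB// ler_wpM2r ?(ltW H_gt0)// ler_nat.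
Qed.

Let elc_exp u : R := expR (- (2 * pi * u / Num.max (Lx S) (Ly S))).

Let hsum : R := rsum nonzero2 (fun n => expR (- hnorm S n)).

Let summable_h : abs_summable nonzero2 (fun n => expR (- hnorm S n)).
Proof.
have s1 := abs_summable_expR_hnorm Lx_gt0 Ly_gt0 (@ltr01 R).
apply: (abs_summableS (@subsetT _ _)); apply: eq_abs_summable s1 => n _.
by rewrite mul1r.
Qed.

Lemma normc_csum_ELC Lz i j : M.+1%:R * H + 1 <= Lz ->
  Normc.normc (csum nonzero2 (ELC_term S M Lz i j)) <=
  2 * (elc_const * expR h_min * image_bound elc_exp Lz * hsum).
Proof.
move=> ML; have H1 : H <= M.+1%:R * H by rewrite ler_peMl ?(ltW H_gt0)// ler1n.
have HL : H < Lz by lra.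
rewrite -rsumZ//; apply: normc_csum; first exact: abs_summableZ.
move=> n n0; rewrite ELC_termE normcM normc_expi mul1r normcR.
rewrite [leRHS]mulrAC; apply: normr_image_sum_le => p pM.
rewrite (le_trans (elc_summand_le _ _ _ HL n0))// -!mulrA ler_wpM2l ?invr_ge0 ?(ltW elc_den_gt0)//.
have p1 : p.1.+1%:R * H <= M.+1%:R * H by rewrite ler_wpM2r ?(ltW H_gt0)// ler_nat.
rewrite /elc_exp -!expRD ler_expR.
have -> : 2 * pi * (Lz - p.1.+1%:R * H) / Num.max (Lx S) (Ly S) = h_min * (Lz - p.1.+1%:R * H).
  by rewrite /hmin mulrAC.
have mh := hmin_le Lx_gt0 Ly_gt0 n0.
(* With [u = Lz - (l + 1) * H >= 1], this gives [h * u >= h_min * u + h - h_min]: the rate [h_min]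
   is extracted while [expR (- h)] is kept for the sum over the modes. *)
have : 0 <= (hnorm S n - h_min) * (Lz - p.1.+1%:R * H - 1) by rewrite mulr_ge0 ?subr_ge0//; lra.
lra.
Qed.

Lemma normc_U_ELC Lz : M.+1%:R * H + 1 <= Lz ->
  Normc.normc (U_ELC S M Lz) <= `|2 * pi / (Lx S * Ly S)| *
   (\sum_i \sum_j `|q i * q j|) * (2 * elc_const * expR h_min * hsum) * image_bound elc_exp Lz.
Proof.
move=> ML; rewrite /U_ELC normcM normcR -!mulrA ler_wpM2l//.
rewrite (le_trans (normc_sum _ _ _))// mulr_suml; apply: ler_sum => i _.
rewrite (le_trans (normc_sum _ _ _))// mulr_suml; apply: ler_sum => j _.
rewrite normcM normcR ler_wpM2l// (le_trans (normc_csum_ELC i j ML))// le_eqVlt.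
by apply/orP; left; apply/eqP; ring.
Qed.

Lemma eqO_pinfty (f B : R -> R) (C : R) :
  (\forall Lz \near +oo, `|f Lz| <= C * B Lz) -> (forall Lz, 0 <= B Lz) ->
  f =O_ (pinfty_nbhs R) B.
Proof.
move=> fB B0; apply/eqO_exP; exists (`|C| + 1); first by rewrite ltr_wpDl.
apply: filterS fB => Lz h; rewrite (le_trans h)// (ger0_norm (B0 _)) ler_wpM2r//.
by rewrite (le_trans (ler_norm _))// lerDl.
Qed.

Lemma eqO_U_ELC : (fun Lz : R => Normc.normc (U_ELC S M Lz)) =O_ (pinfty_nbhs R)
  (fun Lz : R => image_bound elc_exp Lz).
Proof.
apply: (@eqO_pinfty _ _ (`|2 * pi / (Lx S * Ly S)| *
   (\sum_i \sum_j `|q i * q j|) * (2 * elc_const * expR h_min * hsum))).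
  near=> Lz; rewrite (ger0_norm (normc_ge0 _)) normc_U_ELC//.
by move=> Lz; apply: image_bound_ge0 => u; exact: expR_ge0.
Unshelve. all: by end_near. Qed.

Section mesh.
Variable Lz : R.
Hypothesis Lz_large : M.+1%:R * H + alpha^-1 <= Lz.

Local Notation d := (mesh alpha Lz).

Let err_exp u : R := expR (- (alpha ^+ 2 * u ^+ 2)).

Let Lz_gt0 : 0 < Lz.
Proof. by rewrite (lt_le_trans _ Lz_large)// ltr_pwDr ?invr_gt0// mulr_ge0 ?ltW. Qed.

Let d_gt0 : 0 < d. Proof. exact: mesh_gt0. Qed.

Let period : 2 * pi / d = 2 * alpha * Lz.
Proof.
have p0 : pi != 0 :> R by rewrite gt_eqF ?pi_gt0.
rewrite /mesh invf_div (_ : _ * _ = 2 * alpha * Lz * (pi / pi)); last by ring.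
by rewrite mulfV// mulr1.
Qed.

Let freq_le i j p : `|b i j p| <= 2 * alpha * (p.1.+1%:R * H).
Proof.
rewrite /freq normrM ger0_norm ?mulr_ge0 ?(ltW alpha_gt0)//.
by rewrite ler_wpM2l ?mulr_ge0 ?(ltW alpha_gt0)// normr_image_dist.
Qed.

Let order_le (p : nat * bool) : (p.1 <= M)%N -> p.1.+1%:R * H <= M.+1%:R * H.
Proof. by move=> pM; rewrite ler_wpM2r ?(ltW H_gt0)// ler_nat. Qed.

(** The summand [alpha^-1] in [Lz_large], multiplied by [2 * alpha], is exactly the distance 2 that
    the trapezoidal estimates require. *)
Let gap i j p : (p.1 <= M)%N -> 2 <= 2 * pi / d - `|b i j p|.
Proof.
move=> pM; have h1 := freq_le i j p; have h2 := order_le pM.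
have h3 : 2 * alpha * (M.+1%:R * H + alpha^-1) <= 2 * alpha * Lz.
  by rewrite ler_wpM2l ?mulr_ge0 ?(ltW alpha_gt0).
have h4 : 2 * alpha * (p.1.+1%:R * H) <= 2 * alpha * (M.+1%:R * H).
  by rewrite ler_wpM2l ?mulr_ge0 ?(ltW alpha_gt0).
have e : 2 * alpha * alpha^-1 = 2 by rewrite -mulrA mulfV ?mulr1// gt_eqF.
by move: h3; rewrite mulrDr e period; lra.
Qed.

Let gauss_gap_le i j p : (p.1 <= M)%N ->
  expR (- ((2 * pi / d - `|b i j p|) ^+ 2 / 4)) <= err_exp (Lz - p.1.+1%:R * H).
Proof.
move=> pM; rewrite /err_exp ler_expR lerN2 period.
have h0 : 0 <= Lz - p.1.+1%:R * H.
  have := order_le pM; have : 0 < alpha^-1 by rewrite invr_gt0.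
  by move: Lz_large; lra.
have -> : alpha ^+ 2 * (Lz - p.1.+1%:R * H) ^+ 2 =
    (2 * alpha * Lz - 2 * alpha * (p.1.+1%:R * H)) ^+ 2 / 4 by field.
have h1 := freq_le i j p.
have h2 : 0 <= 2 * alpha * Lz - 2 * alpha * (p.1.+1%:R * H).
  by rewrite -mulrBr mulr_ge0// mulr_ge0// ltW.
by rewrite ler_wpM2r// lerXn2r ?nnegrE//; lra.
Qed.

Lemma trapezoid_fourier i j n : nonzero2 n ->
  trapezoid d (fourier_integrand S M alpha i j n) = (isum (fun p =>
    d * rsum [set: int] (fun k : int => screened_cos (wnum n) (b i j p) (k%:~R * d))))%:C.
Proof.
move=> n0; have a0 := wavenum_gt0 Lx_gt0 Ly_gt0 alpha_gt0 n0; rewrite /trapezoid.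
have -> : csum [set: int] (fun k : int => fourier_integrand S M alpha i j n (k%:~R * d)) =
   (isum (fun p => rsum [set: int] (fun k : int => screened_cos (wnum n) (b i j p) (k%:~R * d))))%:C.
  apply: eq_complexP => /=.
    under eq_fun do rewrite Re_fourier_integrand.
    by rewrite rsum_image_sum// => p; exact: abs_summable_screened_cos.
  apply: rsum_odd => k; rewrite !Im_fourier_integrand -image_sumN.
  by apply: eq_bigr => p _; rewrite rmorphN mulNr screened_sinN.
by rewrite -realCM -image_sumZ.
Qed.

(** The factor [4 * pi * alpha] turns the common prefactor [1 / (2 * alpha * Lx * Ly)] into that of
    [U_ELC]. The denominator [1 - expR (h * Lz)] is negative, so subtracting the term adds back the
    geometric series. *)
Let term_error i j n : R[i] := fourier_term S M alpha i j n -
  fourier_term_trapezoid S M alpha Lz i j n - (4 * pi * alpha)%:C * ELC_term S M Lz i j n.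

Lemma normc_term_error i j n : nonzero2 n -> Normc.normc (term_error i j n) <=
  4 * tail_const / wavenum_min S alpha * expR (- wnum n) * image_bound err_exp Lz.
Proof.
move=> n0; have a0 := wavenum_gt0 Lx_gt0 Ly_gt0 alpha_gt0 n0.
have h0 := hnorm_gt0 Lx_gt0 Ly_gt0 n0.
pose a := wnum n.
pose E p := d * rsum [set: int] (fun k : int => screened_cos a (b i j p) (k%:~R * d)) -
  screened_fourier a (b i j p) - pi / a * (expR (a * b i j p) + expR (- (a * b i j p))) /
    (expR (a * (2 * pi / d)) - 1).
have -> : term_error i j n = phase i j n * (isum (fun p => - E p))%:C.
  rewrite /term_error /fourier_term /fourier_term_trapezoid cintegral_fourier_integrand//.
  rewrite trapezoid_fourier// ELC_termE mulrCA -realCM -!mulrBr -!realCN -!realCD.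
  congr (_ * _%:C); rewrite -image_sumZ -!image_sumN -!image_sumD.
  apply: eq_bigr => p _; congr (_ * _); rewrite /E period.
  have aL : a * (2 * alpha * Lz) = hnorm S n * Lz.
    by rewrite /a /wavenum; field; rewrite gt_eqF.
  have ab : a * b i j p = hnorm S n * image_dist S i j p.
    by rewrite /a /wavenum /freq; field; rewrite gt_eqF.
  have pa : pi / a = 2 * pi * alpha / hnorm S n.
    by rewrite /a /wavenum; field; rewrite !gt_eqF.
  rewrite aL ab pa /cosh.
  have e1 : expR (hnorm S n * Lz) - 1 != 0.
    by rewrite gt_eqF// subr_gt0 -[ltLHS]expR0 ltr_expR mulr_gt0.
  have -> : 1 - expR (hnorm S n * Lz) = - (expR (hnorm S n * Lz) - 1) by rewrite opprB.
  by rewrite /a; field; rewrite e1 gt_eqF.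
rewrite normcM normc_expi mul1r normcR; apply: normr_image_sum_le => p pM.
rewrite normrN (le_trans (screened_trapezoid_error a0 d_gt0 (gap i j pM)))//.
have t0 : 0 <= 4 * tail_const :> R by rewrite !mulr_ge0 ?pi_ge0 ?sqr_ge0.
have w0 := wavenum_min_gt0 Lx_gt0 alpha_gt0.
have wn := wavenum_min_le Lx_gt0 Ly_gt0 alpha_gt0 n0.
rewrite ler_pM ?gauss_gap_le ?expR_ge0// ?(mulr_ge0 _ (expR_ge0 _)) ?(divr_ge0 t0) ?(ltW a0)//.
by rewrite ler_wpM2r ?expR_ge0// ler_wpM2l// lef_pV2 ?posrE.
Qed.

Let wsum : R := rsum nonzero2 (fun n => expR (- wnum n)).

Let summable_w : abs_summable nonzero2 (fun n => expR (- wnum n)).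
Proof. exact: abs_summableS (@subsetT _ _) (abs_summable_expR_wavenum Lx_gt0 Ly_gt0 alpha_gt0). Qed.

Lemma normc_csum_error i j : Normc.normc (csum nonzero2 (term_error i j)) <=
  2 * (4 * tail_const / wavenum_min S alpha * image_bound err_exp Lz * wsum).
Proof.
rewrite -rsumZ//; apply: normc_csum; first exact: abs_summableZ.
by move=> n n0; rewrite (le_trans (normc_term_error i j n0))// mulrAC.
Qed.

Hypothesis neutral : \sum_i q i = 0.

(** By [U_trapezoidE] the remainder is the difference between integrals and trapezoidal sums, less
    [U_ELC], so it splits into one error per lateral mode. *)
Lemma U_errE : U_err S M alpha Lz = (1 / (2 * alpha * Lx S * Ly S))%:C *
  (\sum_i \sum_j (q i * q j)%:C * csum nonzero2 (term_error i j) +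
   (pair_sum S (fun i j => isum (fun p => - (d * rsum [set: int]
      (fun n : int => gauss_cosm1 (b i j p) (n%:~R * d)) - unscreened_fourier (b i j p)))))%:C).
Proof.
have ML : M.+1%:R * H < Lz.
  by rewrite (lt_le_trans _ Lz_large)// ltrDl invr_gt0.
have x0 : Lx S != 0 by rewrite gt_eqF.
have y0 : Ly S != 0 by rewrite gt_eqF.
have a0 : alpha != 0 by rewrite gt_eqF.
set c : R := 1 / (2 * alpha * Lx S * Ly S).
have split_term i j : csum nonzero2 (term_error i j) = csum nonzero2 (fourier_term S M alpha i j) -
   csum nonzero2 (fourier_term_trapezoid S M alpha Lz i j) -
   (4 * pi * alpha)%:C * csum nonzero2 (ELC_term S M Lz i j).
  have s1 := csummable_fourier_term M Lx_gt0 Ly_gt0 alpha_gt0 i j.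
  have s2 := csummable_fourier_term_trapezoid M Lx_gt0 Ly_gt0 Lz_gt0 alpha_gt0 i j.
  have s3 := csummable_ELC ML i j.
  rewrite -csumZ// -csumB// -csumB//; last exact: csummableZ.
  by apply: (eq_csummable _ (csummableD s1 (csummableZ (-1) s2))) => n _; rewrite mulN1r.
have elc : U_ELC S M Lz = c%:C * \sum_i \sum_j (q i * q j)%:C *
    ((4 * pi * alpha)%:C * csum nonzero2 (ELC_term S M Lz i j)).
  have -> : \sum_i \sum_j (q i * q j)%:C * ((4 * pi * alpha)%:C * csum nonzero2 (ELC_term S M Lz i j)) =
     (4 * pi * alpha)%:C * \sum_i \sum_j (q i * q j)%:C * csum nonzero2 (ELC_term S M Lz i j).
    rewrite mulr_sumr; apply: eq_bigr => i _; rewrite mulr_sumr; apply: eq_bigr => j _.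
    by rewrite mulrCA.
  rewrite mulrA -realCM; congr (_%:C * _); rewrite /c; field; by rewrite x0 y0 a0.
have trap := U_trapezoidE M Lx_gt0 Ly_gt0 Lz_gt0 alpha_gt0 neutral.
rewrite /U_err -trap elc /U_Fourier /U_trapezoid /J0_trapezoid trapezoid_J0// J0E// -/c.
have -> : \sum_i \sum_j (q i * q j)%:C * csum nonzero2 (term_error i j) =
   \sum_i \sum_j (q i * q j)%:C * csum nonzero2 (fourier_term S M alpha i j) -
   \sum_i \sum_j (q i * q j)%:C * csum nonzero2 (fourier_term_trapezoid S M alpha Lz i j) -
   \sum_i \sum_j (q i * q j)%:C * ((4 * pi * alpha)%:C * csum nonzero2 (ELC_term S M Lz i j)).
  rewrite -!sumrB; apply: eq_bigr => i _; rewrite -!sumrB; apply: eq_bigr => j _.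
  by rewrite split_term !mulrBr.
set P := pair_sum S (fun i j => isum (fun p => unscreened_fourier (b i j p))).
set Q := pair_sum S (fun i j => isum (fun p => d * rsum [set: int]
   (fun n : int => gauss_cosm1 (b i j p) (n%:~R * d)))).
have -> : pair_sum S (fun i j => isum (fun p => - (d * rsum [set: int]
      (fun n : int => gauss_cosm1 (b i j p) (n%:~R * d)) - unscreened_fourier (b i j p)))) = P - Q.
  rewrite -[X in P + X]mulN1r -pair_sumZ -pair_sumD; apply: eq_pair_sum => i j.
  by rewrite mulN1r -image_sumN -image_sumD; apply: eq_bigr => p _; congr (_ * _); ring.
have -> : (P - Q)%:C = P%:C - Q%:C by rewrite realCD realCN.
have -> : (c * P)%:C = c%:C * P%:C by rewrite realCM.
ring.
Qed.

Lemma normc_U_err : Normc.normc (U_err S M alpha Lz) <=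
  `|1 / (2 * alpha * Lx S * Ly S)| * (\sum_i \sum_j `|q i * q j|) *
  (2 * (4 * tail_const / wavenum_min S alpha * wsum) + 16 * Num.sqrt pi) * image_bound err_exp Lz.
Proof.
rewrite U_errE normcM normcR -[leRHS]mulrA -[leRHS]mulrA ler_wpM2l// (le_trans (normcD _ _))//.
rewrite [X in _ * X]mulrDl [leRHS]mulrDr lerD//.
  rewrite (le_trans (normc_sum _ _ _))// mulr_suml; apply: ler_sum => i _.
  rewrite (le_trans (normc_sum _ _ _))// mulr_suml; apply: ler_sum => j _.
  rewrite normcM normcR ler_wpM2l// (le_trans (normc_csum_error i j))// le_eqVlt.
  by apply/orP; left; apply/eqP; ring.
rewrite normcR (le_trans (ler_norm_sum _ _ _))// mulr_suml; apply: ler_sum => i _.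
rewrite (le_trans (ler_norm_sum _ _ _))// mulr_suml; apply: ler_sum => j _.
rewrite normrM ler_wpM2l//; apply: normr_image_sum_le => p pM; rewrite normrN.
rewrite (le_trans (unscreened_trapezoid_error d_gt0 (gap i j pM)))// ler_wpM2l ?mulr_ge0 ?sqrtr_ge0//.
exact: gauss_gap_le.
Qed.

End mesh.

End truncation_errors.

Theorem theorem3p3 (R : realType) (N M : nat) (S : sandwich R N) (alpha : R)
    (M_ge1 : (1 <= M)%N)
    (Lx_gt0 : 0 < Lx S) (Ly_gt0 : 0 < Ly S) (H_gt0 : 0 < height S)
    (alpha_gt0 : 0 < alpha)
    (neutral : \sum_i charges S i = 0)
    (inside : forall i, 0 < zpos S i < height S)
    (eps_top_wd : eps_c S + eps_top S != 0)
    (eps_bot_wd : eps_c S + eps_bot S != 0)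
    (gamma_top_le1 : `|gamma_top S| <= 1)
    (gamma_bot_le1 : `|gamma_bot S| <= 1) :
  [/\ U_Fourier_converges S M alpha,
      forall Lz : R, height S < Lz -> csummable nonzero3 (kterm S M alpha Lz) &
      forall Lz : R, M.+1%:R * height S < Lz -> U_ELC_converges S M Lz] /\
  (forall Lz : R, height S < Lz ->
     U_trapezoid_converges S M alpha Lz /\
     U_trapezoid S M alpha Lz =
       U_reciprocal S M alpha Lz - U_self S alpha + U_IBC S M Lz) /\
  (forall Lz : R, height S < Lz -> U_ELC_converges S M Lz ->
     U_Fourier S M alpha =
       U_reciprocal S M alpha Lz - U_self S alpha
       + U_IBC S M Lz + U_ELC S M Lz + U_err S M alpha Lz) /\
  ((fun Lz : R => Normc.normc (U_ELC S M Lz)) =O_ (pinfty_nbhs R)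
    (fun Lz : R =>
       expR (- (2 * pi * (Lz - height S) / Num.max (Lx S) (Ly S))) +
       \sum_(1 <= l < M.+1) (`|gamma_p S l| + `|gamma_m S l|) *
         expR (- (2 * pi * (Lz - l.+1%:R * height S) /
                  Num.max (Lx S) (Ly S))))) /\
  ((fun Lz : R => Normc.normc (U_err S M alpha Lz)) =O_ (pinfty_nbhs R)
    (fun Lz : R =>
       expR (- (alpha ^+ 2 * (Lz - height S) ^+ 2)) +
       \sum_(1 <= l < M.+1) (`|gamma_p S l| + `|gamma_m S l|) *
         expR (- (alpha ^+ 2 * (Lz - l.+1%:R * height S) ^+ 2)))).
Proof.
have Lz_gt0 Lz : height S < Lz -> 0 < Lz by exact: lt_trans.
split; first split.
- move=> i j; split=> [n n0||].
  + exact: cintegrable_fourier_integrand.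
  + exact: csummable_fourier_term.
  + exact: pv_integrable_J0.
- by move=> Lz HL; apply: csummable_kterm => //; exact: Lz_gt0.
- by move=> Lz ML; exact: csummable_ELC.
split.
  move=> Lz /Lz_gt0 L0; split; first exact: U_trapezoid_cvg.
  exact: U_trapezoidE.
(* Holds by the definition of [U_err] as a remainder; the content lies in the trapezoidal identity
   before it and in the estimates after it. *)
split; first by move=> Lz _ _; rewrite /U_err addrC subrK.
split.
  have -> : (fun Lz : R =>
       expR (- (2 * pi * (Lz - height S) / Num.max (Lx S) (Ly S))) +
       \sum_(1 <= l < M.+1) (`|gamma_p S l| + `|gamma_m S l|) *
         expR (- (2 * pi * (Lz - l.+1%:R * height S) / Num.max (Lx S) (Ly S)))) =
     image_bound M S (fun u => expR (- (2 * pi * u / Num.max (Lx S) (Ly S)))).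
    by apply/funext => Lz; rewrite image_boundE.
  exact: eqO_U_ELC.
have -> : (fun Lz : R =>
     expR (- (alpha ^+ 2 * (Lz - height S) ^+ 2)) +
     \sum_(1 <= l < M.+1) (`|gamma_p S l| + `|gamma_m S l|) *
       expR (- (alpha ^+ 2 * (Lz - l.+1%:R * height S) ^+ 2))) =
   image_bound M S (fun u => expR (- (alpha ^+ 2 * u ^+ 2))).
  by apply/funext => Lz; rewrite image_boundE.
apply: eqO_pinfty => [|Lz]; last by apply: image_bound_ge0 => u; exact: expR_ge0.
near=> Lz; rewrite (ger0_norm (normc_ge0 _)); apply: normc_U_err => //.
Unshelve. all: by end_near. Qed.
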